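(* Let $(M,g)$ be an orientable Riemannian manifold of dimension $m$; assume that there exists $f\in C^\infty(M)$ that solves the C-$\varphi$-PF system (for a given smooth map $\varphi:(M,g)\to(N,h)$ into a Riemannian manifold, a constant $\alpha\in\mathbb{R}\setminus\{0\}$, and functions $U\in C^\infty(N)$, $\mu,p\in C^\infty(M)$). Let the linear map $W^*_{|S^2_0}$ be injective. Then there exist two constants $\Lambda_1,\Lambda_2\in\mathbb{R}$ such that $f$ satisfies $$\begin{cases}\mathrm{Ric}^\varphi+\mathrm{Hess} f-df\otimes df=\lambda g,\\[0.1cm]\Delta_ff=\dfrac1{m-1}\left[S^\varphi-m(\mu+p)\right]+\Lambda_1e^f,\\[0.2cm]\tau(\varphi)=d\varphi(\nabla f)+\dfrac1\alpha(\nabla^hU)(\varphi),\\[0.2cm]\dfrac12S^\varphi=U(\varphi)+\mu+\Lambda_2,\\[0.2cm](\mu+p)\nabla f-\nabla p=0,\end{cases}$$ where $\lambda=\frac1m\left(S^\varphi+\Delta_ff\right)$.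
   Context: Components are taken with respect to local orthonormal coframes on $M$ (indices $i,j,k,l,\dots$) and on $N$ (index $a$); repeated indices are summed; all tensors are regarded as covariant. Indices after a comma denote covariant derivatives, the last index being the newest. $f_i,f_{ij},f_{ijk}$ are the components of $\nabla f$, $\mathrm{Hess} f$, $\nabla\mathrm{Hess} f$; $\Delta f=f_{ll}$, $f_{lli}=(\Delta f)_i$; $\Delta_ff=\Delta f-|\nabla f|^2$. $\varphi^a_i$ are the components of $d\varphi$, $\tau(\varphi)$ is the tension field of $\varphi$, $\nabla^hU$ is the gradient of $U$ with respect to $h$ and $U^a$ are its components along $\varphi$. $R_{ij}=R_{kikj}$ are the components of $\mathrm{Ric}$, with the convention $f_{ijk}-f_{ikj}=f_lR_{lijk}$. $\mathrm{Ric}^\varphi=\mathrm{Ric}-\alpha\varphi^*h$ (components $R^\varphi_{ij}$), $S^\varphi=\mathrm{tr}_g\mathrm{Ric}^\varphi$, $A^\varphi=\mathrm{Ric}^\varphi-\frac{S^\varphi}{2(m-1)}g$, $C^\varphi_{ijk}=A^\varphi_{ij,k}-A^\varphi_{ik,j}$. The C-$\varphi$-PF (Cotton-$\varphi$-perfect fluid) system is $$\begin{aligned}0=&\;C^\varphi_{ijk}+f_{ijk}-f_{ikj}-f_{ik}f_j+f_{ij}f_k-\tfrac1m\big[(f_{llk}-2f_lf_{lk})\delta_{ij}-(f_{llj}-2f_lf_{lj})\delta_{ik}\big]\\&+\tfrac1{2m(m-1)}(S^\varphi_k\delta_{ij}-S^\varphi_j\delta_{ik})+\tfrac1mU^a\varphi^a_j\delta_{ik}-\tfrac1mU^a\varphi^a_k\delta_{ij}+\tfrac1m(\mu_j\delta_{ik}-\mu_k\delta_{ij}),\\0=&-\tfrac{m-1}mf_{lli}+\tfrac{m-2}mf_lf_{li}+(\Delta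 f)f_i+\tfrac1{2m}S^\varphi_i-f_lR^\varphi_{il}+\tfrac1mU^a\varphi^a_i-\tfrac{m-1}m\mu_i,\\0=&\;\tau(\varphi)-d\varphi(\nabla f)-\tfrac1\alpha(\nabla^hU)(\varphi),\\0=&\;\nabla p-(\mu+p)\nabla f.\end{aligned}$$ Let $\epsilon$ be the volume form of $(M,g)$ and $W$ its Weyl tensor. Define $W^*_{i_1\dots i_{m-2}jk}=\epsilon_{i_1\dots i_{m-2}pq}W_{pqjk}$. $S^2_0(M)$ is the space of traceless symmetric $2$-covariant tensors on $M$ and $T^{(0,m-2)}M$ the space of $(m-2)$-covariant tensors on $M$. The linear map $W^*_{|S^2_0}:S^2_0(M)\to T^{(0,m-2)}M$ sends $P$ to the tensor with components $W^*_{|S^2_0}(P)_{i_2\dots i_{m-2}j}=W^*_{li_2\dots i_{m-2}kj}P_{lk}$.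
   Formalization: The manifold M is assumed connected, which the statement does not say; on a disconnected M (for example two differently scaled copies of CP² with constant data) the constants Λ₁, Λ₂ may differ between components and the claim fails. *)

(* Defs.v *)
From mathcomp Require Import all_boot all_order all_algebra.
From mathcomp Require Import all_classical all_reals all_analysis.

Set Implicit Arguments.
Unset Strict Implicit.
Unset Printing Implicit Defensive.

Import Order.TTheory GRing.Theory Num.Theory.
Import numFieldNormedType.Exports.

Local Open Scope classical_set_scope.
Local Open Scope ring_scope.

(* Riemannian geometry in coordinates on open subsets of R^m, followed by
   manifolds as topological spaces with an atlas. Points, vectors and covectors
   are row vectors; covariant 2-tensors are matrices; covariant 3- and 4-tensors
   are families indexed by 'I_m. In covariant derivatives the index of
   differentiation comes last. *)

Section Coordinates.
Context {R : realType}.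

Section Calculus.
Context {m : nat}.
Implicit Types (u : 'rV[R]_m -> R) (x : 'rV[R]_m) (A : set 'rV[R]_m).

Definition pd (i : 'I_m) u x : R := 'D_(delta_mx 0 i) u x.

Definition iter_pd (s : seq 'I_m) u : 'rV[R]_m -> R := foldr pd u s.

(* C^infinity on an open set [A]: the iterated partial derivatives of all orders
   exist and are continuous on [A]. *)
Definition smooth_on A u : Prop :=
  forall s x, A x ->
    {for x, continuous (iter_pd s u)} /\
    forall i, derivable (iter_pd s u) x (delta_mx 0 i).

Definition dfun u x : 'rV[R]_m := \row_i pd i u x.

(* dmap Phi x i a = d(Phi^a)/dx^i; the differential of Phi sends the row vector
   v to [v *m dmap Phi x]. *)
Definition dmap {n} (Phi : 'rV[R]_m -> 'rV[R]_n) x : 'M[R]_(m, n) :=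
  \matrix_(i, a) pd i (fun y => Phi y 0 a) x.

End Calculus.

Section Metric.
Context {m : nat}.
Variable g : 'rV[R]_m -> 'M[R]_m.
Implicit Types (u : 'rV[R]_m -> R) (x : 'rV[R]_m) (T : 'rV[R]_m -> 'M[R]_m).

Definition grad u x : 'rV[R]_m := dfun u x *m invmx (g x).

Definition gtrace T x : R := \tr (invmx (g x) *m T x).

(* christoffel k i j = Gamma^k_{ij} *)
Definition christoffel (k i j : 'I_m) x : R :=
  2^-1 * \sum_l invmx (g x) k l *
    (pd i (fun y => g y j l) x + pd j (fun y => g y i l) x
     - pd l (fun y => g y i j) x).

Definition cov1 (w : 'rV[R]_m -> 'rV[R]_m) x : 'M[R]_m :=
  \matrix_(i, j) (pd j (fun y => w y 0 i) x
                  - \sum_k christoffel k j i x * w x 0 k).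

Definition cov2 T x (i j k : 'I_m) : R :=
  pd k (fun y => T y i j) x
  - \sum_l christoffel l k i x * T x l j
  - \sum_l christoffel l k j x * T x i l.

Definition hess u : 'rV[R]_m -> 'M[R]_m := cov1 (dfun u).
Definition lap u x : R := gtrace (hess u) x.
Definition norm_grad2 u x : R := (grad u x *m (dfun u x)^T) 0 0.
Definition lapf u x : R := lap u x - norm_grad2 u x.

(* riem_up l i j k = R^l_{ijk}, the component along the l-th coordinate field of
   R(d_j, d_k) d_i where R(X, Y) = [nabla_X, nabla_Y] - nabla_[X, Y].
   This is the sign for which f_{ijk} - f_{ikj} = f_l R_{lijk}. *)
Definition riem_up (l i j k : 'I_m) x : R :=
  pd j (christoffel l k i) x - pd k (christoffel l j i) x
  + \sum_q (christoffel l j q x * christoffel q k i x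
            - christoffel l k q x * christoffel q j i x).

Definition riem x (l i j k : 'I_m) : R := \sum_q g x l q * riem_up q i j k x.

Definition ric x : 'M[R]_m :=
  \matrix_(i, j) \sum_k \sum_l invmx (g x) k l * riem x k i l j.

Definition scal x : R := gtrace ric x.

Definition weyl x (i j k l : 'I_m) : R :=
  riem x i j k l
  - (m%:R - 2)^-1 * (ric x i k * g x j l - ric x i l * g x j k
                     + ric x j l * g x i k - ric x j k * g x i l)
  + scal x / ((m%:R - 1) * (m%:R - 2))
    * (g x i k * g x j l - g x i l * g x j k).

End Metric.

(* Components of tensors in a frame: row [i] of [E] holds the coordinates of the
   i-th vector of the frame. *)
Section Frames.
Context {m : nat}.
Implicit Types E : 'M[R]_m.

Definition orthonormal_frame (G E : 'M[R]_m) : Prop := E *m G *m E^T = 1%:M.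

Definition comp1 E (w : 'rV[R]_m) (i : 'I_m) : R := (w *m E^T) 0 i.

Definition comp2 E (T : 'M[R]_m) (i j : 'I_m) : R := (E *m T *m E^T) i j.

Definition comp3 E (T : 'I_m -> 'I_m -> 'I_m -> R) (i j k : 'I_m) : R :=
  \sum_a \sum_b \sum_c E i a * E j b * E k c * T a b c.

Definition comp4 E (T : 'I_m -> 'I_m -> 'I_m -> 'I_m -> R)
    (i j k l : 'I_m) : R :=
  \sum_a \sum_b \sum_c \sum_d E i a * E j b * E k c * E l d * T a b c d.

(* Component of index [I] of the m-form v dx^1 /\ ... /\ dx^m. The list [I] is
   meant to have length m, in which case the default [d] of [nth] is not used. *)
Definition topform_comp (v : R) E (d : 'I_m) (I : seq 'I_m) : R :=
  v * \det (\matrix_(a < m) row (nth d I a) E).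

End Frames.

(* The operator W^* at a point: [v] is the coefficient of the volume form, [W]
   the Weyl tensor in coordinates. *)
Section Wstar.
Context {m : nat}.
Variables (v : R) (W : 'I_m -> 'I_m -> 'I_m -> 'I_m -> R) (E : 'M[R]_m).

(* W^*_{I j k}, where [I] has length m - 2 *)
Definition Wstar (I : seq 'I_m) (j k : 'I_m) : R :=
  \sum_q \sum_r topform_comp v E q (I ++ [:: q; r]) * comp4 E W q r j k.

(* W^*_{|S^2_0}(P)_{I j}, where [I] has length m - 3 *)
Definition WstarS (P : 'M[R]_m) (I : seq 'I_m) (j : 'I_m) : R :=
  \sum_l \sum_k Wstar (l :: I) k j * comp2 E P l k.

End Wstar.

Section Maps.
Context {m n : nat}.
Variables (g : 'rV[R]_m -> 'M[R]_m) (h : 'rV[R]_n -> 'M[R]_n) (alpha : R)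
  (Phi : 'rV[R]_m -> 'rV[R]_n).
Implicit Types x : 'rV[R]_m.

Definition pullback x : 'M[R]_m :=
  dmap Phi x *m h (Phi x) *m (dmap Phi x)^T.

Definition tension x : 'rV[R]_n :=
  \row_a \sum_i \sum_j invmx (g x) i j *
    (pd i (pd j (fun y => Phi y 0 a)) x
     - \sum_k christoffel g k i j x * dmap Phi x k a
     + \sum_b \sum_c christoffel h a b c (Phi x)
         * dmap Phi x i b * dmap Phi x j c).

Definition ric_phi x : 'M[R]_m := ric g x - alpha *: pullback x.
Definition scal_phi x : R := gtrace g ric_phi x.
Definition schouten_phi x : 'M[R]_m :=
  ric_phi x - (scal_phi x / (2 * (m%:R - 1))) *: g x.
Definition cotton_phi x (i j k : 'I_m) : R :=
  cov2 g schouten_phi x i j k - cov2 g schouten_phi x i k j.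

(* phi^a_i in the frames E (domain) and F (target): the scalar product of
   d(phi)(E_i) and F_a *)
Definition dphi_comp (E : 'M[R]_m) (F : 'M[R]_n) x (a : 'I_n) (i : 'I_m) : R :=
  (E *m dmap Phi x *m h (Phi x) *m F^T) i a.

Variables (U : 'rV[R]_n -> R) (f mu pr : 'rV[R]_m -> R).

Definition CPF_at x : Prop :=
  (forall (E : 'M[R]_m) (F : 'M[R]_n),
    orthonormal_frame (g x) E -> orthonormal_frame (h (Phi x)) F ->
    let f1 := comp1 E (dfun f x) in
    let f2 := comp2 E (hess g f x) in
    let f3 := comp3 E (cov2 g (hess g f) x) in
    let dlap := comp1 E (dfun (lap g f) x) in
    let dS := comp1 E (dfun scal_phi x) in
    let dmu := comp1 E (dfun mu x) in
    let C := comp3 E (cotton_phi x) in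
    let Rphi := comp2 E (ric_phi x) in
    let Uphi i := \sum_a comp1 F (dfun U (Phi x)) a * dphi_comp E F x a i in
    let fHf k := \sum_l f1 l * f2 l k in
    let delta (i j : 'I_m) : R := (i == j)%:R in
    (forall i j k : 'I_m,
      0 = C i j k + f3 i j k - f3 i k j - f2 i k * f1 j + f2 i j * f1 k
          - m%:R^-1 * ((dlap k - 2 * fHf k) * delta i j
                       - (dlap j - 2 * fHf j) * delta i k)
          + (2 * m%:R * (m%:R - 1))^-1
            * (dS k * delta i j - dS j * delta i k)
          + m%:R^-1 * Uphi j * delta i k - m%:R^-1 * Uphi k * delta i j
          + m%:R^-1 * (dmu j * delta i k - dmu k * delta i j)) /\
    (forall i : 'I_m,
      0 = - ((m%:R - 1) / m%:R) * dlap i + (m%:R - 2) / m%:R * fHf i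
          + lap g f x * f1 i + (2 * m%:R)^-1 * dS i
          - \sum_l f1 l * Rphi i l
          + m%:R^-1 * Uphi i - (m%:R - 1) / m%:R * dmu i)) /\
  0 = tension x - grad g f x *m dmap Phi x - alpha^-1 *: grad h U (Phi x) /\
  0 = grad g pr x - (mu x + pr x) *: grad g f x.

Definition phiPF_at (L1 L2 : R) x : Prop :=
  let lambda := m%:R^-1 * (scal_phi x + lapf g f x) in
  [/\ ric_phi x + hess g f x - (dfun f x)^T *m dfun f x = lambda *: g x,
      lapf g f x = (m%:R - 1)^-1 * (scal_phi x - m%:R * (mu x + pr x))
                   + L1 * expR (f x),
      tension x = grad g f x *m dmap Phi x + alpha^-1 *: grad h U (Phi x),
      2^-1 * scal_phi x = U (Phi x) + mu x + L2 &
      (mu x + pr x) *: grad g f x - grad g pr x = 0].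

End Maps.
End Coordinates.

Record chart (R : realType) (m : nat) (T : topologicalType) := Chart {
  cdom : set T;
  cmap : T -> 'rV[R]_m;
  cinv : 'rV[R]_m -> T }.

Definition cimg (R : realType) (m : nat) (T : topologicalType)
  (c : chart R m T) : set 'rV[R]_m := cmap c @` cdom c.

(* [cmap c] is a homeomorphism from the open set [cdom c] onto the open set
   [cimg c], with inverse [cinv c]. *)
Definition is_chart (R : realType) (m : nat) (T : topologicalType)
    (c : chart R m T) : Prop :=
  [/\ open (cdom c), open (cimg c),
      forall p, cdom c p -> cinv c (cmap c p) = p,
      forall p, cdom c p -> {for p, continuous (cmap c)} &
      forall x, cimg c x -> {for x, continuous (cinv c)}].

Definition trans (R : realType) (m : nat) (T : topologicalType)
  (c c' : chart R m T) (x : 'rV[R]_m) : 'rV[R]_m := cmap c' (cinv c x).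

Definition trans_dom (R : realType) (m : nat) (T : topologicalType)
  (c c' : chart R m T) : set 'rV[R]_m := cmap c @` (cdom c `&` cdom c').

(* The atlas need not be maximal. *)
Record manifold (R : realType) (m : nat) := Manifold {
  mspace :> topologicalType;
  m_hausdorff : hausdorff_space mspace;
  m_second_countable : @second_countable mspace;
  midx : Type;
  mchart : midx -> chart R m mspace;
  mchartP : forall i, is_chart (mchart i);
  mcover : forall p, exists i, cdom (mchart i) p;
  mcompat : forall i j (a : 'I_m),
    smooth_on (trans_dom (mchart i) (mchart j))
              (fun x => trans (mchart i) (mchart j) x 0 a) }.

Section Manifold.
Context {R : realType} {m : nat}.
Variable M : manifold R m.

Definition rep (f : M -> R) (i : midx M) : 'rV[R]_m -> R :=
  fun x => f (cinv (mchart i) x).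

Definition smooth_fun (f : M -> R) : Prop :=
  forall i, smooth_on (cimg (mchart i)) (rep f i).

(* Smooth covariant 2-tensor fields, given by their components in the charts. *)
Definition tensor2 (P : midx M -> 'rV[R]_m -> 'M[R]_m) : Prop :=
  (forall i a b, smooth_on (cimg (mchart i)) (fun x => P i x a b)) /\
  (forall i j x, trans_dom (mchart i) (mchart j) x ->
     let t := trans (mchart i) (mchart j) in
     P i x = dmap t x *m P j (t x) *m (dmap t x)^T).

Definition is_metric (g : midx M -> 'rV[R]_m -> 'M[R]_m) : Prop :=
  tensor2 g /\
  forall i x, cimg (mchart i) x ->
    (g i x)^T = g i x /\
    forall v : 'rV[R]_m, v != 0 -> 0 < (v *m g i x *m v^T) 0 0.

(* An orientation: [s i x] is 1 or -1 according to whether the chart [i] is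
   positively oriented at the point of coordinates [x]. The manifold is
   orientable when such an [s] exists. *)
Definition is_orientation (s : midx M -> 'rV[R]_m -> R) : Prop :=
  (forall i x, cimg (mchart i) x ->
     (s i x = 1 \/ s i x = -1) /\ {for x, continuous (s i)}) /\
  (forall i j x, trans_dom (mchart i) (mchart j) x ->
     let t := trans (mchart i) (mchart j) in
     s i x = Num.sg (\det (dmap t x)) * s j (t x)).

End Manifold.

Record riemannian (R : realType) (m : nat) := Riemannian {
  rmanifold :> manifold R m;
  metric : midx rmanifold -> 'rV[R]_m -> 'M[R]_m;
  metricP : is_metric metric }.

Section Riemannian.
Context {R : realType} {m : nat}.
Variable M : riemannian R m.

(* Coefficient of the volume form for the orientation [s]. *)
Definition volume (s : midx M -> 'rV[R]_m -> R) (i : midx M)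
  (x : 'rV[R]_m) : R := s i x * Num.sqrt (\det (metric i x)).

Definition S20 (P : midx M -> 'rV[R]_m -> 'M[R]_m) : Prop :=
  tensor2 P /\
  forall i x, cimg (mchart i) x ->
    (P i x)^T = P i x /\ gtrace (metric i) (P i) x = 0.

Definition Wstar_injective (s : midx M -> 'rV[R]_m -> R) : Prop :=
  forall P Q, S20 P -> S20 Q ->
  (forall i x (E : 'M[R]_m) (I : (m - 3).-tuple 'I_m) (j : 'I_m),
     cimg (mchart i) x -> orthonormal_frame (metric i x) E ->
     WstarS (volume s i x) (weyl (metric i) x) E (P i x) I j =
     WstarS (volume s i x) (weyl (metric i) x) E (Q i x) I j) ->
  forall i x, cimg (mchart i) x -> P i x = Q i x.

End Riemannian.

Section Global.
Context {R : realType} {m n : nat}.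
Variables (M : riemannian R m) (N : riemannian R n) (phi : M -> N).

Definition map_rep (i : midx M) (b : midx N) : 'rV[R]_m -> 'rV[R]_n :=
  fun x => cmap (mchart b) (phi (cinv (mchart i) x)).

Definition map_dom (i : midx M) (b : midx N) : set 'rV[R]_m :=
  cmap (mchart i) @` (cdom (mchart i) `&` phi @^-1` cdom (mchart b)).

Definition smooth_map : Prop :=
  continuous phi /\
  forall i b (a : 'I_n), smooth_on (map_dom i b) (fun x => map_rep i b x 0 a).

Variables (alpha : R) (U : N -> R) (f mu pr : M -> R).

Definition CphiPF_system : Prop :=
  forall i b x, map_dom i b x ->
    CPF_at (metric i) (metric b) alpha (map_rep i b)
           (rep U b) (rep f i) (rep mu i) (rep pr i) x.

Definition phiPF_system (L1 L2 : R) : Prop :=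
  forall i b x, map_dom i b x ->
    phiPF_at (metric i) (metric b) alpha (map_rep i b)
             (rep U b) (rep f i) (rep mu i) (rep pr i) L1 L2 x.

End Global.

(* Main.v *)
(* Put T = Ric^phi + Hess f - df (x) df, let Z be its traceless part, S = S^phi
   and psi = S/2 - U(phi) - mu. The first equation of the system says that B =
   Z + (psi/m) g is a Codazzi tensor. Commuting covariant derivatives of B
   gives the cyclic identity B_pj R_pikl + B_pk R_pilj + B_pl R_pijk = 0; its
   trace says that B commutes with Ric, so the identity also holds with the
   Weyl tensor in place of R and Z in place of B. Contracting with the volume
   form gives W^*(Z) = 0, hence Z = 0 by injectivity. Then (psi/m) g is
   Codazzi, which forces d psi = 0 and gives Lambda_2. Substituting T = lambda
   g, d psi = 0 and the last equation in the second one yields d Q = Q df for Q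
   = Delta_f f - (S - m(mu + p))/(m - 1), so that e^{-f} Q is constant, which
   gives Lambda_1.

   Injectivity is assumed for global tensor fields, so the transformation of
   Ric, Hess and phi^* h under changes of charts is needed. With (Gamma_k)_il =
   Gamma^l_ki and J the Jacobian of the transition map, the Christoffel symbols
   transform by d_k J = Gamma_k J - J Gamma'_k, and the compatibility condition
   of this system of equations is the tensoriality of the curvature. *)
Require Import Defs.
From HB Require Import structures.
From mathcomp Require Import all_boot all_order all_algebra.
From mathcomp Require Import all_classical all_reals all_analysis.
From mathcomp Require Import fingroup perm ring lra.

Set Implicit Arguments.
Unset Strict Implicit.
Unset Printing Implicit Defensive.

Import Order.TTheory GRing.Theory Num.Theory.
Import numFieldNormedType.Exports.

Local Open Scope classical_set_scope.
Local Open Scope ring_scope.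

(** * Partial derivatives *)

(** Two facts let the cyclic identity pass from B and the Riemann tensor to Z and the Weyl tensor. A
    multiple of g contributes to the cyclic sum a multiple of the first Bianchi identity. The
    difference between the two curvature tensors is built from Ric and g, and its cyclic sum
    contains only the antisymmetric parts of Z and of Z Ric; the product Z Ric is symmetric because
    Z and Ric commute. The volume form detects only the cyclic sum because a cyclic permutation of
    three indices is even. Two obstacles shape the rest. Smoothness is a condition on iterated
    partial derivatives, so the chain rule and the symmetry of second derivatives are derived from
    the mean value theorem along coordinate axes. Moreover all equations are written in a chart of M
    together with a chart of N, so Z, psi and Q become global objects only once independence of both
    charts is known; connectedness of M then turns vanishing derivatives into constants. *)

Section PartialDerivatives.
Context {R : realType}.
Implicit Types m n : nat.

(** Balls of the sup norm in coordinate form: moving from [x] to a point of the box one coordinate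
    at a time never leaves the box. *)
Definition box {m} (x : 'rV[R]_m) (r : R) : set 'rV[R]_m :=
  [set y | forall j, `|y 0 j - x 0 j| < r].

Lemma nbhs_boxP m (x : 'rV[R]_m) (A : set 'rV[R]_m) :
  nbhs x A <-> exists2 r, 0 < r & box x r `<=` A.
Proof.
split=> [/nbhs_ballP[r /= r0 xrA]|[r r0 xrA]].
  exists r => // y xry; apply: xrA; split=> // i j.
  by rewrite ord1 /ball /= distrC.
apply/nbhs_ballP; exists r => //= y [_ xry]; apply: xrA => j.
by rewrite distrC; exact: xry.
Qed.

Lemma near_dist (T : Type) (F : set_system T) (FF : Filter F) (f : T -> R) y r :
  f t @[t --> F] --> y -> 0 < r -> \forall t \near F, `|f t - y| < r.
Proof. by move=> /cvgrPdist_lt fy /fy; apply: filterS => t; rewrite distrC. Qed.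

Lemma cvg_sum (T I : Type) (F : set_system T) (FF : Filter F) (r : seq I)
    (f : I -> T -> R) (a : I -> R) :
  (forall i, f i t @[t --> F] --> a i) ->
  \sum_(i <- r) f i t @[t --> F] --> \sum_(i <- r) a i.
Proof.
move=> fa; elim: r => [|i r IHr].
  by rewrite big_nil; under eq_fun do rewrite big_nil; exact: cvg_cst.
by rewrite big_cons; under eq_fun do rewrite big_cons; exact: cvgD.
Qed.

Lemma cvg_box (T : Type) (F : set_system T) (FF : Filter F) m (z : T ->
  'rV[R]_m)
    (x : 'rV[R]_m) :
  (forall j, z t 0 j @[t --> F] --> x 0 j) -> z t @[t --> F] --> x.
Proof.
move=> zx A /nbhs_boxP[r r0 xrA].
have : \forall t \near F, forall j, `|z t 0 j - x 0 j| < r.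
  by apply: filter_forall => j; exact: near_dist.
by apply: filterS => t zt; apply: xrA.
Qed.

Lemma derivable_line m (u : 'rV[R]_m -> R) x v s :
  derivable u (x + s *: v) v ->
  is_derive s 1 (fun s : R => u (x + s *: v)) ('D_v u (x + s *: v)).
Proof.
have E : (fun h : R => h^-1 *: (((fun s => u (x + s *: v)) \o shift s) (h *: 1)
            - u (x + s *: v)))
    = (fun h => h^-1 *: ((u \o shift (x + s *: v)) (h *: v) - u (x + s *: v))).
  apply/funext => h /=; congr (_ *: (u _ - _)).
  by rewrite [_%:A]mulr1 scalerDl addrCA.
by move=> du; apply: DeriveDef; rewrite /derivable /derive E.
Qed.

Lemma pd_MVT m (u : 'rV[R]_m -> R) i x t :
  (forall s, `|s| <= `|t| ->
    derivable u (x + s *: delta_mx 0 i) (delta_mx 0 i)) ->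
  exists2 s, `|s| <= `|t| &
    u (x + t *: delta_mx 0 i) - u x = t * pd i u (x + s *: delta_mx 0 i).
Proof.
move=> du; set e := delta_mx 0 i.
have H (a b : R) : a <= b -> (forall s, a <= s <= b -> `|s| <= `|t|) ->
    exists2 s, `|s| <= `|t| &
      u (x + b *: e) - u (x + a *: e) = pd i u (x + s *: e) * (b - a).
  move=> ab sab.
  have [s /[!inE]||c] := @MVT_segment R (fun s => u (x + s *: e))
      (fun s => pd i u (x + s *: e)) a b ab.
  - move=> /andP[s1 s2]; apply: derivable_line; apply/du/sab.
    by rewrite (ltW s1) (ltW s2).
  - apply: derivable_within_continuous => s.
    by rewrite in_itv/= => /sab/du/derivable_line[].
  - by rewrite in_itv /= => /sab cab ->; exists c.
have [t0|t0] := leP 0 t.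
  have [|s st] := H 0 t t0.
    by move=> s /andP[s0 st]; rewrite !ger0_norm.
  by rewrite scale0r addr0 subr0 mulrC => ->; exists s.
have [|s st] := H t 0 (ltW t0).
  by move=> s /andP[s0 st]; rewrite !ler0_norm ?lerN2// ltW.
rewrite scale0r addr0 sub0r mulrN => E; exists s => //.
by rewrite -opprB E opprK mulrC.
Qed.

(** Join [x] to [y] by segments parallel to the axes and apply the one-variable mean value theorem
    on each. Only partial derivatives enter, and in every coordinate the intermediate points are as
    close to [x] as [y] is. *)
Lemma box_MVT m (u : 'rV[R]_m -> R) (x y : 'rV[R]_m) :
  (forall z : 'rV[R]_m, (forall j, `|z 0 j - x 0 j| <= `|y 0 j - x 0 j|) ->
    forall i, derivable u z (delta_mx 0 i)) ->
  exists2 z : 'I_m -> 'rV[R]_m,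
    forall i j, `|z i 0 j - x 0 j| <= `|y 0 j - x 0 j| &
    u y - u x = \sum_i (y 0 i - x 0 i) * pd i u (z i).
Proof.
move=> du.
pose w (k : nat) : 'rV[R]_m := \row_j (if (j < k)%N then y 0 j else x 0 j).
have wS (i : 'I_m) : w i.+1 = w i + (y 0 i - x 0 i) *: delta_mx 0 i.
  apply/rowP => j; rewrite !mxE eqxx/= ltnS leq_eqVlt.
  case: (eqVneq (j : nat) i) => [/val_inj ->|ji].
    by rewrite eqxx ltnn /= mulr1 addrC subrK.
  by rewrite -val_eqE (negbTE ji) mulr0 addr0.
have wz (i : 'I_m) s : `|s| <= `|y 0 i - x 0 i| ->
    forall j, `|(w i + s *: delta_mx 0 i) 0 j - x 0 j| <= `|y 0 j - x 0 j|.
  move=> sy j; rewrite !mxE eqxx/=.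
  have [->|ji] := eqVneq j i; first by rewrite ltnn mulr1 addrC addKr.
  by rewrite mulr0 addr0; case: ifP => // _; rewrite subrr normr0.
have /choice[s sP] : forall i : 'I_m, exists s, `|s| <= `|y 0 i - x 0 i| /\
    u (w i.+1) - u (w i) = (y 0 i - x 0 i) * pd i u (w i + s *: delta_mx 0 i).
  move=> i; have [|s sy E] := @pd_MVT _ u i (w i) (y 0 i - x 0 i).
    by move=> s sy; apply: du; exact: wz.
  by exists s; rewrite wS.
exists (fun i : 'I_m => w i + s i *: delta_mx 0 i).
  by move=> i; apply: wz; exact: (sP i).1.
transitivity (\sum_(i < m) (u (w i.+1) - u (w i))); last first.
  by apply: eq_bigr => i _; exact: (sP i).2.
have := telescope_sumr (fun k => u (w k)) (leq0n m); rewrite big_mkord => ->.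
by congr (u _ - u _); apply/rowP => j; rewrite mxE ?ltn_ord.
Qed.

(** Continuity of the partial derivatives of [u] stands in for total differentiability: [box_MVT]
    writes the increment of [u] as increments of the components of [Phi] times partial derivatives
    at points squeezed towards [Phi x]. *)
Lemma is_derive_comp m n (Phi : 'rV[R]_m -> 'rV[R]_n) (u : 'rV[R]_n -> R)
    (x v : 'rV[R]_m) :
  (forall a, derivable (fun y => Phi y 0 a) x v) ->
  (\forall y \near Phi x, forall a, derivable u y (delta_mx 0 a)) ->
  (forall a, {for Phi x, continuous (pd a u)}) ->
  is_derive x v (u \o Phi)
    (\sum_a 'D_v (fun y => Phi y 0 a) x * pd a u (Phi x)).
Proof.
move=> dPhi /nbhs_boxP[r r0 du] cu.
have /choice[z zP] : forall h : R, exists z : 'I_n -> 'rV[R]_n,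
    (forall a j, `|z a 0 j - Phi x 0 j| <= `|Phi (h *: v + x) 0 j - Phi x 0 j|)
      /\
    (box (Phi x) r (Phi (h *: v + x)) -> u (Phi (h *: v + x)) - u (Phi x) =
       \sum_a (Phi (h *: v + x) 0 a - Phi x 0 a) * pd a u (z a)).
  move=> h; have [hr|hr] := pselect (box (Phi x) r (Phi (h *: v + x))).
    have [|z z1 z2] := @box_MVT _ u (Phi x) (Phi (h *: v + x)).
      by move=> y yx i; apply: du => j; apply: le_lt_trans (hr j); exact: yx.
    by exists z.
  (* Outside the box the intermediate points are set to [Phi x], so that the bound on them holds for
     every [h]. *)
  by exists (fun _ => Phi x); split=> [a j|//]; rewrite subrr normr0.
have cPhi a : Phi (h *: v + x) 0 a @[h --> (0 : R)^'] --> Phi x 0 a.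
  have /derivable1P/derivable1_diffP/differentiable_continuous := dPhi a.
  rewrite /prop_for /continuous_at scale0r add0r => c.
  by move=> B /c /=; exact: nbhs_dnbhs.
have cz a : z h a @[h --> (0 : R)^'] --> Phi x.
  apply: cvg_box => j; apply/cvgrPdist_lt => e e0.
  apply: filterS (near_dist _ (cPhi j) e0) => h hj; rewrite distrC.
  by apply: le_lt_trans hj; exact: (zP h).1.
have near_box : \forall h \near (0 : R)^', box (Phi x) r (Phi (h *: v + x)).
  by apply: filter_forall => j; exact: near_dist.
have L : h^-1 *: ((u \o Phi \o shift x) (h *: v) - (u \o Phi) x)
    @[h --> (0 : R)^'] --> \sum_a 'D_v (fun y => Phi y 0 a) x * pd a u (Phi x).
  pose G (h : R) := \sum_a (h^-1 *: (((fun y => Phi y 0 a) \o shift x) (h *: v)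
      - Phi x 0 a)) * pd a u (z h a).
  apply: (@cvg_trans _ (G @ (0 : R)^')).
    apply: near_eq_cvg; move: near_box; apply: filterS => h hb.
    rewrite /= (zP h).2// /G scaler_sumr.
    by apply: eq_bigr => a _ /=; rewrite scalerAl.
  apply: (@cvg_sum _ _ _ _ _ (fun a h => (h^-1 *: (((fun y => Phi y 0 a) \o
    shift x) (h *: v) - Phi x 0 a)) * pd a u (z h a))
    (fun a => 'D_v (fun y => Phi y 0 a) x * pd a u (Phi x))) => a.
  apply: cvgM; first exact: dPhi.
  exact: (cvg_comp _ _ (cz a) (cu a)).
by apply: DeriveDef; [apply/cvg_ex; eexists; exact: L | exact/cvg_lim].
Qed.

(** The second difference of [u] over a square of side [t] is unchanged when the two axes are
    exchanged, and two applications of the mean value theorem make it [t * t] times either mixed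
    derivative at a point near [x]. *)
Lemma pdC m (u : 'rV[R]_m -> R) (i j : 'I_m) x :
  (\forall y \near x, forall k, derivable u y (delta_mx 0 k)) ->
  (\forall y \near x, derivable (pd i u) y (delta_mx 0 j)) ->
  (\forall y \near x, derivable (pd j u) y (delta_mx 0 i)) ->
  {for x, continuous (pd j (pd i u))} -> {for x, continuous (pd i (pd j u))} ->
  pd i (pd j u) x = pd j (pd i u) x.
Proof.
move=> d0 d1 d2 c1 c2.
have [r r0 xr] : exists2 r, 0 < r & forall y, box x r y ->
    [/\ forall k, derivable u y (delta_mx 0 k),
        derivable (pd i u) y (delta_mx 0 j) & derivable (pd j u) y (delta_mx 0
          i)].
  have /nbhs_boxP[r r0 H] : \forall y \near x, [/\ forall k, derivable u y
    (delta_mx 0 k),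
        derivable (pd i u) y (delta_mx 0 j) & derivable (pd j u) y (delta_mx 0
          i)].
    by apply: filterS3 d0 d1 d2 => y.
  by exists r.
pose e (k : 'I_m) : 'rV[R]_m := delta_mx 0 k.
(* The bound is [2 * t] because [a = b] is allowed, in which case both displacements add up in one
   coordinate. *)
have dist_pt (a b : 'I_m) (t s s' : R) : `|s| <= t -> `|s'| <= t ->
    forall k, `|(x + s *: e a + s' *: e b) 0 k - x 0 k| <= 2 * t.
  move=> st s't k; rewrite !mxE /=.
  rewrite [X in `|X|](_ : _ = s * (k == a)%:R + s' * (k == b)%:R); last by ring.
  apply: le_trans (ler_normD _ _) _.
  have B (p : R) (q : bool) : `|p| <= t -> `|p * q%:R| <= t.
    by case: q => pt; rewrite ?mulr1// mulr0 normr0 (le_trans _ pt).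
  by rewrite mulrDl mul1r lerD ?eqxx /= ?B.
have near_pt (a b : 'I_m) (t s s' : R) : `|s| <= t -> `|s'| <= t -> 2 * t < r ->
    box x r (x + s *: e a + s' *: e b).
  by move=> st s't tr k; apply: le_lt_trans tr; exact: dist_pt.
have key (a b : 'I_m) (t : R) : 0 < t -> 2 * t < r ->
    (forall y, box x r y -> derivable (pd a u) y (e b)) ->
    exists2 z : 'rV[R]_m, forall k, `|z 0 k - x 0 k| <= 2 * t &
    u (x + t *: e a + t *: e b) - u (x + t *: e a) - (u (x + t *: e b) - u x)
      = t * (t * pd b (pd a u) z).
  move=> t0 tr dab; have tt0 : `|t| <= t by rewrite gtr0_norm.
  have dv (s : R) : `|s| <= t -> is_derive (x + s *: e a) (e a)
      (fun y => u (y + t *: e b) - u y)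
      (pd a u (x + s *: e a + t *: e b) - pd a u (x + s *: e a)).
    move=> st.
    have D1 : derivable u (x + s *: e a) (e a).
      have := near_pt a b t s 0 st; rewrite normr0 scale0r addr0.
      by move=> /(_ (ltW t0) tr) hb; have [d _ _] := xr _ hb; exact: d.
    have D2 : is_derive (x + s *: e a) (e a) (fun y => u (y + t *: e b))
        (pd a u (x + s *: e a + t *: e b)).
      have D : derivable u (x + s *: e a + t *: e b) (e a).
        by have [d _ _] := xr _ (near_pt a b t s t st tt0 tr); exact: d.
      have E : (fun h : R => h^-1 *: (((fun y => u (y + t *: e b)) \o
          shift (x + s *: e a)) (h *: e a) - u (x + s *: e a + t *: e b)))
        = (fun h => h^-1 *: ((u \o shift (x + s *: e a + t *: e b)) (h *: e a)
                             - u (x + s *: e a + t *: e b))).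
        by apply/funext => h /=; rewrite !addrA.
      by apply: DeriveDef; rewrite /derivable /derive E.
    by apply: is_deriveB; apply: DeriveDef.
  have [s|s st] := @pd_MVT _ (fun y => u (y + t *: e b) - u y) a x t.
    by rewrite (gtr0_norm t0) => /dv[].
  rewrite (gtr0_norm t0) in st.
  have [_] := dv _ st; rewrite -/(pd a _ _) => -> E.
  have [s'|s' s't E'] := @pd_MVT _ (pd a u) b (x + s *: e a) t.
    by rewrite (gtr0_norm t0) => s't; apply/dab/(near_pt _ _ t).
  rewrite (gtr0_norm t0) in s't.
  exists (x + s *: e a + s' *: e b); last by rewrite -E' -E.
  exact: dist_pt.
apply/eqP; rewrite -subr_eq0 -normr_le0; apply/ler_addgt0Pl => eps eps0;
  rewrite addr0.
have e20 : 0 < eps / 2 by rewrite divr_gt0.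
have /nbhs_boxP[r1 r10 H1] : \forall y \near x,
    `|pd j (pd i u) y - pd j (pd i u) x| < eps / 2 by exact: near_dist c1 e20.
have /nbhs_boxP[r2 r20 H2] : \forall y \near x,
    `|pd i (pd j u) y - pd i (pd j u) x| < eps / 2 by exact: near_dist c2 e20.
have m0 : 0 < Num.min r (Num.min r1 r2) by rewrite !lt_min r0 r10.
have [t t0 tm] : exists2 t : R, 0 < t & 2 * t < Num.min r (Num.min r1 r2).
  by exists (Num.min r (Num.min r1 r2) / 3); lra.
move: tm; rewrite !lt_min => /and3P[tr tr1 tr2].
have [z1 z1P E1] := key i j t t0 tr (fun y yr =>
  let: And3 _ d _ := xr y yr in d).
have [z2 z2P E2] := key j i t t0 tr (fun y yr =>
  let: And3 _ _ d := xr y yr in d).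
have E : pd j (pd i u) z1 = pd i (pd j u) z2.
  apply: (mulfI (lt0r_neq0 t0)); apply: (mulfI (lt0r_neq0 t0)).
  apply: (etrans (esym E1)); apply: (etrans _ E2).
  rewrite (addrAC x (t *: e i)).
  have sub4 (a b c d : R) : a - b - (c - d) = a - c - (b - d) by ring.
  exact: sub4.
have {}H1 := H1 z1 (fun k => le_lt_trans (z1P k) tr1).
have {}H2 := H2 z2 (fun k => le_lt_trans (z2P k) tr2).
set A := pd i (pd j u) x; set B := pd j (pd i u) x.
have -> : A - B = (pd j (pd i u) z1 - B) - (pd i (pd j u) z2 - A).
  by rewrite E; ring.
apply: le_trans (ler_normB _ _) _.
rewrite (splitr eps); apply: lerD; apply: ltW; [exact: H1 | exact: H2].
Qed.

End PartialDerivatives.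

(** * Smooth functions *)

(** Openness travels with the set, so that an equality on the set is an equality near each of its
    points and can be differentiated. *)
Record opens (R : realType) (m : nat) := Opens {
  carrier :> set 'rV[R]_m;
  opens_open : open carrier }.

Definition opens_pred (R : realType) (m : nat) (A : opens R m)
  (x : 'rV[R]_m) : Prop := carrier A x.
Coercion opens_pred : opens >-> Funclass.

Section Smooth.
Context {R : realType} {m : nat}.
Implicit Types (A B : opens R m) (u v : 'rV[R]_m -> R) (x : 'rV[R]_m)
  (i j : 'I_m).

(** The recursion on the order makes closure under products, inverses and composition an induction,
    which the lists of indices in [smooth_on] would turn into a general Leibniz formula. *)
Fixpoint Ck (n : nat) A u : Prop :=
  if n is n'.+1 then
    (forall x, A x -> {for x, continuous u} /\
       forall i, derivable u x (delta_mx 0 i)) /\ forall i, Ck n' A (pd i u)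
  else forall x, A x -> {for x, continuous u}.

Lemma CkW n A u : Ck n.+1 A u -> Ck n A u.
Proof.
elim: n u => [|n IHn] u [Au du]; first by move=> x /Au[].
by split=> // i; apply: IHn; exact: du.
Qed.

(* Wrapping [smooth_on] in an inductive type keeps conversion from unfolding it.
  *)
Variant smooth A u : Prop := Smooth of smooth_on A u.

Lemma smoothP A u : smooth A u <-> forall n, Ck n A u.
Proof.
split=> [[su] n|Cu].
  elim: n u su => [|n IHn] u su; first by move=> x /(su nil)[].
  split=> [x /(su nil)//|i]; apply: IHn => s x Ax.
  (* [iter_pd] applies the last index of the list first, hence the decomposition with [rcons]. *)
  have := su (rcons s i) x Ax.
  by rewrite /iter_pd foldr_rcons.
split=> s; elim/last_ind: s u Cu => [|s i IHs] u Cu x Ax.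
  exact: (Cu 1%N).1.
rewrite /iter_pd foldr_rcons; apply: IHs => // n.
exact: (Cu n.+1).2.
Qed.

Lemma smooth_cont A u x : smooth A u -> A x -> {for x, continuous u}.
Proof. by case=> su /(su nil)[]. Qed.

Lemma smooth_derivable A u x i :
  smooth A u -> A x -> derivable u x (delta_mx 0 i).
Proof. by case=> su /(su nil)[]. Qed.

Lemma smooth_pd A u i : smooth A u -> smooth A (pd i u).
Proof. by move=> /smoothP Cu; apply/smoothP => n; exact: (Cu n.+1).2. Qed.

Lemma smooth_sub A B u : (forall x, B x -> A x) -> smooth A u -> smooth B u.
Proof. by move=> BA [su]; split=> s x /BA /su. Qed.

Lemma opens_near A x : A x -> \forall y \near x, A y.
Proof. by have := @opens_open _ _ A; rewrite openE => /[apply]. Qed.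

Lemma near_eq_pd u v x i : (\forall y \near x, u y = v y) -> pd i u x = pd i v
  x.
Proof. exact: near_eq_derive. Qed.

Lemma eq_pd A u v x i : (forall y, A y -> u y = v y) -> A x ->
  pd i u x = pd i v x.
Proof.
move=> uv Ax; apply: near_eq_pd; apply: filterS (opens_near Ax).
exact: uv.
Qed.

Lemma near_eq_continuous u v x : (\forall y \near x, u y = v y) ->
  {for x, continuous u} -> {for x, continuous v}.
Proof.
move=> uv; rewrite /prop_for /continuous_at -(nbhs_singleton uv).
move=> cu B /cu uB; have {}uB : nbhs x (u @^-1` B) by [].
by apply: filterS2 uv uB => y /= ->.
Qed.

Lemma eq_Ck n A u v : (forall y, A y -> u y = v y) ->
  Ck n A u -> Ck n A v.
Proof.
elim: n u v => [|n IHn] u v uv.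
  move=> cu x Ax; apply: near_eq_continuous (cu x Ax).
  exact: filterS uv (opens_near Ax).
move=> [cu du]; split=> [x Ax|i].
  have nuv : \forall y \near x, u y = v y.
    exact: filterS uv (opens_near Ax).
  split=> [|i]; last first.
    exact: near_eq_derivable nuv ((cu x Ax).2 i).
  exact: near_eq_continuous nuv (cu x Ax).1.
by apply: IHn (du i) => y Ay; exact: eq_pd Ay.
Qed.

Lemma eq_smooth A u v : (forall y, A y -> u y = v y) ->
  smooth A u -> smooth A v.
Proof.
by move=> uv /smoothP Cu; apply/smoothP => n; exact: eq_Ck (Cu n).
Qed.

Lemma pd_cst (c : R) i x : pd i (fun=> c) x = 0.
Proof. exact: derive_cst. Qed.

Lemma derivable_pdD u v x i :
  derivable u x (delta_mx 0 i) -> derivable v x (delta_mx 0 i) ->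
  pd i (fun y => u y + v y) x = pd i u x + pd i v x.
Proof. exact: deriveD. Qed.

Lemma derivable_pdM u v x i :
  derivable u x (delta_mx 0 i) -> derivable v x (delta_mx 0 i) ->
  pd i (fun y => u y * v y) x = pd i u x * v x + u x * pd i v x.
Proof.
move=> du dv; transitivity (u x *: pd i v x + v x *: pd i u x).
  exact: (deriveM du dv).
rewrite addrC; congr (_ + _); first exact: mulrC.
Qed.

Lemma Ck_cst n A (c : R) : Ck n A (fun=> c).
Proof.
elim: n c => [|n IHn] c /=; first by move=> x _; exact: cst_continuous.
split=> [x _|i]; first by split; [exact: cst_continuous|move=> i;
  exact: derivable_cst].
by have -> : pd i (fun=> c) = (fun=> 0) by apply/funext => x; exact: pd_cst.
Qed.

Lemma CkD n A u v : Ck n A u -> Ck n A v -> Ck n A (fun y => u y + v y).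
Proof.
elim: n u v => [|n IHn] u v.
  by move=> cu cv x Ax; apply: continuousD; [exact: cu|exact: cv].
move=> [cu du] [cv dv]; split=> [x Ax|i].
  have [cux dux] := cu x Ax; have [cvx dvx] := cv x Ax.
  by split=> [|i]; [exact: continuousD|exact: derivableD].
apply: (@eq_Ck n A (fun y => pd i u y + pd i v y)) => // [y Ay|].
  by rewrite derivable_pdD//; [exact: (cu y Ay).2|exact: (cv y Ay).2].
exact: (IHn _ _ (du i) (dv i)).
Qed.

Lemma CkM n A u v : Ck n A u -> Ck n A v -> Ck n A (fun y => u y * v y).
Proof.
elim: n u v => [|n IHn] u v.
  by move=> cu cv x Ax; apply: continuousM; [exact: cu|exact: cv].
(* The Leibniz rule pairs the derivative of one factor with the other factor itself, whose order is
   lowered by one to match. *)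
move=> Cu Cv; have Cu' := CkW Cu; have Cv' := CkW Cv.
case: Cu Cv => [cu du] [cv dv]; split=> [x Ax|i].
  have [cux dux] := cu x Ax; have [cvx dvx] := cv x Ax.
  by split=> [|i]; [exact: continuousM|exact: derivableM].
apply: (@eq_Ck n A (fun y => pd i u y * v y + u y * pd i v y)) => // [y Ay|].
  by rewrite derivable_pdM//; [exact: (cu y Ay).2|exact: (cv y Ay).2].
by apply: CkD => //; [exact: (IHn _ _ (du i) Cv')|exact: (IHn _ _ Cu' (dv i))].
Qed.

Lemma derivable_pdV u x i : u x != 0 -> derivable u x (delta_mx 0 i) ->
  pd i (fun y => (u y)^-1) x = - (u x)^-1 * (u x)^-1 * pd i u x.
Proof.
move=> u0 du; transitivity (- (u x) ^- 2 *: pd i u x);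
  first exact: (deriveV u0 du).
by rewrite -exprVn expr2 mulNr.
Qed.

Lemma CkV n A u : (forall x, A x -> u x != 0) -> Ck n A u ->
  Ck n A (fun y => (u y)^-1).
Proof.
move=> u0; elim: n => [|n IHn].
  by move=> cu x Ax; apply: continuousV; [exact: u0|exact: cu].
move=> Cu; have CV := IHn (CkW Cu); case: Cu => [cu du]; split=> [x Ax|i].
  have [cux dux] := cu x Ax.
  by split=> [|i]; [apply: continuousV => //;
    exact: u0|apply: derivableV => //; exact: u0].
(* The derivative of the inverse contains the inverse itself only to the order already covered by
   the induction hypothesis. *)
apply: (@eq_Ck n A (fun y => ((fun=> -1) y * (u y)^-1) * (u y)^-1 * pd i u y))
  => // [y Ay|].
  by rewrite derivable_pdV ?mulN1r//; [exact: u0|exact: (cu y Ay).2].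
apply: CkM (du i) => //; do 2?apply: CkM => //; exact: Ck_cst.
Qed.

Lemma smooth_cst A (c : R) : smooth A (fun=> c).
Proof. by apply/smoothP => n; exact: Ck_cst. Qed.

(** * Closure and differentiation rules for smooth functions *)

Section Algebra.
Variable A : opens R m.

Lemma smoothD u v : smooth A u -> smooth A v ->
  smooth A (fun y => u y + v y).
Proof.
move=> /smoothP su /smoothP sv; apply/smoothP => n.
exact: CkD.
Qed.

Lemma smoothM u v : smooth A u -> smooth A v ->
  smooth A (fun y => u y * v y).
Proof.
move=> /smoothP su /smoothP sv; apply/smoothP => n.
exact: CkM.
Qed.

Lemma smoothN u : smooth A u -> smooth A (fun y => - u y).
Proof.
move=> su; apply: (@eq_smooth A (fun y => (fun=> -1) y * u y)) => //.
  by move=> y _; rewrite mulN1r.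
by apply: smoothM => //; exact: smooth_cst.
Qed.

Lemma smoothB u v : smooth A u -> smooth A v ->
  smooth A (fun y => u y - v y).
Proof. by move=> su sv; apply: smoothD => //; exact: smoothN. Qed.

Lemma smoothV u : (forall x, A x -> u x != 0) -> smooth A u ->
  smooth A (fun y => (u y)^-1).
Proof. by move=> u0 /smoothP su; apply/smoothP => n; exact: CkV. Qed.

Lemma smooth_sum (I : Type) (r : seq I) (P : pred I) (F : I -> 'rV[R]_m -> R) :
  (forall k, smooth A (F k)) -> smooth A (fun y => \sum_(k <- r | P k) F k y).
Proof.
move=> sF; elim: r => [|k r IHr].
  by under eq_fun do rewrite big_nil; exact: smooth_cst.
under eq_fun do rewrite big_cons; case: (P k) => //.
exact: smoothD.
Qed.

Lemma smooth_prod (I : Type) (r : seq I) (P : pred I) (F : I -> 'rV[R]_m -> R) :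
  (forall k, smooth A (F k)) -> smooth A (fun y => \prod_(k <- r | P k) F k y).
Proof.
move=> sF; elim: r => [|k r IHr].
  by under eq_fun do rewrite big_nil; exact: smooth_cst.
under eq_fun do rewrite big_cons; case: (P k) => //.
exact: smoothM.
Qed.

Lemma smooth_pdC u i j x : smooth A u -> A x ->
  pd i (pd j u) x = pd j (pd i u) x.
Proof.
move=> su Ax; have nA := opens_near Ax; apply: pdC.
- by apply: filterS nA => y Ay k; exact: smooth_derivable su Ay.
- by apply: filterS nA => y Ay; exact: smooth_derivable (smooth_pd _ su) Ay.
- by apply: filterS nA => y Ay; exact: smooth_derivable (smooth_pd _ su) Ay.
- exact: smooth_cont (smooth_pd _ (smooth_pd _ su)) Ax.
- exact: smooth_cont (smooth_pd _ (smooth_pd _ su)) Ax.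
Qed.

Lemma pdD u v x i : smooth A u -> smooth A v -> A x ->
  pd i (fun y => u y + v y) x = pd i u x + pd i v x.
Proof.
move=> su sv Ax; apply: derivable_pdD; exact: smooth_derivable Ax.
Qed.

Lemma pdM u v x i : smooth A u -> smooth A v -> A x ->
  pd i (fun y => u y * v y) x = pd i u x * v x + u x * pd i v x.
Proof.
move=> su sv Ax; apply: derivable_pdM; exact: smooth_derivable Ax.
Qed.

Lemma pdN u x i : smooth A u -> A x -> pd i (fun y => - u y) x = - pd i u x.
Proof. by move=> su Ax; apply: deriveN; exact: smooth_derivable Ax. Qed.

Lemma pdB u v x i : smooth A u -> smooth A v -> A x ->
  pd i (fun y => u y - v y) x = pd i u x - pd i v x.
Proof. by move=> su sv Ax; rewrite pdD ?pdN//; exact: smoothN. Qed.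

Lemma pdZ (c : R) u x i : smooth A u -> A x ->
  pd i (fun y => c * u y) x = c * pd i u x.
Proof.
move=> su Ax; rewrite (pdM i (smooth_cst A c) su Ax) pd_cst mul0r add0r//.
Qed.

Lemma pd_sum (I : Type) (r : seq I) (P : pred I) (F : I -> 'rV[R]_m -> R) x i :
  (forall k, smooth A (F k)) -> A x ->
  pd i (fun y => \sum_(k <- r | P k) F k y) x = \sum_(k <- r | P k) pd i (F k)
    x.
Proof.
move=> sF Ax; elim: r => [|k r IHr].
  by under eq_fun do rewrite big_nil; rewrite pd_cst big_nil.
rewrite big_cons; under eq_fun do rewrite big_cons; case: (P k) => //.
by rewrite -IHr pdD//; exact: smooth_sum.
Qed.

End Algebra.

End Smooth.

(** * Composition of smooth functions *)

Section Composition.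
Context {R : realType} {m n : nat}.
Variables (A : opens R m) (B : opens R n) (t : 'rV[R]_m -> 'rV[R]_n).
Hypotheses (AB : forall x, A x -> B (t x))
  (st : forall a, smooth A (fun x => t x 0 a)).

Lemma is_derive_smooth_comp u x i : smooth B u -> A x ->
  is_derive x (delta_mx 0 i) (u \o t) (\sum_a dmap t x i a * pd a u (t x)).
Proof.
move=> su Ax; under eq_bigr do rewrite mxE.
apply: is_derive_comp => [a||a].
- exact: smooth_derivable Ax.
- apply: filterS (opens_near (AB Ax)) => y By a.
  exact: smooth_derivable su By.
- exact: smooth_cont (smooth_pd _ su) (AB Ax).
Qed.

Lemma pd_comp u x i : smooth B u -> A x ->
  pd i (fun y => u (t y)) x = \sum_a dmap t x i a * pd a u (t x).
Proof. by move=> su /(is_derive_smooth_comp i su)[]. Qed.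

(** The induction on the order runs over all [u] at once, because the derivative of the composite
    involves the functions [pd a u] composed with [t]. *)
Lemma smooth_comp u : smooth B u -> smooth A (fun y => u (t y)).
Proof.
move=> su; apply/smoothP => k; elim: k u su => [|k IHk] u su.
  move=> x Ax; apply: continuous_comp; last exact: smooth_cont (AB Ax).
  by apply: (cvg_box (F := nbhs x)) => j; exact: smooth_cont (st j) Ax.
split=> [x Ax|i].
  split=> [|i]; last by have [] := is_derive_smooth_comp i su Ax.
  apply: continuous_comp; last exact: smooth_cont (AB Ax).
  by apply: (cvg_box (F := nbhs x)) => j; exact: smooth_cont (st j) Ax.
apply: (@eq_Ck _ _ k A (fun x => \sum_a pd i (fun y =>
  t y 0 a) x * pd a u (t x))) => //.
  by move=> x Ax; rewrite pd_comp//; under [RHS]eq_bigr do rewrite mxE.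
elim: (index_enum _) => [|a r IHr].
  by under eq_fun do rewrite big_nil; exact: Ck_cst.
under eq_fun do rewrite big_cons; apply: CkD => //; apply: CkM => //.
  by move: (k); exact/smoothP/smooth_pd.
by apply: IHk; exact: smooth_pd.
Qed.

End Composition.

(* Locked, like [connection] and [curvature] below, so that conversion does not
   unfold derivatives. *)
HB.lock Definition pdm (R : realType) (m p q : nat) (k : 'I_m)
    (M : 'rV[R]_m -> 'M[R]_(p, q)) (x : 'rV[R]_m) : 'M[R]_(p, q) :=
  \matrix_(i, j) pd k (fun y => M y i j) x.

(** * Entrywise calculus of matrix-valued functions *)

Section SmoothMatrices.
Context {R : realType} {m : nat}.
Implicit Types (p q r : nat).

Definition smooth_mx {p q} (A : opens R m) (M : 'rV[R]_m -> 'M[R]_(p, q)) :=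
  forall i j, smooth A (fun y => M y i j).


Lemma pdmE p q k (M : 'rV[R]_m -> 'M[R]_(p, q)) x i j :
  pdm k M x i j = pd k (fun y => M y i j) x.
Proof. by rewrite pdm.unlock mxE. Qed.

Variable A : opens R m.

Lemma eq_smooth_mx p q (M N : 'rV[R]_m -> 'M[R]_(p, q)) :
  (forall y, A y -> M y = N y) -> smooth_mx A M -> smooth_mx A N.
Proof.
move=> MN sM i j; apply: (@eq_smooth _ _ A) (sM i j) => y Ay.
by rewrite MN.
Qed.

Lemma eq_pdm p q (M N : 'rV[R]_m -> 'M[R]_(p, q)) x k :
  (forall y, A y -> M y = N y) -> A x -> pdm k M x = pdm k N x.
Proof.
move=> MN Ax; apply/matrixP => i j; rewrite !pdmE.
by apply: (eq_pd k _ Ax) => y /MN ->.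
Qed.

Lemma smooth_pdm p q (M : 'rV[R]_m -> 'M[R]_(p, q)) k :
  smooth_mx A M -> smooth_mx A (pdm k M).
Proof.
by move=> sM i j; under eq_fun do rewrite pdmE; exact: smooth_pd.
Qed.

Lemma smooth_mxD p q (M N : 'rV[R]_m -> 'M[R]_(p, q)) :
  smooth_mx A M -> smooth_mx A N -> smooth_mx A (fun y => M y + N y).
Proof.
by move=> sM sN i j; under eq_fun do rewrite mxE; exact: smoothD.
Qed.

Lemma smooth_mxN p q (M : 'rV[R]_m -> 'M[R]_(p, q)) :
  smooth_mx A M -> smooth_mx A (fun y => - M y).
Proof. by move=> sM i j; under eq_fun do rewrite mxE; exact: smoothN. Qed.

Lemma smooth_mxB p q (M N : 'rV[R]_m -> 'M[R]_(p, q)) :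
  smooth_mx A M -> smooth_mx A N -> smooth_mx A (fun y => M y - N y).
Proof. by move=> sM sN; apply: smooth_mxD => //; exact: smooth_mxN. Qed.

Lemma smooth_mxZ p q u (M : 'rV[R]_m -> 'M[R]_(p, q)) :
  smooth A u -> smooth_mx A M -> smooth_mx A (fun y => u y *: M y).
Proof.
by move=> su sM i j; under eq_fun do rewrite mxE; exact: smoothM.
Qed.

Lemma smooth_mxM p q r (M : 'rV[R]_m -> 'M[R]_(p, q))
    (N : 'rV[R]_m -> 'M[R]_(q, r)) :
  smooth_mx A M -> smooth_mx A N -> smooth_mx A (fun y => M y *m N y).
Proof.
move=> sM sN i j; under eq_fun do rewrite mxE.
by apply: smooth_sum => // k; exact: smoothM.
Qed.

Lemma smooth_tr p q (M : 'rV[R]_m -> 'M[R]_(p, q)) :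
  smooth_mx A M -> smooth_mx A (fun y => (M y)^T).
Proof. by move=> sM i j; under eq_fun do rewrite mxE; exact: sM. Qed.

Lemma smooth_mx_sum p q (I : Type) (s : seq I) (F : I -> 'rV[R]_m -> 'M[R]_(p,
  q)) :
  (forall k, smooth_mx A (F k)) -> smooth_mx A (fun y => \sum_(k <- s) F k y).
Proof.
move=> sF i j; under eq_fun do rewrite summxE.
by apply: smooth_sum => // k; exact: sF.
Qed.

Lemma smooth_det p (M : 'rV[R]_m -> 'M[R]_p) :
  smooth_mx A M -> smooth A (fun y => \det (M y)).
Proof.
move=> sM; apply: smooth_sum => // s; apply: smoothM; first exact: smooth_cst.
by apply: smooth_prod => // i; exact: sM.
Qed.

Lemma smooth_invmx p (M : 'rV[R]_m -> 'M[R]_p) :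
  (forall y, A y -> M y \in unitmx) -> smooth_mx A M ->
  smooth_mx A (fun y => invmx (M y)).
Proof.
move=> uM sM.
(* Cramer's formula: the entries of the inverse are polynomials in the entries of [M] divided by the
   determinant. *)
apply: (@eq_smooth_mx _ _ (fun y => (\det (M y))^-1 *: \adj (M y))).
  by move=> y Ay; rewrite /invmx uM.
apply: smooth_mxZ.
  apply: smoothV => //; last exact: smooth_det.
  by move=> y /uM; rewrite unitmxE unitfE.
move=> i j; under eq_fun do rewrite mxE.
apply: smoothM => //; first exact: smooth_cst.
by apply: smooth_det => a b; under eq_fun do rewrite !mxE; exact: sM.
Qed.

Lemma smooth_tr_mx p (M : 'rV[R]_m -> 'M[R]_p) :
  smooth_mx A M -> smooth A (fun y => \tr (M y)).
Proof. by move=> sM; apply: smooth_sum => // i; exact: sM. Qed.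

Lemma pdm_cst p q (M : 'M[R]_(p, q)) (k : 'I_m) x :
  pdm k (fun=> M) x = 0.
Proof. by apply/matrixP => i j; rewrite pdmE mxE; exact: pd_cst. Qed.

Lemma pdmD p q (M N : 'rV[R]_m -> 'M[R]_(p, q)) k x :
  smooth_mx A M -> smooth_mx A N -> A x ->
  pdm k (fun y => M y + N y) x = pdm k M x + pdm k N x.
Proof.
move=> sM sN Ax; apply/matrixP => i j; rewrite !(pdmE, mxE).
under [X in pd k X]eq_fun do rewrite mxE.
exact: pdD Ax.
Qed.

Lemma pdmN p q (M : 'rV[R]_m -> 'M[R]_(p, q)) k x :
  smooth_mx A M -> A x -> pdm k (fun y => - M y) x = - pdm k M x.
Proof.
move=> sM Ax; apply/matrixP => i j; rewrite !(pdmE, mxE).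
under [X in pd k X]eq_fun do rewrite mxE.
exact: pdN Ax.
Qed.

Lemma pdmB p q (M N : 'rV[R]_m -> 'M[R]_(p, q)) k x :
  smooth_mx A M -> smooth_mx A N -> A x ->
  pdm k (fun y => M y - N y) x = pdm k M x - pdm k N x.
Proof. by move=> sM sN Ax; rewrite pdmD ?pdmN//; exact: smooth_mxN. Qed.

Lemma pdmZ p q u (M : 'rV[R]_m -> 'M[R]_(p, q)) k x :
  smooth A u -> smooth_mx A M -> A x ->
  pdm k (fun y => u y *: M y) x = pd k u x *: M x + u x *: pdm k M x.
Proof.
move=> su sM Ax; apply/matrixP => i j; rewrite !(pdmE, mxE).
under [X in pd k X]eq_fun do rewrite mxE.
exact: pdM Ax.
Qed.

Lemma pdmM p q r (M : 'rV[R]_m -> 'M[R]_(p, q)) (N : 'rV[R]_m -> 'M[R]_(q, r)) k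
  x :
  smooth_mx A M -> smooth_mx A N -> A x ->
  pdm k (fun y => M y *m N y) x = pdm k M x *m N x + M x *m pdm k N x.
Proof.
move=> sM sN Ax; apply/matrixP => i j; rewrite !(pdmE, mxE).
under [X in pd k X]eq_fun do rewrite mxE.
rewrite (@pd_sum _ _ A) => [|l|//]; last exact: smoothM.
rewrite -big_split/=; apply: eq_bigr => l _.
by rewrite !pdmE; exact: pdM Ax.
Qed.

Lemma pdm_tr p q (M : 'rV[R]_m -> 'M[R]_(p, q)) k x :
  pdm k (fun y => (M y)^T) x = (pdm k M x)^T.
Proof.
apply/matrixP => i j; rewrite !(pdmE, mxE).
by under [X in pd k X]eq_fun do rewrite mxE.
Qed.

Lemma pdm_sum p q (I : Type) (s : seq I) (F : I -> 'rV[R]_m -> 'M[R]_(p, q)) k x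
  :
  (forall i, smooth_mx A (F i)) -> A x ->
  pdm k (fun y => \sum_(i <- s) F i y) x = \sum_(i <- s) pdm k (F i) x.
Proof.
move=> sF Ax; apply/matrixP => i j; rewrite pdmE summxE.
under [X in pd k X]eq_fun do rewrite summxE.
rewrite (@pd_sum _ _ A) => [|l|//]; last exact: sF.
by apply: eq_bigr => l _; rewrite pdmE.
Qed.

Lemma pdmC p q (M : 'rV[R]_m -> 'M[R]_(p, q)) k l x :
  smooth_mx A M -> A x -> pdm k (pdm l M) x = pdm l (pdm k M) x.
Proof.
move=> sM Ax; apply/matrixP => i j; rewrite !pdmE.
have E k' : (fun y => pdm k' M y i j) = pd k' (fun y => M y i j).
  by apply/funext => y; exact: pdmE.
rewrite !E; exact: (smooth_pdC _ _ (sM i j) Ax).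
Qed.

End SmoothMatrices.

Lemma pdm_comp (R : realType) (m n p q : nat) (A : opens R m)
    (B : opens R n) (t : 'rV[R]_m -> 'rV[R]_n)
    (M : 'rV[R]_n -> 'M[R]_(p, q)) k x :
  (forall x, A x -> B (t x)) ->
  (forall a, smooth A (fun x => t x 0 a)) -> smooth_mx B M -> A x ->
  pdm k (fun y => M (t y)) x = \sum_d dmap t x k d *: pdm d M (t x).
Proof.
move=> AB st sM Ax; apply/matrixP => i j; rewrite pdmE summxE.
rewrite (pd_comp AB st k (sM i j) Ax).
by apply: eq_bigr => d _; rewrite !mxE pdmE.
Qed.

(** * Connection and curvature *)

Section MatrixEntries.
Context {R : realType}.
Implicit Types p q : nat.

Lemma mxaddE p q (M N : 'M[R]_(p, q)) i j : (M + N) i j = M i j + N i j.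
Proof. exact: mxE. Qed.

Lemma mxoppE p q (M : 'M[R]_(p, q)) i j : (- M) i j = - M i j.
Proof. exact: mxE. Qed.

Lemma mxmulE p q r (M : 'M[R]_(p, q)) (N : 'M[R]_(q, r)) i j :
  (M *m N) i j = \sum_k M i k * N k j.
Proof. exact: mxE. Qed.

Lemma mxtrE p q (M : 'M[R]_(p, q)) i j : M^T i j = M j i.
Proof. exact: mxE. Qed.

Lemma mxscaleE p q z (M : 'M[R]_(p, q)) i j : (z *: M) i j = z * M i j.
Proof. exact: mxE. Qed.

Lemma dfunE m (u : 'rV[R]_m -> R) x k : dfun u x 0 k = pd k u x.
Proof. exact: mxE. Qed.

Lemma trmxD p q (M N : 'M[R]_(p, q)) : (M + N)^T = M^T + N^T.
Proof. by apply/matrixP => i j; rewrite !mxE. Qed.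

Lemma trmxB p q (M N : 'M[R]_(p, q)) : (M - N)^T = M^T - N^T.
Proof. by apply/matrixP => i j; rewrite !mxE. Qed.

Lemma trmxZ p q z (M : 'M[R]_(p, q)) : (z *: M)^T = z *: M^T.
Proof. by apply/matrixP => i j; rewrite !mxE. Qed.

End MatrixEntries.

HB.lock Definition connection (R : realType) (m : nat)
    (g : 'rV[R]_m -> 'M[R]_m) (k : 'I_m) (x : 'rV[R]_m) : 'M[R]_m :=
  \matrix_(i, l) christoffel g l k i x.

Lemma connection_christoffel (R : realType) (m : nat)
    (g : 'rV[R]_m -> 'M[R]_m) k x i l :
  connection g k x i l = christoffel g l k i x.
Proof. by rewrite connection.unlock mxE. Qed.

(** The entry [(i, l)] is R^l_{ijk}. Each connection matrix is the transpose of the one acting on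
    vectors, which reverses the order of the two products. *)
HB.lock Definition curvature (R : realType) (m : nat)
    (g : 'rV[R]_m -> 'M[R]_m) (j k : 'I_m) (x : 'rV[R]_m) : 'M[R]_m :=
  pdm j (connection g k) x - pdm k (connection g j) x
  + connection g k x *m connection g j x - connection g j x *m connection g k x.

Lemma curvatureE (R : realType) (m : nat) (g : 'rV[R]_m -> 'M[R]_m) j k x :
  curvature g j k x =
  pdm j (connection g k) x - pdm k (connection g j) x
  + connection g k x *m connection g j x - connection g j x *m connection g k x.
Proof. by rewrite curvature.unlock. Qed.

Section Connection.
Context {R : realType} {m : nat}.
Variable g : 'rV[R]_m -> 'M[R]_m.

Local Notation connection := (connection g).
(* Covariant derivative of the covector fields in the columns of [w]. *)
Definition covD p (k : 'I_m) (w : 'rV[R]_m -> 'M[R]_(m, p)) (x : 'rV[R]_m) :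
  'M[R]_(m, p) := pdm k w x - connection k x *m w x.

Local Notation curvature := (curvature g).

Lemma cov2E T x i j k :
  cov2 g T x i j k =
  (pdm k T x - connection k x *m T x - T x *m (connection k x)^T) i j.
Proof.
rewrite /cov2 !(mxaddE, mxoppE) pdmE; congr (_ - _ - _).
  by rewrite mxmulE; apply: eq_bigr => l _; rewrite connection_christoffel.
rewrite mxmulE; apply: eq_bigr => l _.
by rewrite mxtrE connection_christoffel mulrC.
Qed.

Lemma hessE u x i j :
  hess g u x i j = covD j (fun y => (dfun u y)^T) x i 0.
Proof.
rewrite /covD mxaddE mxoppE pdmE [LHS]mxE.
have -> : (fun y => (dfun u y)^T i 0) = (fun y => dfun u y 0 i).
  by apply/funext => y; rewrite mxtrE.
congr (_ - _); rewrite mxmulE; apply: eq_bigr => l _.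
by rewrite connection_christoffel mxtrE.
Qed.

Lemma riem_upE x l i j k : riem_up g l i j k x = curvature j k x i l.
Proof.
have E k' : (fun y => connection k' y i l) = christoffel g l k' i.
  by apply/funext => y; rewrite connection_christoffel.
rewrite /riem_up !curvatureE !(mxaddE, mxoppE) !pdmE !E -[RHS]addrA;
  congr (_ + _).
rewrite !mxmulE -sumrB; apply: eq_bigr => q _.
rewrite !connection_christoffel (mulrC (christoffel g l j q x)).
by rewrite (mulrC (christoffel g l k q x)).
Qed.

Lemma curvatureN j k x : curvature k j x = - curvature j k x.
Proof.
by apply/matrixP => a b; rewrite !curvatureE !(mxaddE, mxoppE); ring.
Qed.

Variable A : opens R m.
Hypotheses (gS : smooth_mx A g) (gT : forall y, A y -> (g y)^T = g y)
  (gU : forall y, A y -> g y \in unitmx).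

(** The Christoffel symbols of the first kind: the upper index is lowered and the inverse metric
    disappears. *)
Definition christoffel1 (k : 'I_m) (x : 'rV[R]_m) : 'M[R]_m :=
  \matrix_(i, q) (2^-1 * (pdm k g x i q + pdm i g x k q - pdm q g x k i)).

Lemma invmx_sym y : A y -> (invmx (g y))^T = invmx (g y).
Proof. by move=> Ay; rewrite trmx_inv gT. Qed.

Lemma pdm_metric_tr k x : A x -> (pdm k g x)^T = pdm k g x.
Proof. by move=> Ax; rewrite -pdm_tr; apply: (eq_pdm k _ Ax) => y /gT. Qed.

Lemma pdm_metric_sym k x i j : A x -> pdm k g x i j = pdm k g x j i.
Proof. by move=> /(pdm_metric_tr k) E; rewrite -[in LHS]E mxtrE. Qed.

Lemma connectionE k y : A y ->
  connection k y = christoffel1 k y *m invmx (g y).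
Proof.
move=> Ay; apply/matrixP => i l.
rewrite mxmulE connection_christoffel /christoffel mulr_sumr.
apply: eq_bigr => q _; rewrite [christoffel1 _ _ _ _]mxE !pdmE.
by rewrite -[in RHS](invmx_sym Ay) mxE; ring.
Qed.

Lemma smooth_christoffel1 k : smooth_mx A (christoffel1 k).
Proof.
move=> i j; under eq_fun do rewrite mxE.
apply: smoothM; first exact: smooth_cst.
apply: smoothB; last exact: smooth_pdm.
by apply: smoothD; exact: smooth_pdm.
Qed.

Lemma smooth_invmetric : smooth_mx A (fun y => invmx (g y)).
Proof. exact: smooth_invmx. Qed.

Lemma smooth_connection k : smooth_mx A (connection k).
Proof.
apply: (eq_smooth_mx (fun y Ay => esym (connectionE k Ay))).
by apply: smooth_mxM; [exact: smooth_christoffel1|exact: smooth_invmetric].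
Qed.

Lemma eq_covD p k (v w : 'rV[R]_m -> 'M[R]_(m, p)) x :
  (forall y, A y -> v y = w y) -> A x -> covD k v x = covD k w x.
Proof. by move=> vw Ax; rewrite /covD (eq_pdm k vw Ax) vw. Qed.

Lemma smooth_covD p k (w : 'rV[R]_m -> 'M[R]_(m, p)) :
  smooth_mx A w -> smooth_mx A (covD k w).
Proof.
move=> sw; apply: smooth_mxB; first exact: smooth_pdm.
by apply: smooth_mxM => //; exact: smooth_connection.
Qed.

Lemma smooth_curvature j k : smooth_mx A (curvature j k).
Proof.
have sG := smooth_connection.
apply: (eq_smooth_mx (fun y _ => esym (curvatureE g j k y))).
apply: smooth_mxB; last by apply: smooth_mxM.
apply: smooth_mxD; last by apply: smooth_mxM.
by apply: smooth_mxB; apply: smooth_pdm.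
Qed.

Lemma connection_sym k i l y : A y -> connection k y i l = connection i y k l.
Proof.
move=> Ay; rewrite !connectionE// !mxE; apply: eq_bigr => q _.
rewrite !mxE; congr (_ * _ * _); rewrite [pdm k g y i q + _]addrC.
by rewrite (pdm_metric_sym q k i Ay).
Qed.

Lemma connection_metric k x : A x -> connection k x *m g x = christoffel1 k x.
Proof. by move=> Ax; rewrite connectionE// mulmxKV// gU. Qed.

(** In the Christoffel symbols of the first kind plus their transpose, the derivatives of the metric
    in the directions other than [k] cancel. *)
Lemma metric_compat k x : A x ->
  pdm k g x = connection k x *m g x + g x *m (connection k x)^T.
Proof.
move=> Ax; rewrite -{2}(gT Ax) -trmx_mul connection_metric//.
apply/matrixP => i j; rewrite !mxE.
rewrite (pdm_metric_sym j k i Ax) (pdm_metric_sym i k j Ax).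
by rewrite (pdm_metric_sym k j i Ax); field.
Qed.

(** Differentiate [metric_compat] once more and antisymmetrise: one side vanishes because partial
    derivatives commute, the other is the curvature with lowered index plus its transpose. *)
Lemma curvature_skew j k x : A x ->
  curvature j k x *m g x + (curvature j k x *m g x)^T = 0.
Proof.
move=> Ax.
have E a b : pdm a (pdm b g) x =
    pdm a (connection b) x *m g x
    + connection b x *m (connection a x *m g x + g x *m (connection a x)^T)
    + ((connection a x *m g x + g x *m (connection a x)^T) *m (connection b x)^T
       + g x *m (pdm a (connection b) x)^T).
  have sG := smooth_connection.
  rewrite (eq_pdm a (fun y Ay => metric_compat b Ay) Ax).
  rewrite (pdmD _ (smooth_mxM (sG b) gS) (smooth_mxM gS (smooth_tr (sG b))) Ax).
  rewrite (pdmM _ (sG b) gS Ax) (pdmM _ gS (smooth_tr (sG b)) Ax).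
  by rewrite pdm_tr -metric_compat.
have := pdmC j k gS Ax; rewrite !E => {E} H.
have -> : (curvature j k x *m g x)^T = g x *m
    ((pdm j (connection k) x)^T - (pdm k (connection j) x)^T
     + (connection j x)^T *m (connection k x)^T
     - (connection k x)^T *m (connection j x)^T).
  rewrite trmx_mul gT//; congr (_ *m _); rewrite -!trmx_mul curvatureE.
  by apply/matrixP => a b; rewrite !(mxtrE, mxaddE, mxoppE).
rewrite !curvatureE.
move: H; rewrite !(mulmxDl, mulmxDr, mulmxBl, mulmxBr, mulNmx, mulmxN) !mulmxA.
move=> /matrixP H; apply/matrixP => a b; move: (H a b).
rewrite !(mxaddE, mxoppE) => H'; rewrite [RHS]mxE; lra.
Qed.

(** The connection is torsion-free, so over the cyclic sum the derivative terms and the products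
    each cancel in pairs. *)
Lemma bianchi i j k x : A x ->
  row i (curvature j k x) + row j (curvature k i x) + row k (curvature i j x) =
    0.
Proof.
move=> Ax; apply/rowP => l.
rewrite !(mxaddE, mxoppE) ![row _ _ 0 l]mxE [in RHS]mxE.
have S a b c : pdm a (connection b) x c l = pdm a (connection c) x b l.
  rewrite !pdmE; apply: (eq_pd a _ Ax) => y Ay; exact: connection_sym.
have P a b c : (connection a x *m connection b x) c l =
    (connection c x *m connection b x) a l.
  by rewrite !mxE; apply: eq_bigr => q _; rewrite connection_sym.
rewrite !curvatureE !(mxaddE, mxoppE).
rewrite (S j k i) (S k j i) (S i k j) (P k j i) (P j k i) (P k i j); ring.
Qed.

(** The Ricci identity. [covD k] differentiates along a fixed coordinate field and does not treat
    [k] as a tensor index; since coordinate fields commute, the commutator contains no further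
    term. *)
Lemma covDC p j k (w : 'rV[R]_m -> 'M[R]_(m, p)) x : smooth_mx A w -> A x ->
  covD j (covD k w) x - covD k (covD j w) x = - (curvature j k x *m w x).
Proof.
move=> sw Ax; have sG := smooth_connection.
have E a b : covD a (covD b w) x = pdm a (pdm b w) x
    - (pdm a (connection b) x *m w x + connection b x *m pdm a w x)
    - connection a x *m (pdm b w x - connection b x *m w x).
  rewrite {1}/covD (pdmB _ (smooth_pdm b sw) (smooth_mxM (sG b) sw) Ax).
  by rewrite (pdmM _ (sG b) sw Ax).
rewrite !E (pdmC j k sw Ax) !curvatureE.
rewrite !(mulmxDl, mulmxDr, mulmxBl, mulmxBr, mulNmx, mulmxN) !mulmxA.
by apply/matrixP => a b; rewrite !(mxaddE, mxoppE); ring.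
Qed.

(** Regard the columns of [T] as covector fields. The connection term on the second index of [cov2]
    is symmetric in the last two indices, so the Codazzi equation says that differentiating column
    [j] along [k] or column [k] along [j] gives the same covector. In the cyclic sum of Ricci
    identities the six second derivatives then cancel in pairs. *)
Lemma codazzi_curvature (T : 'rV[R]_m -> 'M[R]_m) j k l x :
  smooth_mx A T ->
  (forall y, A y -> forall i j k, cov2 g T y i j k = cov2 g T y i k j) ->
  A x ->
  curvature l k x *m col j (T x) + curvature j l x *m col k (T x)
  + curvature k j x *m col l (T x) = 0.
Proof.
move=> sT cT Ax; pose b j y := col j (T y).
have sb j' : smooth_mx A (b j').
  by move=> i' o; under eq_fun do rewrite mxE; exact: sT.
have bE j' k' y i' : covD k' (b j') y i' 0 =
    (pdm k' T y - connection k' y *m T y) i' j'.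
  have E : pdm k' (b j') y i' 0 = pdm k' T y i' j'.
    rewrite !pdmE; have -> // : (fun z => b j' z i' 0) = (fun z => T z i' j').
    by apply/funext => z; rewrite mxE.
  rewrite /covD !(mxaddE, mxoppE) E; congr (_ - _).
  by rewrite !mxmulE; apply: eq_bigr => q _; rewrite mxE.
have bC j' k' y : A y -> covD k' (b j') y = covD j' (b k') y.
  move=> Ay; apply/matrixP => i' o; rewrite ord1 !bE.
  have := cT y Ay i' j' k'; rewrite !cov2E !(mxaddE, mxoppE).
  suff -> : (T y *m (connection k' y)^T) i' j' = (T y *m (connection j' y)^T) i'
    k'.
    by move/addIr.
  rewrite !mxmulE; apply: eq_bigr => q _; congr (_ * _).
  by rewrite !mxtrE; exact: connection_sym.
have bCC l' j' k' : covD l' (covD k' (b j')) x = covD l' (covD j' (b k')) x.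
  by apply: eq_covD Ax => y Ay; exact: bC.
have H j' k' l' : curvature j' k' x *m col l' (T x) =
    covD k' (covD j' (b l')) x - covD j' (covD k' (b l')) x.
  by rewrite -[LHS]opprK -(covDC _ _ (sb l') Ax) opprB.
rewrite !H.
rewrite (bCC l j k) (bCC j k l) (bCC k j l).
by rewrite subrKA subrKA subrr.
Qed.

Lemma riemE x l i j k : A x -> riem g x l i j k = (curvature j k x *m g x) i l.
Proof.
move=> Ax; rewrite /riem mxmulE; apply: eq_bigr => q _.
by rewrite riem_upE mulrC -{1}(gT Ax) mxtrE.
Qed.

Lemma ricE x i j : A x -> ric g x i j = \sum_l curvature l j x i l.
Proof.
move=> Ax; rewrite mxE exchange_big /=; apply: eq_bigr => l _.
rewrite -[in RHS](mulmxK (gU Ax) (curvature l j x)) mxmulE.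
apply: eq_bigr => k _.
by rewrite riemE// mulrC.
Qed.

Lemma smooth_ric : smooth_mx A (ric g).
Proof.
move=> i j; apply: (@eq_smooth _ _ A (fun x => \sum_l curvature l j x i l)).
  by move=> y Ay; rewrite ricE.
by apply: smooth_sum => l; exact: smooth_curvature.
Qed.

Lemma smooth_dfun u : smooth A u -> smooth_mx A (dfun u).
Proof. by move=> su i j; under eq_fun do rewrite mxE; exact: smooth_pd. Qed.

Lemma smooth_hess u : smooth A u -> smooth_mx A (hess g u).
Proof.
move=> su i j; under eq_fun do rewrite hessE.
by apply: smooth_covD; apply: smooth_tr; exact: smooth_dfun.
Qed.

Lemma smooth_gtrace T : smooth_mx A T -> smooth A (gtrace g T).
Proof.
by move=> sT; apply: smooth_tr_mx; apply: smooth_mxM => //;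
  exact: smooth_invmetric.
Qed.

Lemma smooth_norm_grad2 u : smooth A u -> smooth A (norm_grad2 g u).
Proof.
move=> su; apply: (smooth_mxM (smooth_mxM (smooth_dfun su) smooth_invmetric)).
exact: smooth_tr (smooth_dfun su).
Qed.

Lemma smooth_lapf u : smooth A u -> smooth A (lapf g u).
Proof.
move=> su; apply: smoothB; last exact: smooth_norm_grad2.
exact: smooth_gtrace (smooth_hess su).
Qed.

Lemma hess_sym u x : smooth A u -> A x -> (hess g u x)^T = hess g u x.
Proof.
move=> su Ax; apply/matrixP => i j; rewrite mxE !hessE /covD.
rewrite !(mxaddE, mxoppE) !pdmE; congr (_ - _).
  have E k : (fun y => (dfun u y)^T k 0) = pd k u.
    by apply/funext => y; rewrite !mxE.
  by rewrite !E; exact: (smooth_pdC _ _ su Ax).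
by rewrite !mxE; apply: eq_bigr => q _; rewrite connection_sym.
Qed.

End Connection.

(** * Chain rule and change of charts *)

Section ChainRule.
Context {R : realType} {m n p : nat}.
Variables (A : opens R m) (B : opens R n) (t : 'rV[R]_m -> 'rV[R]_n).
Hypotheses (AB : forall x, A x -> B (t x))
  (st : forall a, smooth A (fun x => t x 0 a)).

Lemma smooth_dmap : smooth_mx A (dmap t).
Proof. by move=> i j; under eq_fun do rewrite mxE; exact: smooth_pd. Qed.

Lemma smooth_mx_comp q r (M : 'rV[R]_n -> 'M[R]_(q, r)) :
  smooth_mx B M -> smooth_mx A (fun y => M (t y)).
Proof. by move=> sM i j; exact: smooth_comp (sM i j). Qed.

Lemma dfun_comp u x : smooth B u -> A x ->
  dfun (fun y => u (t y)) x = dfun u (t x) *m (dmap t x)^T.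
Proof.
move=> su Ax; apply/rowP => i; rewrite [LHS]mxE (pd_comp AB st i su Ax) mxmulE.
by apply: eq_bigr => a _; rewrite mxtrE [dfun _ _ _ _]mxE mulrC.
Qed.

Lemma dmap_comp (Phi : 'rV[R]_n -> 'rV[R]_p) x :
  (forall a, smooth B (fun y => Phi y 0 a)) -> A x ->
  dmap (fun y => Phi (t y)) x = dmap t x *m dmap Phi (t x).
Proof.
move=> sPhi Ax; apply/matrixP => i a.
rewrite [LHS]mxE (pd_comp AB st i (sPhi a) Ax) mxmulE.
by apply: eq_bigr => b _; rewrite [dmap Phi _ _ _]mxE.
Qed.

End ChainRule.

Lemma eq_dfun (R : realType) m (A : opens R m) u v x :
  (forall y, A y -> u y = v y) -> A x -> dfun u x = dfun v x.
Proof.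
move=> uv Ax; apply/rowP => i; rewrite [LHS]mxE [RHS]mxE.
exact: (eq_pd i uv Ax).
Qed.

Lemma eq_dmap (R : realType) m n (A : opens R m)
    (Phi Psi : 'rV[R]_m -> 'rV[R]_n) x :
  (forall y, A y -> Phi y = Psi y) -> A x -> dmap Phi x = dmap Psi x.
Proof.
move=> PP Ax; apply/matrixP => i a; rewrite [LHS]mxE [RHS]mxE.
by apply: (eq_pd i _ Ax) => y /PP ->.
Qed.

Lemma eq_hess (R : realType) m (A : opens R m) g u v x :
  (forall y, A y -> u y = v y) -> A x -> hess g u x = hess g v x.
Proof.
move=> uv Ax; apply/matrixP => i j; rewrite !hessE.
have -> // : covD g j (fun y => (dfun u y)^T) x = covD g j (fun y =>
  (dfun v y)^T) x.
apply: eq_covD Ax => y Ay; congr (_^T); exact: (eq_dfun uv Ay).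
Qed.

Section ChangeOfChart.
Context {R : realType} {m : nat}.
Variables (A B : opens R m) (t : 'rV[R]_m -> 'rV[R]_m)
  (g g' : 'rV[R]_m -> 'M[R]_m).
Hypotheses (AB : forall x, A x -> B (t x))
  (st : forall a, smooth A (fun x => t x 0 a))
  (gS : smooth_mx A g) (gT : forall y, A y -> (g y)^T = g y)
  (gU : forall y, A y -> g y \in unitmx)
  (gS' : smooth_mx B g') (gT' : forall y, B y -> (g' y)^T = g' y)
  (gU' : forall y, B y -> g' y \in unitmx)
  (gt : forall x, A x -> g x = dmap t x *m g' (t x) *m (dmap t x)^T).

Let J := dmap t.
Let G := connection g.
Let G' := connection g'.

Let sJ : smooth_mx A J.
Proof. exact: smooth_dmap. Qed.

Let sG k : smooth_mx A (G k).
Proof. exact: smooth_connection. Qed.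

Let sG' k : smooth_mx B (G' k).
Proof. exact: smooth_connection. Qed.

Lemma dmap_unit x : A x -> dmap t x \in unitmx.
Proof.
by move=> Ax; have := gU Ax; rewrite gt// !unitmx_mul => /andP[/andP[]].
Qed.

(** The connection of the target chart on covectors, pulled back along [t]. *)
Definition pulled_connection (k : 'I_m) (x : 'rV[R]_m) : 'M[R]_m :=
  \sum_d J x k d *: G' d (t x).

Let Gt := pulled_connection.

Lemma pdm_pulled_metric k x : A x ->
  pdm k (fun y => g' (t y)) x = Gt k x *m g' (t x) + g' (t x) *m (Gt k x)^T.
Proof.
move=> Ax; rewrite (pdm_comp k AB st gS' Ax) /Gt /pulled_connection.
rewrite linear_sum mulmx_suml mulmx_sumr -big_split /=.
apply: eq_bigr => d _.
by rewrite (metric_compat gT' gU' d (AB Ax)) scalerDr linearZ -scalemxAl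
  -scalemxAr.
Qed.

Lemma pdm_dmap_sym k i c x : A x -> pdm k J x i c = pdm i J x k c.
Proof.
move=> Ax; rewrite !pdmE.
have E l : (fun y => J y l c) = pd l (fun y => t y 0 c).
  by apply/funext => y; rewrite mxE.
by rewrite !E; exact: (smooth_pdC _ _ (st c) Ax).
Qed.

Lemma pulled_connection_sym k i c x : A x ->
  (J x *m Gt k x) i c = (J x *m Gt i x) k c.
Proof.
move=> Ax; rewrite !mxmulE.
have E a l : Gt l x a c = \sum_d J x l d * G' d (t x) a c.
  by rewrite /Gt /pulled_connection summxE; apply: eq_bigr => d _; rewrite mxE.
under eq_bigr do rewrite E mulr_sumr.
under [RHS]eq_bigr do rewrite E mulr_sumr.
rewrite exchange_big; apply: eq_bigr => a _; apply: eq_bigr => d _.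
by rewrite (connection_sym gT' _ _ _ (AB Ax)) mulrCA.
Qed.

(* The difference of the two sides, with the last index lowered, is skew in its
   last two indices (both connections are metric) and symmetric in the first two
   (both are torsion-free), hence vanishes. *)
Lemma connection_change k x : A x ->
  pdm k J x = G k x *m J x - J x *m Gt k x.
Proof.
move=> Ax; pose D k := G k x *m J x - J x *m Gt k x - pdm k J x.
pose L := g' (t x) *m (J x)^T; pose N k := D k *m L.
have uL : L \in unitmx.
  by rewrite unitmx_mul gU' ?unitmx_tr ?dmap_unit//; exact: AB.
have sN a i j : N a i j = N i a j.
  rewrite /N !mxmulE; apply: eq_bigr => c _; congr (_ * _).
  rewrite /D !(mxaddE, mxoppE) (pdm_dmap_sym a i c Ax).
  rewrite (pulled_connection_sym a i c Ax); congr (_ - _ - _).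
  rewrite !mxmulE; apply: eq_bigr => l _; congr (_ * _).
  exact: (connection_sym gT).
have kN a i j : N a i j = - N a j i.
  suff /matrixP/(_ i j) : N a + (N a)^T = 0.
    by rewrite mxaddE mxtrE [RHS]mxE => /eqP; rewrite addr_eq0 => /eqP.
  have := metric_compat gT gU a Ax.
  rewrite (eq_pdm a gt Ax).
  rewrite (pdmM a (smooth_mxM sJ (smooth_mx_comp AB st gS')) (smooth_tr sJ) Ax).
  rewrite (pdmM a sJ (smooth_mx_comp AB st gS') Ax) pdm_tr.
  rewrite (pdm_pulled_metric a Ax) gt//.
  have NE : N a = G a x *m (J x *m g' (t x) *m (J x)^T)
      - J x *m Gt a x *m g' (t x) *m (J x)^T - pdm a J x *m g' (t x) *m (J x)^T.
    by rewrite /N /D /L !mulmxBl !mulmxA.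
  have NT : (N a)^T = (J x *m g' (t x) *m (J x)^T) *m (G a x)^T
      - J x *m g' (t x) *m (Gt a x)^T *m (J x)^T - J x *m g' (t x) *m (pdm a J
        x)^T.
    rewrite NE !trmxB !trmx_mul trmxK gT'; last exact: AB.
    by rewrite !mulmxA.
  rewrite NT NE !(mulmxDl, mulmxDr) !mulmxA => /matrixP H.
  apply/matrixP => p q; move: (H p q); rewrite !(mxaddE, mxoppE) => H'.
  by rewrite [RHS]mxE; lra.
suff : D k = 0 by rewrite /D => /eqP; rewrite subr_eq0 => /eqP <-.
have N0 : N k = 0.
  apply/matrixP => i j; rewrite [RHS]mxE.
  (* N_kij = -N_kji = -N_jki = N_jik = N_ijk = -N_ikj = -N_kij. *)
  have := kN k i j; rewrite (sN k j i) (kN j k i) (sN j i k) (kN i j k) (sN i k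
    j).
  by lra.
by rewrite -[LHS](mulmxK uL) -/(N k) N0 mul0mx.
Qed.

(** Multiplication by the Jacobian is the pullback of covectors; [connection_change] says that it
    intertwines the two covariant derivatives. *)
Lemma covD_dmap p (w : 'rV[R]_m -> 'M[R]_(m, p)) k x : smooth_mx A w -> A x ->
  covD g k (fun y => J y *m w y) x = J x *m (pdm k w x - Gt k x *m w x).
Proof.
move=> sw Ax; rewrite /covD (pdmM k sJ sw Ax) connection_change//.
rewrite !(mulmxBl, mulmxBr) !mulmxA -/G.
by apply/matrixP => a b; rewrite !(mxaddE, mxoppE); ring.
Qed.

Lemma smooth_pulled_connection k : smooth_mx A (Gt k).
Proof.
apply: smooth_mx_sum => d; apply: smooth_mxZ; first exact: sJ.
exact: (smooth_mx_comp AB st (sG' d)).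
Qed.

Lemma pdm_pulled_connection j k x : A x ->
  pdm j (Gt k) x = \sum_d pdm j J x k d *: G' d (t x)
    + \sum_b \sum_d (J x j b * J x k d) *: pdm b (G' d) (t x).
Proof.
move=> Ax.
have sZ d : smooth_mx A (fun y => J y k d *: G' d (t y)).
  by apply: smooth_mxZ; [exact: sJ|exact: (smooth_mx_comp AB st (sG' d))].
rewrite (pdm_sum _ j sZ Ax) exchange_big -big_split; apply: eq_bigr => d _ /=.
rewrite (pdmZ j (sJ k d) (smooth_mx_comp AB st (sG' d)) Ax) pdmE; congr (_ + _).
rewrite (pdm_comp j AB st (sG' d) Ax) scaler_sumr; apply: eq_bigr => b _.
by rewrite scalerA mulrC.
Qed.

Lemma pulled_connectionM j k x : Gt k x *m Gt j x =
  \sum_b \sum_d (J x j b * J x k d) *: (G' d (t x) *m G' b (t x)).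
Proof.
rewrite mulmx_sumr; apply: eq_bigr => b _; rewrite mulmx_suml.
by apply: eq_bigr => d _; rewrite -scalemxAr -scalemxAl scalerA.
Qed.

(** The Ricci identity applied to the columns of [J], which are the pulled back coordinate
    differentials. Each covariant derivative of [J] is minus [J] times a pulled back connection
    matrix, so the commutator is the curvature of the pulled back connection. *)
Lemma curvature_change j k x : A x ->
  curvature g j k x *m J x =
  J x *m \sum_b \sum_d (J x j b * J x k d) *: curvature g' b d (t x).
Proof.
move=> Ax; have sGt := smooth_pulled_connection.
have E a b : covD g a (covD g b J) x
    = J x *m (Gt a x *m Gt b x) - J x *m pdm a (Gt b) x.
  rewrite (@eq_covD _ _ g A _ _ _ (fun y => J y *m - Gt b y)) => [|y Ay|//].
    rewrite covD_dmap//; last exact: smooth_mxN.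
    rewrite (pdmN _ (sGt b) Ax) mulmxN opprK mulmxDr mulmxN addrC.
    by [].
  by rewrite /covD connection_change// addrAC subrr add0r mulmxN.
have := covDC gS gT gU j k sJ Ax; rewrite !E.
move=> /eqP; rewrite -eqr_oppLR => /eqP <-.
have S1 : \sum_b \sum_d (J x j b * J x k d) *: curvature g' b d (t x) =
   pdm j (Gt k) x - pdm k (Gt j) x + Gt k x *m Gt j x - Gt j x *m Gt k x.
  rewrite !pdm_pulled_connection// !pulled_connectionM.
  (* The second derivatives of [t] are symmetric and drop out of the commutator. *)
  have -> : \sum_d pdm j J x k d *: G' d (t x) = \sum_d pdm k J x j d *: G' d (t
    x).
    by apply: eq_bigr => d _; rewrite pdm_dmap_sym.
  rewrite opprD addrACA subrr add0r.
  rewrite [X in _ = _ - X + _ - _]exchange_big [X in _ = _ - X]exchange_big /=.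
  rewrite -!sumrB -big_split -sumrB /=; apply: eq_bigr => b _.
  rewrite -!sumrB -big_split -sumrB /=; apply: eq_bigr => d _.
  by rewrite !curvatureE [J x k d * _]mulrC !(scalerBr, scalerDr).
rewrite S1 !(mulmxBr, mulmxDr).
by apply/matrixP => a b; rewrite !(mxaddE, mxoppE); ring.
Qed.

Lemma ric_change x : A x -> ric g x = J x *m ric g' (t x) *m (J x)^T.
Proof.
move=> Ax; apply/matrixP => i j; rewrite (ricE gT gU _ _ Ax).
have uJ := dmap_unit Ax.
have E l : curvature g l j x i l = \sum_d \sum_b J x j d *
    (J x l b * (J x *m curvature g' b d (t x) *m invmx (J x)) i l).
  rewrite -[curvature g l j x](mulmxK uJ) curvature_change// mulmx_sumr
    mulmx_suml.
  rewrite summxE exchange_big; apply: eq_bigr => b _ /=.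
  rewrite mulmx_sumr mulmx_suml summxE; apply: eq_bigr => d _.
  by rewrite -scalemxAr -scalemxAl mxE; ring.
under eq_bigr do rewrite E; rewrite exchange_big mxmulE;
  apply: eq_bigr => d _ /=.
rewrite mxtrE mulrC exchange_big mxmulE mulr_sumr.
under [RHS]eq_bigr do rewrite (ricE gT' gU' _ _ (AB Ax)) mulr_sumr mulr_sumr.
rewrite [RHS]exchange_big; apply: eq_bigr => b _ /=.
rewrite -mulr_sumr.
(* Summing over [l] contracts [J] with its inverse and leaves a trace in the target chart. *)
have -> : \sum_l J x l b * (J x *m curvature g' b d (t x) *m invmx (J x)) i l =
    (J x *m curvature g' b d (t x)) i b.
  rewrite -[in RHS](mulmxKV uJ (J x *m curvature g' b d (t x))) [RHS]mxmulE.
  by apply: eq_bigr => l _; rewrite mulrC.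
by rewrite mxmulE mulr_sumr.
Qed.

(** By the chain rule the differential of [v] is the Jacobian times the differential of [u] along
    [t], a pulled back covector to which [covD_dmap] applies. *)
Lemma hess_change u v x : smooth B u -> (forall y, A y -> v y = u (t y)) -> A x
  ->
  hess g v x = J x *m hess g' u (t x) *m (J x)^T.
Proof.
move=> su vu Ax; rewrite (eq_hess g vu Ax); apply/matrixP => i j; rewrite hessE.
pose w y := (dfun u y)^T.
have sw : smooth_mx B w by apply: smooth_tr; exact: smooth_dfun.
have swt : smooth_mx A (fun y => w (t y)) by exact: (smooth_mx_comp AB st sw).
rewrite (@eq_covD _ _ g A _ _ _ (fun y => J y *m w (t y))) => [|y Ay|//];
  last first.
  by rewrite (dfun_comp AB st su Ay) trmx_mul trmxK.
rewrite (covD_dmap _ swt Ax) (pdm_comp j AB st sw Ax) mulmx_suml -sumrB.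
rewrite mulmx_sumr summxE mxmulE; apply: eq_bigr => d _.
rewrite -scalemxAl -scalerBr -scalemxAr mxE mxtrE mulrC; congr (_ * _).
by rewrite !mxmulE; apply: eq_bigr => a _; rewrite hessE.
Qed.

Lemma invmx_change x : A x ->
  invmx (g' (t x)) = (J x)^T *m invmx (g x) *m J x.
Proof.
move=> Ax; have uJ := dmap_unit Ax; have uJT : (J x)^T \in unitmx.
  by rewrite unitmx_tr.
have uG := gU' (AB Ax).
have E : g x *m (invmx (J x)^T *m invmx (g' (t x)) *m invmx (J x)) = 1%:M.
  by rewrite gt// !mulmxA (mulmxK uJT) (mulmxK uG) mulmxV.
have -> : invmx (g x) = invmx (J x)^T *m invmx (g' (t x)) *m invmx (J x).
  by rewrite -[RHS](mulKmx (gU Ax)) E mulmx1.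
by rewrite !mulmxA (mulmxV uJT) mul1mx (mulmxKV uJ).
Qed.

Lemma gtrace_change T T' x : A x -> T x = J x *m T' (t x) *m (J x)^T ->
  gtrace g T x = gtrace g' T' (t x).
Proof.
move=> Ax TE; rewrite /gtrace invmx_change// TE !mulmxA mxtrace_mulC !mulmxA.
by rewrite mxtrace_mulC !mulmxA.
Qed.

Lemma norm_grad2_change u v x :
  smooth B u -> (forall y, A y -> v y = u (t y)) -> A x ->
  norm_grad2 g v x = norm_grad2 g' u (t x).
Proof.
move=> su vu Ax; rewrite /norm_grad2 /grad (eq_dfun vu Ax).
by rewrite (dfun_comp AB st su Ax) invmx_change// trmx_mul trmxK !mulmxA.
Qed.

Lemma lapf_change u v x :
  smooth B u -> (forall y, A y -> v y = u (t y)) -> A x ->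
  lapf g v x = lapf g' u (t x).
Proof.
move=> su vu Ax.
have L : lap g v x = lap g' u (t x) := gtrace_change Ax (hess_change su vu Ax).
by rewrite /lapf L (norm_grad2_change su vu Ax).
Qed.

End ChangeOfChart.

(** * Orthonormal frames *)

Section OrthonormalFrames.
Context {R : realType}.
Implicit Types m : nat.

Definition posdef m (G : 'M[R]_m) : Prop :=
  forall v : 'rV[R]_m, v != 0 -> 0 < (v *m G *m v^T) 0 0.

(** Gram-Schmidt in block form, by induction on the dimension: split off the first basis vector and
    continue with the Schur complement. *)
Lemma exists_orthonormal_frame m (G : 'M[R]_m) : G^T = G -> posdef G ->
  exists E, orthonormal_frame G E.
Proof.
rewrite /orthonormal_frame.
elim: m G => [|m IHm] G GT Gpos; first by exists 0; apply/matrixP => -[].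
rewrite -[m.+1]/(1 + m)%N in G GT Gpos *.
pose a := ulsubmx G 0 0; pose b := ursubmx G; pose D := drsubmx G.
have GE : G = block_mx a%:M b b^T D.
  rewrite -[LHS]submxK [ulsubmx G]mx11_scalar; congr block_mx.
  by rewrite /b trmx_ursub GT.
have DT : D^T = D by rewrite /D trmx_drsub GT.
have a0 : 0 < a.
  have := Gpos (row_mx 1%:M 0); rewrite GE tr_row_mx mul_row_block mul_row_col.
  rewrite !mul1mx !mul0mx !addr0 trmx1 mulmx1 trmx0 mulmx0 addr0 mxE.
  rewrite eqxx mulr1n; apply; apply/eqP => /matrixP /(_ 0 (lshift m 0)).
  by rewrite row_mxEl !mxE eqxx => /eqP; rewrite oner_eq0.
have an0 : a != 0 by rewrite gt_eqF.
pose c := a^-1 *: b; pose S := D - b^T *m c.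
have ac : a *: c = b by rewrite /c scalerA mulfV// scale1r.
have acT : a *: c^T = b^T by rewrite -[in RHS]ac (trmxZ a c).
have SE : S = D - c^T *m b.
  have cT : c^T = a^-1 *: b^T by rewrite /c trmxZ.
  by rewrite /S cT /c -scalemxAl -scalemxAr.
have ST : S^T = S.
  by rewrite /S trmxB trmx_mul trmxK DT -/S SE.
have Spos : posdef S.
  (* Removing from [v] its projection to the first basis vector gives a vector whose square norm for
     [G] is the value of [S] on [v]. *)
  move=> v v0; have := Gpos (row_mx (- (v *m c^T)) v).
  rewrite GE tr_row_mx mul_row_block mul_row_col mul_mx_scalar scalerN.
  rewrite scalemxAr acT addNr mul0mx add0r.
  have -> : - (v *m c^T) *m b + v *m D = v *m S.
    by rewrite SE mulmxBr mulmxA mulNmx addrC.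
  apply; apply: contra v0 => /eqP E0; apply/eqP/rowP => i.
  by have /rowP/(_ (rshift 1 i)) := E0; rewrite row_mxEr !mxE.
have [F FSF] := IHm S ST Spos.
pose s := (Num.sqrt a)^-1.
have sas : s * a * s = 1.
  rewrite /s -{2}(sqr_sqrtr (ltW a0)) expr2 mulrA mulVf ?mul1r ?mulfV//;
    by rewrite gt_eqF// sqrtr_gt0.
(* The first basis vector is normalised, and the rows of [F] are made orthogonal to it by the same
   projection. *)
exists (block_mx s%:M 0 (- (F *m c^T)) F).
rewrite GE tr_block_mx !mulmx_block !mul0mx !addr0.
rewrite !tr_scalar_mx trmx0 !mulmx0 !addr0 -!scalar_mxM sas.
rewrite !mul_scalar_mx !mul_mx_scalar.
have -> : a *: - (F *m c^T) + F *m b^T = 0.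
  by rewrite scalerN scalemxAr acT addNr.
have -> : - (F *m c^T) *m b + F *m D = F *m S.
  by rewrite SE mulmxBr mulmxA mulNmx addrC.
rewrite scaler0 mul0mx add0r FSF scalar_mx_block; congr block_mx.
have -> : (- (F *m c^T))^T = - (c *m F^T).
  apply/matrixP => p q; rewrite mxtrE !mxoppE -[c in RHS]trmxK -trmx_mul.
  by rewrite mxtrE.
by rewrite scalerN scalemxAl -scalerA ac addNr.
Qed.

Lemma posdef_unit m (G : 'M[R]_m) : G^T = G -> posdef G -> G \in unitmx.
Proof.
move=> GT Gp; have [E EG] := exists_orthonormal_frame GT Gp.
have : E *m G *m E^T \in unitmx by rewrite EG unitmx1.
by rewrite !unitmx_mul => /andP[/andP[]].
Qed.

Section Frame.
Context {m : nat} {G E : 'M[R]_m}.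
Hypothesis EG : orthonormal_frame G E.

Lemma frame_unit : E \in unitmx.
Proof.
have : E *m G *m E^T \in unitmx by rewrite EG unitmx1.
by rewrite !unitmx_mul => /andP[/andP[]].
Qed.

(** A sum over the frame index is therefore a contraction with the inverse metric; this is how frame
    expressions return to coordinates. *)
Lemma frame_inv : E^T *m E = invmx G.
Proof.
have uG : G \in unitmx.
  have : E *m G *m E^T \in unitmx by rewrite EG unitmx1.
  by rewrite !unitmx_mul => /andP[/andP[]].
have EGE : E^T *m (E *m G) = 1%:M by apply: mulmx1C; exact: EG.
by rewrite -[LHS](mulmxK uG) -(mulmxA E^T E G) EGE mul1mx.
Qed.

End Frame.
End OrthonormalFrames.

(** * Linear algebra of tensor components in a frame *)

Section Components.
Context {R : realType} {m : nat}.
Variable E : 'M[R]_m.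

Lemma comp3D S T i j k :
  comp3 E (fun a b c => S a b c + T a b c) i j k = comp3 E S i j k + comp3 E T i
    j k.
Proof.
rewrite /comp3 -big_split; apply: eq_bigr => a _ /=.
rewrite -big_split; apply: eq_bigr => b _ /=.
by rewrite -big_split; apply: eq_bigr => c _ /=; rewrite mulrDr.
Qed.

Lemma comp3Z z T i j k :
  comp3 E (fun a b c => z * T a b c) i j k = z * comp3 E T i j k.
Proof.
rewrite /comp3 mulr_sumr; apply: eq_bigr => a _.
rewrite mulr_sumr; apply: eq_bigr => b _.
by rewrite mulr_sumr; apply: eq_bigr => c _; rewrite mulrCA.
Qed.

Lemma comp3N T i j k : comp3 E (fun a b c =>
  - T a b c) i j k = - comp3 E T i j k.
Proof.
rewrite -mulN1r -comp3Z /comp3; apply: eq_bigr => a _; apply: eq_bigr => b _.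
by apply: eq_bigr => c _; rewrite mulN1r.
Qed.

Lemma comp3B S T i j k :
  comp3 E (fun a b c => S a b c - T a b c) i j k = comp3 E S i j k - comp3 E T i
    j k.
Proof. by rewrite comp3D comp3N. Qed.

Lemma comp3_swap T i j k : comp3 E (fun a b c =>
  T a c b) i j k = comp3 E T i k j.
Proof.
rewrite /comp3; apply: eq_bigr => a _; rewrite exchange_big.
apply: eq_bigr => b _; apply: eq_bigr => c _; congr (_ * _); ring.
Qed.

Lemma comp2E T i j : comp2 E T i j = \sum_a \sum_b E i a * E j b * T a b.
Proof.
rewrite /comp2 mxE exchange_big; apply: eq_bigr => b _ /=.
rewrite !mxE mulr_suml; apply: eq_bigr => a _; ring.
Qed.

Lemma comp3_mul (T : 'M[R]_m) (w : 'rV[R]_m) i j k :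
  comp3 E (fun a b c => T a b * w 0 c) i j k = comp2 E T i j * comp1 E w k.
Proof.
rewrite comp2E /comp1 mxE mulr_suml; apply: eq_bigr => a _.
rewrite mulr_suml; apply: eq_bigr => b _; rewrite mulr_sumr.
by apply: eq_bigr => c _; rewrite !mxE; ring.
Qed.

Lemma comp3_mul_swap (T : 'M[R]_m) (w : 'rV[R]_m) i j k :
  comp3 E (fun a b c => T a c * w 0 b) i j k = comp2 E T i k * comp1 E w j.
Proof.
by rewrite -comp3_mul -(comp3_swap (fun a b c => T a b * w 0 c)).
Qed.

Lemma comp1D v w i : comp1 E (v + w) i = comp1 E v i + comp1 E w i.
Proof. by rewrite /comp1 mulmxDl mxE. Qed.

Lemma comp1Z z w i : comp1 E (z *: w) i = z * comp1 E w i.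
Proof. by rewrite /comp1 -scalemxAl mxE. Qed.

Lemma comp1N w i : comp1 E (- w) i = - comp1 E w i.
Proof. by rewrite /comp1 mulNmx mxE. Qed.

Lemma comp2D S T i j : comp2 E (S + T) i j = comp2 E S i j + comp2 E T i j.
Proof. by rewrite /comp2 mulmxDr mulmxDl mxE. Qed.

Lemma comp2Z z T i j : comp2 E (z *: T) i j = z * comp2 E T i j.
Proof. by rewrite /comp2 -scalemxAr -scalemxAl mxE. Qed.

Lemma comp4D S T i j k l :
  comp4 E (fun a b c d => S a b c d + T a b c d) i j k l =
  comp4 E S i j k l + comp4 E T i j k l.
Proof.
rewrite /comp4 -big_split; apply: eq_bigr => a _ /=.
rewrite -big_split; apply: eq_bigr => b _ /=.
rewrite -big_split; apply: eq_bigr => c _ /=.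
by rewrite -big_split; apply: eq_bigr => d _ /=; rewrite mulrDr.
Qed.

Lemma comp4Z z T i j k l :
  comp4 E (fun a b c d => z * T a b c d) i j k l = z * comp4 E T i j k l.
Proof.
rewrite /comp4 mulr_sumr; apply: eq_bigr => a _.
rewrite mulr_sumr; apply: eq_bigr => b _; rewrite mulr_sumr;
  apply: eq_bigr => c _.
by rewrite mulr_sumr; apply: eq_bigr => d _; rewrite mulrCA.
Qed.

Lemma eq_comp4 S T i j k l : (forall a b c d, S a b c d = T a b c d) ->
  comp4 E S i j k l = comp4 E T i j k l.
Proof.
move=> ST; apply: eq_bigr => a _; apply: eq_bigr => b _.
by apply: eq_bigr => c _; apply: eq_bigr => d _; rewrite ST.
Qed.

Lemma comp4_eq0 T i j k l : (forall a b c d, T a b c d = 0) ->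
  comp4 E T i j k l = 0.
Proof.
move=> T0; rewrite (eq_comp4 (T := fun a b c d => 0 * T a b c d)).
  by rewrite comp4Z mul0r.
by move=> *; rewrite T0 mulr0.
Qed.

Lemma comp4_12 T i j k l :
  comp4 E (fun a b c d => T b a c d) i j k l = comp4 E T j i k l.
Proof.
rewrite /comp4 exchange_big; apply: eq_bigr => a _; apply: eq_bigr => b _.
by apply: eq_bigr => c _; apply: eq_bigr => d _; rewrite [E i b * _]mulrC.
Qed.

Lemma comp4_23 T i j k l :
  comp4 E (fun a b c d => T a c b d) i j k l = comp4 E T i k j l.
Proof.
rewrite /comp4; apply: eq_bigr => a _; rewrite exchange_big;
  apply: eq_bigr => b _.
by apply: eq_bigr => c _; apply: eq_bigr => d _; rewrite [E i a * _ * _]mulrAC.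
Qed.

Lemma comp4_34 T i j k l :
  comp4 E (fun a b c d => T a b d c) i j k l = comp4 E T i j l k.
Proof.
rewrite /comp4; apply: eq_bigr => a _; apply: eq_bigr => b _;
  rewrite exchange_big.
by apply: eq_bigr => c _; apply: eq_bigr => d _; rewrite [_ * E k d * _]mulrAC.
Qed.

Lemma comp4_mul (S T : 'M[R]_m) i j k l :
  comp4 E (fun a b c d => S a b * T c d) i j k l = comp2 E S i j * comp2 E T k
    l.
Proof.
rewrite !comp2E mulr_suml; apply: eq_bigr => a _; rewrite mulr_suml.
apply: eq_bigr => b _; rewrite mulr_sumr; apply: eq_bigr => c _;
  rewrite mulr_sumr.
by apply: eq_bigr => d _; ring.
Qed.

Lemma comp4_mul13 (S T : 'M[R]_m) i j k l :
  comp4 E (fun a b c d => S a c * T b d) i j k l = comp2 E S i k * comp2 E T j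
    l.
Proof. by rewrite -comp4_mul -(comp4_23 (fun a b c d => S a b * T c d)). Qed.

Lemma comp4_mul14 (S T : 'M[R]_m) i j k l :
  comp4 E (fun a b c d => S a d * T b c) i j k l = comp2 E S i l * comp2 E T j
    k.
Proof. by rewrite -comp4_mul13 -(comp4_34 (fun a b c d => S a c * T b d)). Qed.

Hypothesis uE : E \in unitmx.

Lemma frame_sum_eq0 (y : 'I_m -> R) : (forall i, \sum_a E i a * y a = 0) ->
  forall a, y a = 0.
Proof.
move=> Ey a; have : E *m (\col_b y b) = 0.
  apply/matrixP => i o; rewrite mxE [RHS]mxE -[RHS](Ey i).
  by apply: eq_bigr => b _; rewrite mxE.
move=> /(congr1 (mulmx (invmx E))); rewrite mulKmx// mulmx0.
by move=> /matrixP/(_ a 0); rewrite !mxE.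
Qed.

Lemma comp1_eq0 w : (forall i, comp1 E w i = 0) -> w = 0.
Proof.
move=> w0; apply/rowP => a; rewrite [RHS]mxE; move: a;
  apply: frame_sum_eq0 => i.
by rewrite -[RHS](w0 i) /comp1 mxE; apply: eq_bigr => a _; rewrite mxE mulrC.
Qed.

Lemma comp3_eq0 T : (forall i j k, comp3 E T i j k = 0) ->
  forall a b c, T a b c = 0.
Proof.
move=> T0 a b; apply: frame_sum_eq0 => k; move: b; apply: frame_sum_eq0 => j.
move: a; apply: frame_sum_eq0 => i; rewrite -[RHS](T0 i j k).
apply: eq_bigr => a _; rewrite mulr_sumr; apply: eq_bigr => b _.
by rewrite !mulr_sumr; apply: eq_bigr => c _; ring.
Qed.

End Components.

(** The right-hand side has the shape of the first equation of the system: third-order terms,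
    Hessian times df, and pure trace terms. *)
Lemma comp3_codazzi (R : realType) (m : nat) (E : 'M[R]_m)
    (K L : 'I_m -> 'I_m -> 'I_m -> R) (H G : 'M[R]_m) (d k : 'rV[R]_m) i j l :
  comp3 E (fun a b c => K a b c + (L a b c - L a c b)
    - (H a c * d 0 b - H a b * d 0 c) + (G a b * k 0 c - G a c * k 0 b)) i j l =
  comp3 E K i j l + (comp3 E L i j l - comp3 E L i l j)
    - (comp2 E H i l * comp1 E d j - comp2 E H i j * comp1 E d l)
    + (comp2 E G i j * comp1 E k l - comp2 E G i l * comp1 E k j).
Proof.
rewrite -(comp3_mul E H d i j l) -(comp3_mul_swap E H d i j l).
rewrite -(comp3_mul E G k i j l) -(comp3_mul_swap E G k i j l).
by rewrite -(comp3_swap E L i j l) -!comp3B -comp3D -comp3B -comp3D.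
Qed.

(** * Algebraic curvature tensors and the Weyl operator *)

Section AlgebraicCurvature.
Context {R : realType} {m : nat}.
Variable r : 'I_m -> 'I_m -> 'I_m -> 'I_m -> R.
Hypotheses (r12 : forall i j k l, r j i k l = - r i j k l)
  (r34 : forall i j k l, r i j l k = - r i j k l)
  (rB : forall i j k l, r i j k l + r i k l j + r i l j k = 0).

Let rho (i j : 'I_m) := \sum_k r k i k j.

Lemma pair_sym i j k l : r i j k l = r k l i j.
Proof.
have := rB i j k l; have := rB j k l i; have := rB k l i j; have := rB l i j k.
have := r12 i j k l; have := r12 i k j l; have := r34 i k l j.
have := r12 i l j k; have := r12 j k l i; have := r12 j l k i.
have := r34 j l i k; have := r12 k l i j; lra.
Qed.


Lemma rho_sym i j : rho i j = rho j i.
Proof.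
apply: eq_bigr => k _; have := rB k i k j.
by rewrite (r34 k j k i); have := r12 k k j i; lra.
Qed.

Definition cyclic (w : 'I_m -> 'I_m -> 'I_m -> 'I_m -> R) (z : 'I_m -> 'I_m ->
  R) :=
  forall i j k l, \sum_p z p j * w p i k l + \sum_p z p k * w p i l j
    + \sum_p z p l * w p i j k = 0.

Variable z : 'I_m -> 'I_m -> R.
Hypothesis zS : forall i j, z i j = z j i.

(** By the first Bianchi identity the Kronecker delta satisfies the cyclic identity, so a multiple
    of the metric can be removed from a Codazzi tensor. *)
Lemma cyclic_shift c :
  cyclic r (fun i j => z i j + c * (i == j)%:R) -> cyclic r z.
Proof.
move=> H i j k l; have := H i j k l.
have E a b d : \sum_p (z p a + c * (p == a)%:R) * r p i b d =
    \sum_p z p a * r p i b d - c * r i a b d.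
  under eq_bigr do rewrite mulrDl; rewrite big_split /=; congr (_ + _).
  rewrite (bigD1 a)//= eqxx big1 => [|p /negPf ->]; last by rewrite mulr0 mul0r.
  by rewrite addr0 mulr1 (r12 i a); ring.
rewrite !E => H'; have := rB i j k l => H''.
have : c * (r i j k l + r i k l j + r i l j k) = 0 by rewrite H'' mulr0.
rewrite !mulrDr => H3; lra.
Qed.

(** Contract [i] with [k]. The middle sum pairs the symmetric [z] with [r], skew in its first two
    indices, and vanishes; the other two sums produce the Ricci tensor. *)
Lemma cyclic_comm : cyclic r z -> forall j l,
  \sum_p z p l * rho p j = \sum_p z p j * rho p l.
Proof.
move=> H j l.
have S0 : \sum_(k < m) \sum_p z p k * r p k l j = 0.
  have E : \sum_(k < m) \sum_p z p k * r p k l j =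
      - \sum_(k < m) \sum_p z p k * r p k l j.
    rewrite [LHS]exchange_big -sumrN; apply: eq_bigr => k _.
    rewrite -sumrN; apply: eq_bigr => p _; rewrite zS r12; ring.
  by lra.
have : \sum_k (\sum_p z p j * r p k k l + \sum_p z p k * r p k l j
    + \sum_p z p l * r p k j k) = 0 by rewrite big1.
rewrite !big_split /= S0 addr0 => H'.
have E1 : \sum_k \sum_p z p j * r p k k l = - \sum_p z p j * rho p l.
  rewrite exchange_big -sumrN; apply: eq_bigr => p _ /=.
  rewrite /rho mulr_sumr -sumrN; apply: eq_bigr => k _.
  by rewrite (r12 k p); ring.
have E2 : \sum_k \sum_p z p l * r p k j k = \sum_p z p l * rho p j.
  rewrite exchange_big; apply: eq_bigr => p _ /=.
  rewrite /rho mulr_sumr; apply: eq_bigr => k _.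
  by rewrite (r12 k p) (r34 k p k j); ring.
by move: H'; rewrite E1 E2; lra.
Qed.

Variables (c1 c2 : R) (w : 'I_m -> 'I_m -> 'I_m -> 'I_m -> R).
Let d (i j : 'I_m) : R := (i == j)%:R.
Hypothesis wE : forall i j k l, w i j k l = r i j k l
  - c1 * (rho i k * d j l - rho i l * d j k + rho j l * d i k - rho j k * d i l)
  + c2 * (d i k * d j l - d i l * d j k).

(** The cyclic sum antisymmetrises every correction term, either in [z], which is symmetric, or in
    the product of [z] and [rho], which is symmetric by [cyclic_comm]. This happens for all values
    of [c1] and [c2]. *)
Lemma weyl_cyclic : cyclic r z -> cyclic w z.
Proof.
move=> H i j k l.
have dS a b : d a b = d b a by rewrite /d eq_sym.
have zd a b : \sum_p z p a * d p b = z b a.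
  rewrite (bigD1 b)//= /d eqxx mulr1 big1 ?addr0// => p /negPf ->.
  by rewrite mulr0.
pose zr a b := \sum_p z p a * rho p b.
have E a b e : \sum_p z p a * w p i b e = \sum_p z p a * r p i b e
   - c1 * (zr a b * d i e - zr a e * d i b + rho i e * z b a - rho i b * z e a)
   + c2 * (z b a * d i e - z e a * d i b).
  rewrite (eq_bigr (fun p => z p a * r p i b e + (- c1 * d i e) * (z p a * rho p
    b)
      + (c1 * d i b) * (z p a * rho p e)
      + (c2 * d i e - c1 * rho i e) * (z p a * d p b)
      + (c1 * rho i b - c2 * d i b) * (z p a * d p e))); last first.
    by move=> p _; rewrite wE; ring.
  by rewrite !big_split -!mulr_sumr /= !zd /zr; ring.
have zrS a b : zr a b = zr b a by exact: cyclic_comm.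
rewrite !E; have := H i j k l.
rewrite (zrS l j) (zrS k j) (zrS l k) (zS l j) (zS k j) (zS l k).
by move=> H'; rewrite -[RHS]H'; ring.
Qed.


(** Moves the slot contracted by [WstarS], the third, to the first, which is the one contracted in
    [cyclic]. *)
Lemma weyl_pair_sym i j k l : w i j k l = w k l i j.
Proof.
rewrite !wE (pair_sym i j k l) (rho_sym k i) (rho_sym k j) (rho_sym l i).
have dS a b : d a b = d b a by rewrite /d eq_sym.
by rewrite (rho_sym l j) (dS l j) (dS l i) (dS k j) (dS k i); ring.
Qed.

End AlgebraicCurvature.

(** * The volume form and the Weyl operator *)

Section VolumeForm.
Context {R : realType} {m : nat}.
Variables (v : R) (E : 'M[R]_m.+3) (I : seq 'I_m.+3).
Hypothesis sI : size I = m.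

Lemma det_row_swap (h : 'I_m.+3 -> 'I_m.+3) (a b : 'I_m.+3) : a != b ->
  \det (\matrix_(x < m.+3) row (h (tperm a b x)) E) =
  - \det (\matrix_(x < m.+3) row (h x) E).
Proof.
move=> ab; have -> : \matrix_(x < m.+3) row (h (tperm a b x)) E =
    row_perm (tperm a b) (\matrix_(x < m.+3) row (h x) E).
  by apply/matrixP => x y; rewrite !mxE.
by rewrite row_permE det_mulmx det_perm odd_tperm ab expr1 mulN1r.
Qed.

(* The two index lists differ by a cyclic permutation of three entries. *)
Lemma topform_cyclic l q r :
  topform_comp v E q ((l :: I) ++ [:: q; r]) =
  topform_comp v E r ((q :: I) ++ [:: r; l]).
Proof.
(* As [I] has length [m], the entries [l], [q] and [r] stand at the positions 0, [m.+1] and [m.+2].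
   Two transpositions of these positions realise the cycle, and their signs cancel. *)
pose i0 : 'I_m.+3 := ord0; pose i2 : 'I_m.+3 := ord_max.
have lt1 : (m.+1 < m.+3)%N by rewrite ltnS.
pose i1 := Ordinal lt1.
have n01 : i0 != i1 by [].
have n12 : i1 != i2 by rewrite -val_eqE /= ltn_eqF.
pose h (x : 'I_m.+3) := nth q ((l :: I) ++ [:: q; r]) x.
rewrite /topform_comp; congr (_ * _); symmetry.
transitivity (\det (\matrix_(x < m.+3) row (h (tperm i0 i1 (tperm i1 i2 x)))
  E)).
  congr (\det _); apply/matrixP => x y; rewrite !mxE; congr (E _ _).
  rewrite /h /=.
  have nI d e s k : (k < m)%N -> nth d (I ++ s) k = nth e I k.
    by move=> km; rewrite nth_cat sI km; apply: set_nth_default; rewrite sI.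
  have n02 : i0 != i2 by [].
  have T0 : tperm i0 i1 (tperm i1 i2 i0) = i1.
    by rewrite [tperm i1 i2 i0]tpermD ?tpermL// eq_sym.
  have T1 : tperm i0 i1 (tperm i1 i2 i1) = i2 by rewrite tpermL tpermD.
  have T2 : tperm i0 i1 (tperm i1 i2 i2) = i0 by rewrite !tpermR.
  have [->|x0] := eqVneq x i0.
    by rewrite T0 /= nth_cat sI ltnn subnn.
  have [->|x1] := eqVneq x i1.
    rewrite T1 /= !nth_cat sI ltnn subnn ltnNge leqnSn /=.
    by rewrite subSnn.
  have [->|x2] := eqVneq x i2.
    by rewrite T2 /= nth_cat sI ltnNge leqnSn /= subSnn.
  have -> : tperm i0 i1 (tperm i1 i2 x) = x.
    by rewrite [tperm i1 i2 x]tpermD 1?eq_sym// tpermD 1?eq_sym.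
  have {}x0 : (x : nat) != 0 by apply: contra x0 => /eqP e; apply/eqP/val_inj.
  have {}x1 : (x : nat) != m.+1 by apply: contra x1 => /eqP e;
    apply/eqP/val_inj.
  have {}x2 : (x : nat) != m.+2 by apply: contra x2 => /eqP e;
    apply/eqP/val_inj.
  case: x x0 x1 x2 => -[//|k] /= kn _ k1 k2.
  have km : (k < m)%N.
    move: kn k1 k2; rewrite !eqSS 2!ltnS leq_eqVlt => /orP[-> //|].
    by rewrite ltnS leq_eqVlt => /orP[->|].
  by rewrite (nI _ r _ _ km) (nI _ r _ _ km).
rewrite (det_row_swap (fun x => h (tperm i0 i1 x)) n12).
by rewrite (det_row_swap h n01) opprK.
Qed.

(* [3 WstarS] is the volume form contracted with the cyclic sums, since the
   volume form is invariant under cyclic permutations of three indices. *)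
Lemma WstarS_eq0 W P j :
  (forall l q r,
    \sum_k comp2 E P l k * comp4 E W q r k j
    + \sum_k comp2 E P q k * comp4 E W r l k j
    + \sum_k comp2 E P r k * comp4 E W l q k j = 0) ->
  WstarS v W E P I j = 0.
Proof.
move=> cyc; pose X l q r := \sum_k comp2 E P l k * comp4 E W q r k j.
pose eps l q r := topform_comp v E q ((l :: I) ++ [:: q; r]).
have E1 : WstarS v W E P I j = \sum_l \sum_q \sum_r eps l q r * X l q r.
  rewrite /WstarS; apply: eq_bigr => l _; rewrite /Wstar.
  under eq_bigr do rewrite mulr_suml.
  rewrite exchange_big; apply: eq_bigr => q _ /=.
  under eq_bigr do rewrite mulr_suml.
  rewrite exchange_big; apply: eq_bigr => r _ /=.
  by rewrite /X mulr_sumr; apply: eq_bigr => k _; rewrite /eps; ring.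
have rot (F : 'I_m.+3 -> 'I_m.+3 -> 'I_m.+3 -> R) :
    \sum_l \sum_q \sum_r F l q r = \sum_l \sum_q \sum_r F q r l.
  by rewrite [RHS]exchange_big; apply: eq_bigr => q _;
    rewrite [RHS]exchange_big.
have E2 : WstarS v W E P I j = \sum_l \sum_q \sum_r eps l q r * X q r l.
  rewrite E1 rot; apply: eq_bigr => l _; apply: eq_bigr => q _.
  by apply: eq_bigr => r _; rewrite /eps (topform_cyclic l q r).
have E3 : WstarS v W E P I j = \sum_l \sum_q \sum_r eps l q r * X r l q.
  rewrite E2 rot; apply: eq_bigr => l _; apply: eq_bigr => q _.
  by apply: eq_bigr => r _; rewrite /eps (topform_cyclic l q r).
have : WstarS v W E P I j + WstarS v W E P I j + WstarS v W E P I j = 0.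
  rewrite {1}E1 {1}E2 E3 -!big_split big1// => l _ /=; rewrite -!big_split.
  rewrite big1// => q _ /=; rewrite -!big_split big1// => r _ /=.
  by rewrite -!mulrDr cyc mulr0.
lra.
Qed.


End VolumeForm.

(** * Codazzi tensors *)

Section FrameCurvature.
Context {R : realType} {m : nat}.
Variables (A : opens R m) (g : 'rV[R]_m -> 'M[R]_m) (x : 'rV[R]_m) (E :
  'M[R]_m).
Hypotheses (gS : smooth_mx A g) (gT : forall y, A y -> (g y)^T = g y)
  (gU : forall y, A y -> g y \in unitmx) (Ax : A x)
  (EG : orthonormal_frame (g x) E).

Let r := comp4 E (riem g x).

Lemma comp4_rot T i j k l :
  comp4 E T i k l j = comp4 E (fun a b c d => T a c d b) i j k l.
Proof.
by rewrite (comp4_23 E (fun a b c d => T a b d c)) (comp4_34 E T).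
Qed.

Lemma comp4_rot2 T i j k l :
  comp4 E T i l j k = comp4 E (fun a b c d => T a d b c) i j k l.
Proof.
by rewrite (comp4_34 E (fun a b c d => T a c b d)) (comp4_23 E T).
Qed.

Lemma comp4N T i j k l :
  comp4 E (fun a b c d => - T a b c d) i j k l = - comp4 E T i j k l.
Proof.
rewrite -mulN1r -comp4Z; apply: eq_comp4 => *; by rewrite mulN1r.
Qed.

Lemma riem_frame12 i j k l : r j i k l = - r i j k l.
Proof.
rewrite /r -comp4N -(comp4_12 E (riem g x)); apply: eq_comp4 => a b c d.
rewrite !(riemE gT)//; have /matrixP/(_ a b) := curvature_skew gS gT gU c d Ax.
by rewrite mxaddE mxtrE [RHS]mxE => /eqP; rewrite addr_eq0 => /eqP.
Qed.

Lemma riem_frame34 i j k l : r i j l k = - r i j k l.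
Proof.
rewrite /r -comp4N -(comp4_34 E (riem g x)); apply: eq_comp4 => a b c d.
by rewrite !(riemE gT)// curvatureN mulNmx mxoppE.
Qed.

Lemma riem_frameB i j k l : r i j k l + r i k l j + r i l j k = 0.
Proof.
rewrite /r (comp4_rot _ i j k l) (comp4_rot2 _ i j k l) -!comp4D;
  apply: comp4_eq0 => a b c d.
rewrite !(riemE gT)//; have := bianchi gT b c d Ax.
move=> /(congr1 (fun M => M *m g x)); rewrite !mulmxDl mul0mx.
move=> /matrixP/(_ 0 a); rewrite !mxaddE [RHS]mxE => <-.
by rewrite -!row_mul ![row _ _ 0 a]mxE.
Qed.

Lemma frame_sum_inv (V : 'M[R]_m) :
  \sum_k \sum_a \sum_c E k a * E k c * V a c = \sum_a \sum_c invmx (g x) a c * V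
    a c.
Proof.
rewrite exchange_big; apply: eq_bigr => a _ /=; rewrite exchange_big.
apply: eq_bigr => c _ /=; rewrite -(frame_inv EG) mxmulE mulr_suml.
by apply: eq_bigr => k _; rewrite mxtrE.
Qed.

Lemma ric_frame i j : \sum_k r k i k j = comp2 E (ric g x) i j.
Proof.
rewrite comp2E /r /comp4.
have -> : \sum_k \sum_a \sum_b \sum_c \sum_d
      E k a * E i b * E k c * E j d * riem g x a b c d =
    \sum_b \sum_d E i b * E j d *
      \sum_k \sum_a \sum_c E k a * E k c * (\matrix_(a, c) riem g x a b c d) a
        c.
  under [RHS]eq_bigr => b _ do under eq_bigr do rewrite mulr_sumr.
  under [RHS]eq_bigr => b _ do rewrite exchange_big.
  rewrite [RHS]exchange_big; apply: eq_bigr => k _ /=.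
  under [RHS]eq_bigr => b _ do under eq_bigr do rewrite mulr_sumr.
  under [RHS]eq_bigr => b _ do rewrite exchange_big.
  rewrite [RHS]exchange_big; apply: eq_bigr => a _ /=.
  apply: eq_bigr => b _; rewrite exchange_big; apply: eq_bigr => d _ /=.
  by rewrite mulr_sumr; apply: eq_bigr => c _; rewrite mxE; ring.
apply: eq_bigr => b _; apply: eq_bigr => d _; congr (_ * _).
rewrite frame_sum_inv [RHS]mxE.
by apply: eq_bigr => a _; apply: eq_bigr => c _; rewrite mxE.
Qed.

Lemma metric_frame i j : comp2 E (g x) i j = (i == j)%:R.
Proof. by rewrite /comp2 EG mxE. Qed.

Lemma weyl_frame i j k l : comp4 E (weyl g x) i j k l = r i j k l
  - (m%:R - 2)^-1 * (comp2 E (ric g x) i k * (j == l)%:R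
     - comp2 E (ric g x) i l * (j == k)%:R + comp2 E (ric g x) j l * (i == k)%:R
     - comp2 E (ric g x) j k * (i == l)%:R)
  + scal g x / ((m%:R - 1) * (m%:R - 2))
    * ((i == k)%:R * (j == l)%:R - (i == l)%:R * (j == k)%:R).
Proof.
rewrite /weyl comp4D comp4Z !comp4D !comp4N comp4Z !comp4D !comp4N.
rewrite !comp4_mul13 !comp4_mul14.
have E1 : comp4 E (fun a b c d => ric g x b d * g x a c) i j k l =
    comp2 E (ric g x) j l * (i == k)%:R.
  rewrite mulrC -metric_frame -comp4_mul13; apply: eq_comp4 => *; exact: mulrC.
have E2 : comp4 E (fun a b c d => ric g x b c * g x a d) i j k l =
    comp2 E (ric g x) j k * (i == l)%:R.
  rewrite mulrC -metric_frame -comp4_mul14; apply: eq_comp4 => *; exact: mulrC.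
by rewrite E1 E2 !metric_frame.
Qed.

(** The sum over the frame raises the first index of the curvature, so the contraction becomes a
    matrix product in coordinates, the form in which [codazzi_curvature] is stated. *)
Lemma curvature_contract (T : 'M[R]_m) i j k l :
  \sum_p comp2 E T p j * r p i k l =
  comp4 E (fun b c d e => (curvature g c d x *m T) b e) i k l j.
Proof.
have L p : r p i k l = \sum_a E p a * \sum_b \sum_c \sum_d
    E i b * E k c * E l d * riem g x a b c d.
  apply: eq_bigr => a _; rewrite mulr_sumr; apply: eq_bigr => b _.
  rewrite mulr_sumr; apply: eq_bigr => c _; rewrite mulr_sumr.
  by apply: eq_bigr => d _; ring.
under eq_bigr do rewrite L mulr_sumr.
rewrite exchange_big /=.
transitivity (\sum_a (invmx (g x) *m T *m E^T) a j * \sum_b \sum_c \sum_d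
    E i b * E k c * E l d * riem g x a b c d).
  apply: eq_bigr => a _; rewrite -(frame_inv EG) -!mulmxA mxmulE mulr_suml.
  by apply: eq_bigr => p _; rewrite mxtrE /comp2 -mulmxA; ring.
under eq_bigr do rewrite mulr_sumr; rewrite exchange_big;
  apply: eq_bigr => b _ /=.
under eq_bigr do rewrite mulr_sumr; rewrite exchange_big;
  apply: eq_bigr => c _ /=.
under eq_bigr do rewrite mulr_sumr; rewrite exchange_big;
  apply: eq_bigr => d _ /=.
have -> : \sum_e E i b * E k c * E l d * E j e * (curvature g c d x *m T) b e =
    E i b * E k c * E l d * (curvature g c d x *m T *m E^T) b j.
  rewrite [in RHS]mxmulE mulr_sumr; apply: eq_bigr => e _.
  by rewrite mxtrE; ring.
have -> : curvature g c d x *m T *m E^T =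
    (curvature g c d x *m g x) *m (invmx (g x) *m T *m E^T).
  by rewrite !mulmxA mulmxK// gU.
rewrite [in RHS]mxmulE mulr_sumr; apply: eq_bigr => a _.
by rewrite (riemE gT)//; ring.
Qed.

Lemma codazzi_cyclic T : smooth_mx A T ->
  (forall y, A y -> forall i j k, cov2 g T y i j k = cov2 g T y i k j) ->
  cyclic r (comp2 E (T x)).
Proof.
move=> sT cT i j k l; rewrite !curvature_contract (comp4_rot _ i j k l)
  (comp4_rot2 _ i j k l) -!comp4D.
apply: comp4_eq0 => a b c d.
have C (K : 'M[R]_m) e : (K *m col e (T x)) a 0 = (K *m T x) a e.
  by rewrite !mxmulE; apply: eq_bigr => p _; rewrite mxE.
have := codazzi_curvature gS gT gU b c d sT cT Ax.
move=> /matrixP/(_ a 0); rewrite !mxaddE !C [RHS]mxE.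
rewrite (curvatureN _ c d) (curvatureN _ d b) (curvatureN _ b c).
by rewrite !mulNmx !mxoppE => H; lra.
Qed.

End FrameCurvature.

Section CodazziWeyl.
Context {R : realType} {m : nat}.
Variables (A : opens R m.+3) (g : 'rV[R]_m.+3 -> 'M[R]_m.+3).
Hypotheses (gS : smooth_mx A g) (gT : forall y, A y -> (g y)^T = g y)
  (gU : forall y, A y -> g y \in unitmx).

Lemma comp2_sym (E T : 'M[R]_m.+3) i j : T^T = T -> comp2 E T i j = comp2 E T j
  i.
Proof.
by move=> TT; rewrite /comp2 -[RHS]mxtrE !trmx_mul trmxK TT mulmxA.
Qed.

(** Here [c] is a number attached to the point [x]: only [T] is differentiated, so the multiple of
    the metric may vary from point to point. *)
Lemma codazzi_WstarS T c x E v I j :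
  smooth_mx A T ->
  (forall y, A y -> forall i j k, cov2 g T y i j k = cov2 g T y i k j) ->
  A x -> (T x)^T = T x -> orthonormal_frame (g x) E -> size I = m ->
  WstarS v (weyl g x) E (T x - c *: g x) I j = 0.
Proof.
move=> sT cT Ax TT EG sI; set P := T x - c *: g x.
pose z := comp2 E P; pose w := comp4 E (weyl g x).
have PT : P^T = P by rewrite /P trmxB trmxZ TT gT.
have zS a b : z a b = z b a by exact: comp2_sym.
have r12 := riem_frame12 E gS gT gU Ax.
have r34 := riem_frame34 E gT Ax.
have rB := riem_frameB E gT Ax.
have cz : cyclic (comp4 E (riem g x)) z.
  apply: (cyclic_shift r12 rB (c := c)).
  have <- : comp2 E (T x) = (fun a b => z a b + c * (a == b)%:R).
    apply/funext => a; apply/funext => b.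
    rewrite -(metric_frame EG) /z -comp2Z -comp2D; congr (comp2 _ _ _ _).
    by rewrite /P subrK.
  exact: codazzi_cyclic sT cT.
have wE i k l p : w i k l p = comp4 E (riem g x) i k l p
  - (m.+3%:R - 2)^-1 * ((\sum_q comp4 E (riem g x) q i q l) * (k == p)%:R
     - (\sum_q comp4 E (riem g x) q i q p) * (k == l)%:R
     + (\sum_q comp4 E (riem g x) q k q p) * (i == l)%:R
     - (\sum_q comp4 E (riem g x) q k q l) * (i == p)%:R)
  + scal g x / ((m.+3%:R - 1) * (m.+3%:R - 2))
    * ((i == l)%:R * (k == p)%:R - (i == p)%:R * (k == l)%:R).
  by rewrite !(ric_frame EG) /w weyl_frame.
have wC := weyl_cyclic r12 r34 zS wE cz.
have wS := weyl_pair_sym r12 r34 rB wE.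
apply: (WstarS_eq0 v sI) => l q r'; rewrite -[RHS](wC j l q r').
by congr (_ + _ + _); apply: eq_bigr => k _;
  rewrite -/(z _ _) -/(w _ _ _ _) zS wS.
Qed.

End CodazziWeyl.

(** * Covariant derivatives of 2-tensors *)

Section CovariantDerivatives.
Context {R : realType} {m : nat}.
Variables (A : opens R m) (g : 'rV[R]_m -> 'M[R]_m).
Hypotheses (gS : smooth_mx A g) (gT : forall y, A y -> (g y)^T = g y)
  (gU : forall y, A y -> g y \in unitmx).
Implicit Types (S T : 'rV[R]_m -> 'M[R]_m) (u : 'rV[R]_m -> R).

Lemma cov2D S T x i j k : smooth_mx A S -> smooth_mx A T -> A x ->
  cov2 g (fun y => S y + T y) x i j k = cov2 g S x i j k + cov2 g T x i j k.
Proof.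
move=> sS sT Ax; rewrite !cov2E (pdmD k sS sT Ax) mulmxDl mulmxDr.
by rewrite !(mxaddE, mxoppE); ring.
Qed.

Lemma cov2B S T x i j k : smooth_mx A S -> smooth_mx A T -> A x ->
  cov2 g (fun y => S y - T y) x i j k = cov2 g S x i j k - cov2 g T x i j k.
Proof.
move=> sS sT Ax; rewrite !cov2E (pdmB k sS sT Ax) mulmxBl mulmxBr.
by rewrite !(mxaddE, mxoppE); ring.
Qed.

Lemma cov2_metric u x i j k : smooth A u -> A x ->
  cov2 g (fun y => u y *: g y) x i j k = g x i j * dfun u x 0 k.
Proof.
move=> su Ax; rewrite cov2E (pdmZ k su gS Ax) (metric_compat gT gU k Ax).
rewrite scalerDr -scalemxAr -scalemxAl -addrA -opprD addrK.
by rewrite !mxE mulrC.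
Qed.

Lemma cov2_outer u x i j k : smooth A u -> A x ->
  cov2 g (fun y => (dfun u y)^T *m dfun u y) x i j k =
  hess g u x i k * dfun u x 0 j + hess g u x j k * dfun u x 0 i.
Proof.
move=> su Ax; have sd := smooth_dfun su; have sdT := smooth_tr sd.
rewrite cov2E (pdmM k sdT sd Ax) !hessE /covD pdm_tr.
set d := dfun u x; set d' := pdm k (dfun u) x; set K := connection g k x.
have -> : (d'^T *m d + d^T *m d' - K *m (d^T *m d) - d^T *m d *m K^T) i j =
    ((d'^T - K *m d^T) *m d) i j + ((d'^T - K *m d^T) *m d) j i.
  have -> : ((d'^T - K *m d^T) *m d) j i = (d^T *m (d' - d *m K^T)) i j.
    by rewrite -[LHS]mxtrE trmx_mul trmxB trmx_mul !trmxK.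
  rewrite mulmxBl mulmxBr !mulmxA.
  by rewrite !(mxaddE, mxoppE); ring.
by rewrite !mxmulE !big_ord1.
Qed.

Lemma eq_cov2 S T x i j k : (forall y, A y -> S y = T y) -> A x ->
  cov2 g S x i j k = cov2 g T x i j k.
Proof. by move=> ST Ax; rewrite !cov2E (eq_pdm k ST Ax) ST. Qed.

Lemma pdm_invmetric k x : A x -> pdm k (fun y => invmx (g y)) x =
  - (invmx (g x) *m connection g k x + (connection g k x)^T *m invmx (g x)).
Proof.
move=> Ax; have uG := gU Ax.
have : pdm k (fun y => g y *m invmx (g y)) x = 0.
  by rewrite (eq_pdm k (fun y Ay => mulmxV (gU Ay)) Ax) pdm_cst.
rewrite (pdmM k gS (smooth_invmetric gS gU) Ax) (metric_compat gT gU k Ax).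
move=> /(congr1 (mulmx (invmx (g x)))); rewrite mulmxDr mulmx0 mulKmx//.
rewrite addrC => /eqP; rewrite addr_eq0 => /eqP ->; congr (- _).
by rewrite mulmxDl mulmxDr mulmxK// !mulmxA (mulVmx uG) mul1mx.
Qed.

(** The derivative of the inverse metric supplies the connection terms that complete the derivatives
    of [dfun u] to the Hessian. *)
Lemma pd_norm_grad2 u x k : smooth A u -> A x ->
  pd k (norm_grad2 g u) x = 2 * (grad g u x *m hess g u x) 0 k.
Proof.
move=> su Ax; have sd := smooth_dfun su; have sdT := smooth_tr sd.
have sI := smooth_invmetric gS gU.
rewrite -(pdmE k (fun y => grad g u y *m (dfun u y)^T) x 0 0) /grad.
rewrite (pdmM k (smooth_mxM sd sI) sdT Ax) (pdmM k sd sI Ax) (pdm_invmetric k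
  Ax).
rewrite pdm_tr; set d := dfun u x; set d' := pdm k (dfun u) x.
set K := connection g k x; set I := invmx (g x).
have IT : I^T = I by exact: (invmx_sym gT Ax).
have -> : d *m I *m hess g u x = \row_j (d *m I *m covD g j (fun y =>
  (dfun u y)^T) x) 0 0.
  apply/rowP => j; rewrite mxmulE [RHS]mxE [RHS]mxmulE.
  by apply: eq_bigr => a _; rewrite hessE.
rewrite [in RHS]mxE /covD pdm_tr -/d -/d' -/K.
have E1 : (d' *m I *m d^T) 0 0 = (d *m I *m d'^T) 0 0.
  by rewrite -[LHS]mxtrE !trmx_mul trmxK IT mulmxA.
have E2 : (d *m K^T *m I *m d^T) 0 0 = (d *m I *m K *m d^T) 0 0.
  by rewrite -[LHS]mxtrE !trmx_mul !trmxK IT !mulmxA.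
rewrite mulmxN mulmxDr mulmxDl mulNmx mulmxDl mulmxBr !mulmxA.
by rewrite !(mxaddE, mxoppE) E1 E2; ring.
Qed.

Lemma gtraceD S T x :
  gtrace g (fun y => S y + T y) x = gtrace g S x + gtrace g T x.
Proof. by rewrite /gtrace mulmxDr linearD. Qed.

Lemma gtraceB S T x :
  gtrace g (fun y => S y - T y) x = gtrace g S x - gtrace g T x.
Proof. by rewrite /gtrace mulmxBr linearB. Qed.

Lemma gtrace_metric u x : A x -> gtrace g (fun y => u y *: g y) x = u x * m%:R.
Proof.
move=> Ax; rewrite /gtrace -scalemxAr mulVmx ?gU// linearZ /=.
by rewrite mxtrace1.
Qed.

Lemma gtrace_outer u x :
  gtrace g (fun y => (dfun u y)^T *m dfun u y) x = norm_grad2 g u x.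
Proof.
rewrite /gtrace mulmxA mxtrace_mulC mulmxA /mxtrace big_ord1 /norm_grad2.
by [].
Qed.

End CovariantDerivatives.

(** * The system in a pair of charts *)

Section LocalEquations.
Context {R : realType} {m n : nat}.
Let dim : R := m.+3%:R.
Variables (A : opens R m.+3) (C : opens R n)
  (g : 'rV[R]_m.+3 -> 'M[R]_m.+3) (h : 'rV[R]_n -> 'M[R]_n) (alpha : R)
  (Phi : 'rV[R]_m.+3 -> 'rV[R]_n) (U : 'rV[R]_n -> R)
  (f mu pr : 'rV[R]_m.+3 -> R).
Hypotheses (AC : forall x, A x -> C (Phi x))
  (sPhi : forall a, smooth A (fun x => Phi x 0 a))
  (gS : smooth_mx A g) (gT : forall y, A y -> (g y)^T = g y)
  (gP : forall y, A y -> posdef (g y))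
  (hS : smooth_mx C h) (hT : forall y, C y -> (h y)^T = h y)
  (hP : forall y, C y -> posdef (h y))
  (sU : smooth C U) (sf : smooth A f) (smu : smooth A mu) (spr : smooth A pr).

Let gU y (Ay : A y) : g y \in unitmx.
Proof. exact: posdef_unit (gT Ay) (gP Ay). Qed.

Let Ric := ric_phi g h alpha Phi.
Let S := scal_phi g h alpha Phi.
Let Uphi y := U (Phi y).

Definition soliton y : 'M[R]_m.+3 :=
  Ric y + hess g f y - (dfun f y)^T *m dfun f y.

Definition soliton_trace y : R := S y + lapf g f y.

Definition potential y : R := 2^-1 * S y - Uphi y - mu y.

(** Its differential collects the pure trace terms of the first equation. The resulting coefficient
    -1/(2m) of dS is 1/(2m(m-1)), present in the equation, minus 1/(2(m-1)), which comes from
    writing the Cotton tensor through derivatives of Ric^phi. Subtracting [soliton_trace] makes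
    [potential] the trace of the tensor below. *)
Let kappa y : R := dim^-1 * (potential y - soliton_trace y).

(* The first equation of the system says that this tensor is Codazzi. *)
Definition codazzi_tensor y : 'M[R]_m.+3 := soliton y + kappa y *: g y.

Definition traceless y : 'M[R]_m.+3 :=
  soliton y - (dim^-1 * soliton_trace y) *: g y.

Let dim0 : dim != 0. Proof. by rewrite pnatr_eq0. Qed.
Let dim1 : dim - 1 != 0.
Proof. by rewrite /dim -(natrB R (isT : 1 <= m.+3)%N) pnatr_eq0. Qed.

Lemma smooth_pullback : smooth_mx A (pullback h Phi).
Proof.
have sd : smooth_mx A (dmap Phi) := smooth_dmap sPhi.
apply: smooth_mxM (smooth_tr sd); apply: smooth_mxM => //.
exact: (smooth_mx_comp AC sPhi hS).
Qed.

Lemma smooth_ric_phi : smooth_mx A Ric.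
Proof.
apply: smooth_mxB; first exact: smooth_ric.
by apply: smooth_mxZ; [exact: smooth_cst|exact: smooth_pullback].
Qed.

Lemma smooth_scal_phi : smooth A S.
Proof. exact: (smooth_gtrace gS gU smooth_ric_phi). Qed.

Lemma smooth_Uphi : smooth A Uphi.
Proof. exact: (smooth_comp AC sPhi sU). Qed.

Lemma smooth_soliton_trace : smooth A soliton_trace.
Proof. by apply: smoothD; [exact: smooth_scal_phi|exact: smooth_lapf]. Qed.

Lemma smooth_potential : smooth A potential.
Proof.
apply: smoothB => //; apply: smoothB; last exact: smooth_Uphi.
by apply: smoothM; [exact: smooth_cst|exact: smooth_scal_phi].
Qed.

Let sRH : smooth_mx A (fun y => Ric y + hess g f y).
Proof. by apply: smooth_mxD; [exact: smooth_ric_phi|exact: smooth_hess]. Qed.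

Let sdd : smooth_mx A (fun y => (dfun f y)^T *m dfun f y).
Proof.
by apply: smooth_mxM; [apply: smooth_tr|]; exact: smooth_dfun.
Qed.

Lemma smooth_soliton : smooth_mx A soliton.
Proof. exact: smooth_mxB sRH sdd. Qed.

Let skappa : smooth A kappa.
Proof.
apply: smoothM; first exact: smooth_cst.
by apply: smoothB; [exact: smooth_potential|exact: smooth_soliton_trace].
Qed.

Lemma smooth_codazzi_tensor : smooth_mx A codazzi_tensor.
Proof. exact: smooth_mxD smooth_soliton (smooth_mxZ skappa gS). Qed.

Lemma smooth_traceless : smooth_mx A traceless.
Proof.
apply: smooth_mxB smooth_soliton (smooth_mxZ _ gS).
by apply: smoothM; [exact: smooth_cst|exact: smooth_soliton_trace].
Qed.

Lemma ric_phi_sym y : A y -> (Ric y)^T = Ric y.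
Proof.
move=> Ay; have ricT : (ric g y)^T = ric g y.
  have [E EG] := exists_orthonormal_frame (gT Ay) (gP Ay).
  have uE := frame_unit EG.
  have uET : E^T \in unitmx by rewrite unitmx_tr.
  (* Symmetry is checked in an orthonormal frame, where Ric is a trace over repeated indices of an
     algebraic curvature tensor. *)
  suff H : E *m (ric g y)^T *m E^T = E *m ric g y *m E^T.
    by rewrite -[LHS](mulKmx uE) -[E *m _](mulmxK uET) H (mulmxK uET) (mulKmx
      uE).
  have cT i j : comp2 E (ric g y)^T i j = comp2 E (ric g y) j i.
    by rewrite /comp2 -[RHS]mxtrE !trmx_mul trmxK mulmxA.
  apply/matrixP => i j; rewrite -[LHS]/(comp2 E (ric g y)^T i j) cT.
  rewrite -[RHS]/(comp2 E (ric g y) i j) -!(ric_frame EG).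
  exact: (rho_sym (riem_frame12 E gS gT gU Ay) (riem_frame34 E gT Ay)
    (riem_frameB E gT Ay)).
rewrite /Ric /ric_phi trmxB ricT trmxZ /pullback !trmx_mul trmxK hT ?mulmxA//.
exact: AC.
Qed.

Lemma soliton_sym y : A y -> (soliton y)^T = soliton y.
Proof.
move=> Ay; have hs := hess_sym gT sf Ay.
by rewrite /soliton trmxB trmxD ric_phi_sym// hs trmx_mul trmxK.
Qed.

Lemma codazzi_tensor_sym y : A y -> (codazzi_tensor y)^T = codazzi_tensor y.
Proof.
by move=> Ay; rewrite /codazzi_tensor trmxD trmxZ soliton_sym// gT.
Qed.

Lemma traceless_sym y : A y -> (traceless y)^T = traceless y.
Proof. by move=> Ay; rewrite /traceless trmxB trmxZ soliton_sym// gT. Qed.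

Lemma gtrace_soliton y : gtrace g soliton y = soliton_trace y.
Proof.
rewrite gtraceB gtraceD gtrace_outer /soliton_trace -addrA.
by [].
Qed.

Lemma gtrace_traceless y : A y -> gtrace g traceless y = 0.
Proof.
move=> Ay; rewrite gtraceB gtrace_soliton (gtrace_metric gU _ Ay).
by rewrite mulrAC mulVf// mul1r subrr.
Qed.

Lemma traceless_codazzi y : traceless y =
  codazzi_tensor y - (dim^-1 * potential y) *: g y.
Proof.
rewrite /traceless /codazzi_tensor -[RHS]addrA; congr (_ + _).
by rewrite -scalerBl -scaleNr /kappa; congr (_ *: _); ring.
Qed.

Lemma dfun_kappa y : A y -> dfun kappa y =
  dim^-1 *: (- 2^-1 *: dfun S y - dfun Uphi y - dfun mu y
    - (dfun (lap g f) y - 2 *: (grad g f y *m hess g f y))).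
Proof.
move=> Ay; have sS := smooth_scal_phi.
have sL : smooth A (lap g f) := smooth_gtrace gS gU (smooth_hess gS gT gU sf).
have sN := smooth_norm_grad2 gS gU sf.
have sLf := smooth_lapf gS gT gU sf.
have s2 := smoothM (smooth_cst A (2^-1 : R)) sS.
apply/rowP => k; rewrite [LHS]mxE.
rewrite (pdZ _ k (smoothB smooth_potential smooth_soliton_trace) Ay).
rewrite (pdB k smooth_potential smooth_soliton_trace Ay).
rewrite (pdB k (smoothB s2 smooth_Uphi) smu Ay) (pdB k s2 smooth_Uphi Ay).
rewrite (pdZ _ k sS Ay) (pdD k sS sLf Ay) (pdB k sL sN Ay).
rewrite (pd_norm_grad2 gS gT gU k sf Ay) [RHS]mxE; congr (_ * _).
by rewrite !(mxaddE, mxoppE, mxscaleE, dfunE); field.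
Qed.

(** As [F] is orthonormal, the sum over [a] contracts with the inverse of [h], which cancels the
    factor [h] inside [dphi_comp]; what remains is the chain rule. *)
Lemma Uphi_frame (E : 'M[R]_m.+3) (F : 'M[R]_n) y i : A y ->
  orthonormal_frame (h (Phi y)) F ->
  \sum_a comp1 F (dfun U (Phi y)) a * dphi_comp h Phi E F y a i =
  comp1 E (dfun Uphi y) i.
Proof.
move=> Ay HF; have Cy := AC Ay.
have uH : h (Phi y) \in unitmx by exact: posdef_unit (hT Cy) (hP Cy).
rewrite (dfun_comp AC sPhi sU Ay) /comp1.
transitivity ((dfun U (Phi y) *m F^T *m
    (E *m dmap Phi y *m h (Phi y) *m F^T)^T) 0 i).
  by rewrite [RHS]mxmulE; apply: eq_bigr => a _; rewrite mxtrE.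
rewrite !trmx_mul trmxK (hT Cy) !mulmxA -(mulmxA _ F^T F) (frame_inv HF).
by rewrite (mulmxKV uH).
Qed.

Lemma cov2_codazzi_tensor y i j k : A y ->
  cov2 g codazzi_tensor y i j k = cov2 g Ric y i j k + cov2 g (hess g f) y i j k
    - (hess g f y i k * dfun f y 0 j + hess g f y j k * dfun f y 0 i)
    + g y i j * dfun kappa y 0 k.
Proof.
move=> Ay; rewrite (cov2D _ _ _ _ smooth_soliton (smooth_mxZ skappa gS) Ay).
rewrite (cov2B _ _ _ _ sRH sdd Ay).
rewrite (cov2D _ _ _ _ smooth_ric_phi (smooth_hess gS gT gU sf) Ay).
by rewrite (cov2_outer g _ _ _ sf Ay) (cov2_metric gS gT gU _ _ _ skappa Ay).
Qed.

Lemma cotton_phiE y i j k : A y ->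
  cotton_phi g h alpha Phi y i j k = cov2 g Ric y i j k - cov2 g Ric y i k j
    - (2 * (dim - 1))^-1 * (g y i j * dfun S y 0 k - g y i k * dfun S y 0 j).
Proof.
move=> Ay; pose sg z := S z / (2 * (dim - 1)).
have ssg : smooth A sg by apply: smoothM (smooth_scal_phi) (smooth_cst _ _).
have dsg l : dfun sg y 0 l = (2 * (dim - 1))^-1 * dfun S y 0 l.
  rewrite [LHS]mxE [in RHS]mxE (pdM l smooth_scal_phi (smooth_cst A _) Ay).
  by rewrite pd_cst mulr0 addr0 mulrC.
have D a b c : cov2 g (schouten_phi g h alpha Phi) y a b c =
    cov2 g Ric y a b c - g y a b * dfun sg y 0 c.
  rewrite (cov2B _ _ _ _ smooth_ric_phi (smooth_mxZ ssg gS) Ay).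
  by rewrite (cov2_metric gS gT gU _ _ _ ssg Ay).
by rewrite /cotton_phi !D !dsg; ring.
Qed.

Lemma grad_frame (E T : 'M[R]_m.+3) y k : orthonormal_frame (g y) E ->
  \sum_l comp1 E (dfun f y) l * comp2 E T l k = comp1 E (grad g f y *m T) k.
Proof.
move=> EG; rewrite /grad -(frame_inv EG) /comp1 /comp2.
by rewrite -mxmulE !mulmxA.
Qed.

Hypothesis CPF : forall x, A x -> CPF_at g h alpha Phi U f mu pr x.

Lemma codazzi_tensor_codazzi y : A y -> forall i j k,
  cov2 g codazzi_tensor y i j k = cov2 g codazzi_tensor y i k j.
Proof.
move=> Ay i j k; have Cy := AC Ay.
have [E EG] := exists_orthonormal_frame (gT Ay) (gP Ay).
have [F FH] := exists_orthonormal_frame (hT Cy) (hP Cy).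
have [H0 _] := CPF Ay; have [eq1 _] := H0 E F EG FH.
pose X a b c := cov2 g codazzi_tensor y a b c - cov2 g codazzi_tensor y a c b.
suff : forall a b c, X a b c = 0 by move=> /(_ i j k)/eqP;
  rewrite subr_eq0 => /eqP.
(* The system is stated in orthonormal frames, so the vanishing of [X] is tested on its components
   there. *)
apply: (@comp3_eq0 _ _ E (frame_unit EG) X) => {}i {}j {}k;
  rewrite [RHS](eq1 i j k) => {eq1}.
pose G' := g y; pose H := hess g f y; pose d := dfun f y; pose dS := dfun S y.
pose c1 := (2 * (dim - 1))^-1.
have HS a b : H a b = H b a by rewrite /H -[in LHS](hess_sym gT sf Ay) mxtrE.
transitivity (comp3 E (fun a b c => cotton_phi g h alpha Phi y a b c
   + (cov2 g (hess g f) y a b c - cov2 g (hess g f) y a c b)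
   - (H a c * d 0 b - H a b * d 0 c)
   + (G' a b * (c1 *: dS + dfun kappa y) 0 c
      - G' a c * (c1 *: dS + dfun kappa y) 0 b)) i j k).
  apply: eq_bigr => a _; apply: eq_bigr => b _; apply: eq_bigr => c _.
  congr (_ * _); rewrite /X !cov2_codazzi_tensor// cotton_phiE// -/H -/d -/G'.
  (* The derivative of df (x) df contains the product f_bc f_a, which is symmetric in the last two
     indices and cancels in [X]. *)
  rewrite (HS c b).
  have w e : (c1 *: dS + dfun kappa y) 0 e = c1 * dS 0 e + dfun kappa y 0 e.
    by rewrite !mxE.
  by rewrite !w /c1 -/dS; ring.
rewrite comp3_codazzi !(metric_frame EG) dfun_kappa//.
rewrite !(comp1D, comp1Z, comp1N) -!(Uphi_frame E _ Ay FH) !(grad_frame _ _ EG).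
rewrite /c1 /H /d /dS -/dim -/S.
move: (comp1 E (dfun f y)) (comp2 E (hess g f y)) (comp1 E (dfun S y))
  (comp1 E (dfun mu y)) (comp1 E (dfun (lap g f) y))
  (comp1 E (grad g f y *m hess g f y)) (comp3 E (cotton_phi g h alpha Phi y))
  (comp3 E (cov2 g (hess g f) y)) => f1 f2 s' mu' l' fH K L.
move: (\sum_a comp1 F (dfun U (Phi y)) a * dphi_comp h Phi E F y a j)
  (\sum_a comp1 F (dfun U (Phi y)) a * dphi_comp h Phi E F y a k) => uj uk.
have := dim0; have := dim1; move: (dim) => D D1 D0.
by field; rewrite D0 D1.
Qed.

Hypothesis Z0 : forall x, A x -> traceless x = 0.

Lemma dfun_potential y : A y -> dfun potential y = 0.
Proof.
move=> Ay; have sK : smooth A (fun z => dim^-1 * potential z).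
  by apply: smoothM; [exact: smooth_cst|exact: smooth_potential].
have BE z : A z -> codazzi_tensor z = (dim^-1 * potential z) *: g z.
  move=> Az; have := traceless_codazzi z; rewrite Z0// => /eqP.
  by rewrite eq_sym subr_eq0 => /eqP.
pose w := dfun (fun z => dim^-1 * potential z) y.
have gw i j k : g y i j * w 0 k = g y i k * w 0 j.
  have := codazzi_tensor_codazzi Ay i j k; rewrite !(eq_cov2 _ _ _ _ BE Ay).
  by rewrite !(cov2_metric gS gT gU _ _ _ sK Ay).
have w0 k : w 0 k = 0.
  (* Raising [i] in [gw] to an index [j] different from [k] leaves [w 0 k] on one side and zero on
     the other. *)
  have [j jk] : exists j : 'I_m.+3, j != k.
    have [->|k0] := eqVneq k ord0; first by exists ord_max.
    by exists ord0; rewrite eq_sym.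
  have I1 a b : \sum_i invmx (g y) a i * g y i b = (a == b)%:R.
    by rewrite -mxmulE mulVmx ?gU// mxE.
  transitivity ((\sum_i invmx (g y) j i * g y i j) * w 0 k).
    by rewrite I1 eqxx mul1r.
  rewrite mulr_suml.
  under eq_bigr do rewrite -mulrA gw mulrA.
  by rewrite -mulr_suml I1 (negbTE jk) mul0r.
apply/rowP => k; rewrite [RHS]mxE dfunE; have := w0 k.
rewrite /w dfunE (pdZ _ k smooth_potential Ay) => /eqP.
by rewrite mulf_eq0 invr_eq0 (negbTE dim0) => /eqP.
Qed.

Lemma ric_phi_soliton y : A y ->
  Ric y = (dim^-1 * soliton_trace y) *: g y - hess g f y + (dfun f y)^T *m dfun
    f y.
Proof.
move=> Ay; have /eqP := Z0 Ay; rewrite subr_eq0 => /eqP <-.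
by rewrite /soliton addrAC subrK addrK.
Qed.

Lemma grad_metric u y : A y -> grad g u y *m g y = dfun u y.
Proof. by move=> Ay; rewrite /grad mulmxKV// gU. Qed.

Lemma grad_ric_phi y : A y -> grad g f y *m Ric y =
  (dim^-1 * soliton_trace y + norm_grad2 g f y) *: dfun f y
  - grad g f y *m hess g f y.
Proof.
move=> Ay; rewrite ric_phi_soliton// mulmxDr mulmxBr -scalemxAr grad_metric//.
rewrite mulmxA [grad g f y *m (dfun f y)^T]mx11_scalar mul_scalar_mx.
by rewrite scalerDl addrAC.
Qed.

(* The second equation says that [exp(-f)] times this function is constant. *)
Definition first_integral y : R :=
  lapf g f y - (dim - 1)^-1 * (S y - dim * (mu y + pr y)).

Lemma smooth_first_integral : smooth A first_integral.
Proof.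
apply: smoothB; first exact: (smooth_lapf gS gT gU sf).
apply: smoothM; first exact: smooth_cst.
apply: smoothB; first exact: smooth_scal_phi.
by apply: smoothM; [exact: smooth_cst|exact: smoothD].
Qed.

Lemma dfun_pressure y : A y -> dfun pr y = (mu y + pr y) *: dfun f y.
Proof.
move=> Ay; have [_ [_ eq4]] := CPF Ay.
move/eqP: eq4; rewrite eq_sym subr_eq0 => /eqP eq4.
by rewrite -(grad_metric pr Ay) eq4 -scalemxAl grad_metric.
Qed.

Lemma dfun_first_integral y : A y ->
  dfun first_integral y = first_integral y *: dfun f y.
Proof.
move=> Ay; have Cy := AC Ay.
have [E EG] := exists_orthonormal_frame (gT Ay) (gP Ay).
have [F FH] := exists_orthonormal_frame (hT Cy) (hP Cy).
have [H0 _] := CPF Ay; have [_ eq2] := H0 E F EG FH.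
have sS := smooth_scal_phi.
have sL : smooth A (lap g f) := smooth_gtrace gS gU (smooth_hess gS gT gU sf).
have sN := smooth_norm_grad2 gS gU sf.
have sLf := smooth_lapf gS gT gU sf.
have smp := smoothD smu spr.
have sdmp := smoothM (smooth_cst A dim) smp.
have dQ : dfun first_integral y = dfun (lap g f) y
    - 2 *: (grad g f y *m hess g f y)
    - (dim - 1)^-1 *: (dfun S y - dim *: (dfun mu y + dfun pr y)).
  apply/rowP => k; rewrite dfunE.
  rewrite (pdB k sLf (smoothM (smooth_cst A _) (smoothB sS sdmp)) Ay).
  rewrite (pdB k sL sN Ay) (pd_norm_grad2 gS gT gU k sf Ay).
  rewrite (pdZ _ k (smoothB sS sdmp) Ay) (pdB k sS sdmp Ay) (pdZ _ k smp Ay).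
  by rewrite (pdD k smu spr Ay) !(mxaddE, mxoppE, mxscaleE, dfunE).
(* The vanishing differential of [potential] eliminates U from the second equation. *)
have dU : dfun Uphi y = 2^-1 *: dfun S y - dfun mu y.
  have := dfun_potential Ay; have s2 := smoothM (smooth_cst A (2^-1 : R)) sS.
  move=> /rowP dP; apply/rowP => k; have := dP k; rewrite dfunE [RHS]mxE.
  rewrite (pdB k (smoothB s2 smooth_Uphi) smu Ay) (pdB k s2 smooth_Uphi Ay).
  rewrite (pdZ _ k sS Ay) !(mxaddE, mxoppE, mxscaleE, dfunE) => H; lra.
apply/eqP; rewrite -subr_eq0; apply/eqP.
apply: (comp1_eq0 (frame_unit EG)) => i; have := eq2 i.
rewrite (Uphi_frame E _ Ay FH) dU dQ dfun_pressure// (grad_frame _ _ EG).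
under eq_bigr do rewrite (comp2_sym E _ _ (ric_phi_sym Ay)).
rewrite (grad_frame _ _ EG) grad_ric_phi// !(comp1D, comp1Z, comp1N).
rewrite -/dim -/S /first_integral /soliton_trace /lapf.
move: (comp1 E (dfun f y) i) (comp1 E (dfun S y) i) (comp1 E (dfun mu y) i)
  (comp1 E (dfun (lap g f) y) i) (comp1 E (grad g f y *m hess g f y) i)
  (lap g f y) (norm_grad2 g f y) (S y) (mu y) (pr y) =>
    f1 s' mu' l' fH l q s u p H.
(* After substitution for Ric^phi, the differential of Delta_f f has the coefficient -(m-1)/m in the
   second equation; the factor -m/(m-1) normalises it to 1. *)
rewrite -[RHS](mulr0 (- dim / (dim - 1))) H.
have := dim0; have := dim1; move: (dim) => D D1 D0.
by field; rewrite D0 D1.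
Qed.

End LocalEquations.

(** * Locally constant functions *)

Section LocallyConstant.
Context {R : realType} {m : nat}.
Variable A : opens R m.
Implicit Types u v : 'rV[R]_m -> R.

Lemma is_derive_expR_comp u x i : smooth A u -> A x ->
  is_derive x (delta_mx 0 i) (fun y => expR (u y)) (expR (u x) * pd i u x).
Proof.
move=> su Ax; set e := delta_mx 0 i.
have du : derivable u (x + 0 *: e) e.
  by rewrite scale0r addr0; exact: smooth_derivable su Ax.
have := derivable_line du; rewrite scale0r addr0 -/(pd i u x) => dl.
have [] : is_derive (0 : R) 1 (expR \o (fun s => u (x + s *: e)))
    (expR (u x) * pd i u x).
  apply: is_derive1_comp; rewrite /= scale0r addr0; exact: is_derive_expR.
rewrite /derivable /derive /=.
have -> : (fun h : R => h^-1 *: (expR (u (x + (h *: 1 + 0) *: e))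
      - expR (u (x + 0 *: e))))
    = (fun h => h^-1 *: (((fun y => expR (u y)) \o shift x) (h *: e) - expR (u
      x))).
  apply/funext => h /=; rewrite scale0r !addr0 [h *: (1 : R)]mulr1.
  by rewrite [x + _]addrC.
by move=> d1 d2; apply: DeriveDef.
Qed.

Lemma exp_first_integral u v x i : smooth A u -> smooth A v -> A x ->
  dfun u x = u x *: dfun v x ->
  is_derive x (delta_mx 0 i) (fun y => u y * expR (- v y)) 0.
Proof.
move=> su sv Ax uv; have sNv := smoothN sv.
have [d1 d2] := is_derive_expR_comp i sNv Ax.
have du : derivable u x (delta_mx 0 i) by exact: smooth_derivable su Ax.
apply: DeriveDef; first exact: (derivableM du d1).
transitivity (pd i u x * expR (- v x) + u x * pd i (fun y => expR (- v y)) x).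
  exact: (derivable_pdM du d1).
rewrite [pd i _ x in X in _ + X]d2 (@pdN _ _ A v x i sv Ax).
have := congr1 (fun w : 'rV_m => w 0 i) uv; rewrite mxscaleE !dfunE => ->.
by ring.
Qed.

(** On a box inside [A], [box_MVT] expresses the increments of [u] through partial derivatives, all
    of which vanish. *)
Lemma zero_pd_locally_constant u x :
  (forall y i, A y -> is_derive y (delta_mx 0 i) u 0) -> A x ->
  \forall y \near x, u y = u x.
Proof.
move=> du Ax; have /nbhs_boxP[r r0 xrA] := opens_near Ax.
apply/nbhs_boxP; exists r => // y xy.
have Az (z : 'rV[R]_m) : (forall j, `|z 0 j - x 0 j| <= `|y 0 j - x 0 j|) -> A
  z.
  by move=> zy; apply: xrA => j; apply: le_lt_trans (zy j) (xy j).
have [|z zP E] := @box_MVT _ _ u x y.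
  by move=> z /Az Az' i; have [] := du z i Az'.
apply/eqP; rewrite -subr_eq0 E big1// => i _.
have [_ d0] := du (z i) i (Az _ (zP i)).
by rewrite /pd d0 mulr0.
Qed.

End LocallyConstant.

Lemma connected_locally_constant (T : topologicalType) (X : Type) (F : T -> X) :
  connected [set: T] -> (forall p, \forall q \near p, F q = F p) ->
  forall p q, F q = F p.
Proof.
move=> cT Floc p q; pose B := [set q | F q = F p].
have oB : open B.
  by rewrite openE => z Bz; apply: filterS (Floc z) => w wz; rewrite /B /= wz.
have cB : closed B.
  rewrite -[B]setCK closedC openE => z nBz.
  by apply: filterS (Floc z) => w wz Bw; apply: nBz; rewrite /B /= -wz.
have BT : B = [set: T].
  apply: cT; first by exists p.
  - by exists B; rewrite ?setTI.
  - by exists B; rewrite ?setTI.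
by have : B q by rewrite BT.
Qed.

(** * Manifolds *)

Definition opensI (R : realType) (m : nat) (A B : opens R m) : opens R m :=
  Opens (openI (@opens_open _ _ A) (@opens_open _ _ B)).

Section Charts.
Context {R : realType} {m : nat} (M : manifold R m).
Implicit Types (i j : midx M) (O : set M).

(** Covers both kinds of domains defined as direct images: [trans_dom], with [O] another chart
    domain, and [map_dom], with [O] a preimage under the map. *)
Lemma chart_preimageP i O x :
  (cmap (mchart i) @` (cdom (mchart i) `&` O)) x <->
  cimg (mchart i) x /\ O (cinv (mchart i) x).
Proof.
have [_ _ ck _ _] := mchartP i; split.
  by move=> [p [pi Op] <-]; split; [exists p|rewrite ck].
by move=> [[p pi <-]]; rewrite ck// => Op; exists p.
Qed.

Lemma cinv_dom i x : cimg (mchart i) x -> cdom (mchart i) (cinv (mchart i) x).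
Proof. by have [_ _ ck _ _] := mchartP i => -[p pi <-]; rewrite ck. Qed.

Lemma cinvK i x : cimg (mchart i) x -> cmap (mchart i) (cinv (mchart i) x) = x.
Proof. by have [_ _ ck _ _] := mchartP i => -[p pi <-]; rewrite ck. Qed.

Lemma open_chart_image i O : open O ->
  open (cmap (mchart i) @` (cdom (mchart i) `&` O)).
Proof.
move=> oO; have [_ oi _ _ ci] := mchartP i.
rewrite openE => x /chart_preimageP[xi Ox].
have n1 : \forall y \near x, cimg (mchart i) y by move: oi; rewrite openE;
  exact.
have n2 : \forall y \near x, O (cinv (mchart i) y).
  by apply: (ci x xi); move: oO; rewrite openE; exact.
apply: filterS2 n1 n2 => y yi Oy.
exact/chart_preimageP.
Qed.

Definition chart_image i : opens R m :=
  Opens (let: And5 _ o _ _ _ := mchartP i in o).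

Lemma open_cdom i : open (cdom (mchart i)).
Proof. by have [] := mchartP i. Qed.

Definition overlap i j : opens R m := Opens (open_chart_image (i := i)
  (open_cdom j)).

Lemma overlapP i j x : overlap i j x <->
  cimg (mchart i) x /\ cdom (mchart j) (cinv (mchart i) x).
Proof. exact: chart_preimageP. Qed.

Lemma cinv_trans i j x : overlap i j x ->
  cinv (mchart j) (trans (mchart i) (mchart j) x) = cinv (mchart i) x.
Proof. by have [_ _ ck _ _] := mchartP j => /overlapP[_ /ck]. Qed.

Lemma trans_img i j x : overlap i j x ->
  chart_image j (trans (mchart i) (mchart j) x).
Proof. by move=> /overlapP[_ xj]; exists (cinv (mchart i) x). Qed.

Lemma smooth_trans i j a :
  smooth (overlap i j) (fun x => trans (mchart i) (mchart j) x 0 a).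
Proof. by split; exact: mcompat. Qed.

Lemma rep_trans (u : M -> R) i j x : overlap i j x ->
  rep u i x = rep u j (trans (mchart i) (mchart j) x).
Proof. by move=> xij; rewrite /rep cinv_trans. Qed.

Lemma smooth_rep (u : M -> R) i : smooth_fun u ->
  smooth (chart_image i) (rep u i).
Proof. by move=> su; split; exact: su. Qed.

End Charts.

(** * The metric in charts *)

Section Metrics.
Context {R : realType} {m : nat} (M : riemannian R m).
Implicit Types i j : midx M.

Lemma smooth_metric i : smooth_mx (chart_image i) (metric i).
Proof. by move=> a b; split; have [[+ _] _] := metricP M; exact. Qed.

Lemma metric_trmx i x : chart_image i x -> (metric i x)^T = metric i x.
Proof. by have [_ H] := metricP M => /H[]. Qed.

Lemma metric_posdef i x : chart_image i x -> posdef (metric i x).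
Proof. by have [_ H] := metricP M => /H[]. Qed.

Lemma metric_unit i x : chart_image i x -> metric i x \in unitmx.
Proof. by move=> xi; exact: posdef_unit (metric_trmx xi) (metric_posdef xi).
  Qed.

Lemma metric_trans i j x : overlap i j x ->
  metric i x = dmap (trans (mchart i) (mchart j)) x
    *m metric j (trans (mchart i) (mchart j) x)
    *m (dmap (trans (mchart i) (mchart j)) x)^T.
Proof. by have [[_ H] _] := metricP M; exact: H. Qed.

End Metrics.

(** * Maps between manifolds and their behaviour under changes of charts *)

Section Maps.
Context {R : realType} {m n : nat}.
Variables (M : riemannian R m) (N : riemannian R n) (phi : M -> N).
Hypothesis phi_smooth : smooth_map phi.
Implicit Types (i j : midx M) (b c : midx N).

Lemma open_phi b : open (phi @^-1` cdom (mchart b)).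
Proof.
have [cphi _] := phi_smooth.
by move: cphi => /continuousP; apply; exact: open_cdom.
Qed.

Definition map_opens i b : opens R m := Opens (open_chart_image (i := i)
  (open_phi b)).

Lemma map_opensP i b x : map_opens i b x <->
  cimg (mchart i) x /\ cdom (mchart b) (phi (cinv (mchart i) x)).
Proof. exact: chart_preimageP. Qed.

Lemma smooth_map_rep i b a :
  smooth (map_opens i b) (fun x => map_rep phi i b x 0 a).
Proof. by split; have [_] := phi_smooth; exact. Qed.

Lemma map_rep_img i b x : map_opens i b x -> chart_image b (map_rep phi i b x).
Proof. by move=> /map_opensP[_ xb]; exists (phi (cinv (mchart i) x)). Qed.

Lemma map_opens_img i b x : map_opens i b x -> chart_image i x.
Proof. by move=> /map_opensP[]. Qed.

(** The Jacobian that the chain rule adds to the differential on either side is absorbed by the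
    transformation law of the metric of [N]. *)
Lemma pullback_target i b c x : map_opens i b x -> map_opens i c x ->
  pullback (metric b) (map_rep phi i b) x = pullback (metric c) (map_rep phi i
    c) x.
Proof.
move=> xb xc; pose A := opensI (map_opens i b) (map_opens i c).
have AO y : A y -> overlap b c (map_rep phi i b y).
  move=> [/map_opensP[yi yb] /map_opensP[_ yc]]; apply/overlapP; split.
    by exists (phi (cinv (mchart i) y)).
  by have [_ _ ck _ _] := mchartP b; rewrite /map_rep ck.
have Ax : A x by split.
have sA a : smooth A (fun y => map_rep phi i b y 0 a).
  by apply: smooth_sub (smooth_map_rep i b a) => y [].
have E y : A y -> map_rep phi i c y =
    trans (mchart b) (mchart c) (map_rep phi i b y).
  move=> [/map_opensP[yi yb] _]; rewrite /trans /map_rep.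
  by have [_ _ ck _ _] := mchartP b; rewrite ck.
rewrite /pullback (eq_dmap E Ax) (dmap_comp AO sA (smooth_trans b c) Ax).
by rewrite (metric_trans (AO _ Ax)) (E _ Ax) trmx_mul !mulmxA.
Qed.

Lemma pullback_source i j b x : overlap i j x -> map_opens i b x ->
  pullback (metric b) (map_rep phi i b) x =
  dmap (trans (mchart i) (mchart j)) x
  *m pullback (metric b) (map_rep phi j b) (trans (mchart i) (mchart j) x)
  *m (dmap (trans (mchart i) (mchart j)) x)^T.
Proof.
move=> xij xb; pose A := opensI (overlap i j) (map_opens i b).
have Ax : A x by split.
set t := trans (mchart i) (mchart j).
have At y : A y -> map_opens j b (t y).
  move=> [yij /map_opensP[_ yb]]; apply/map_opensP.
  by rewrite cinv_trans//; split=> //; exact: trans_img.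
have sA a : smooth A (fun y => t y 0 a).
  by apply: smooth_sub (smooth_trans i j a) => y [].
have E y : A y -> map_rep phi i b y = map_rep phi j b (t y).
  by move=> [yij _]; rewrite /map_rep cinv_trans.
rewrite /pullback (eq_dmap E Ax) (dmap_comp At sA (smooth_map_rep j b) Ax).
by rewrite (E _ Ax) trmx_mul !mulmxA.
Qed.

Variable alpha : R.
Let ricphi i b := ric_phi (metric i) (metric b) alpha (map_rep phi i b).
Let scalphi i b := scal_phi (metric i) (metric b) alpha (map_rep phi i b).

Lemma ric_phi_target i b c x : map_opens i b x -> map_opens i c x ->
  ricphi i b x = ricphi i c x.
Proof. by move=> xb xc; rewrite /ricphi /ric_phi (pullback_target xb xc). Qed.

Lemma scal_phi_target i b c x : map_opens i b x -> map_opens i c x ->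
  scalphi i b x = scalphi i c x.
Proof.
move=> xb xc; have := ric_phi_target xb xc.
by rewrite /scalphi /scal_phi /gtrace /ricphi => ->.
Qed.

Section Overlap.
Variables (i j : midx M).
Let t := trans (mchart i) (mchart j).

Lemma overlap_img x : overlap i j x -> chart_image i x.
Proof. by move=> /overlapP[]. Qed.

Let gT y (yij : overlap i j y) := metric_trmx (overlap_img yij).
Let gU y (yij : overlap i j y) := metric_unit (overlap_img yij).

Lemma ric_phi_source b x : overlap i j x -> map_opens i b x ->
  ricphi i b x = dmap t x *m ricphi j b (t x) *m (dmap t x)^T.
Proof.
move=> xij xb; rewrite /ricphi /ric_phi (pullback_source xij xb) -/t.
have gS : smooth_mx (overlap i j) (metric i).
  by move=> a c; apply: smooth_sub (smooth_metric i a c) => y /overlap_img.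
have -> := ric_change (@trans_img _ _ _ i j) (smooth_trans i j) gS gT gU
  (smooth_metric j) (@metric_trmx _ _ M j) (@metric_unit _ _ M j)
  (@metric_trans _ _ M i j) xij.
by rewrite mulmxBr mulmxBl -scalemxAr -scalemxAl.
Qed.

Lemma scal_phi_source b x : overlap i j x -> map_opens i b x ->
  scalphi i b x = scalphi j b (t x).
Proof.
move=> xij xb.
exact: (gtrace_change (@trans_img _ _ _ i j) gU (@metric_unit _ _ M j)
  (@metric_trans _ _ M i j) xij (ric_phi_source xij xb)).
Qed.

Variables (f : M -> R) (f_smooth : smooth_fun f).

Lemma hess_source x : overlap i j x ->
  hess (metric i) (rep f i) x =
  dmap t x *m hess (metric j) (rep f j) (t x) *m (dmap t x)^T.
Proof.
move=> xij.
exact: (hess_change (@trans_img _ _ _ i j) (smooth_trans i j) gT gU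
  (smooth_metric j) (@metric_trmx _ _ M j) (@metric_unit _ _ M j)
  (@metric_trans _ _ M i j) (smooth_rep j f_smooth)
  (@rep_trans _ _ M f i j) xij).
Qed.

Lemma lapf_source x : overlap i j x ->
  lapf (metric i) (rep f i) x = lapf (metric j) (rep f j) (t x).
Proof.
move=> xij.
exact: (lapf_change (@trans_img _ _ _ i j) (smooth_trans i j) gT gU
  (smooth_metric j) (@metric_trmx _ _ M j) (@metric_unit _ _ M j)
  (@metric_trans _ _ M i j) (smooth_rep j f_smooth)
  (@rep_trans _ _ M f i j) xij).
Qed.

Lemma dfun_source x : overlap i j x ->
  dfun (rep f i) x = dfun (rep f j) (t x) *m (dmap t x)^T.
Proof.
move=> xij; rewrite (eq_dfun (@rep_trans _ _ M f i j) xij).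
exact: (dfun_comp (@trans_img _ _ _ i j) (smooth_trans i j)
  (smooth_rep j f_smooth) xij).
Qed.

End Overlap.
End Maps.

(** * The global argument *)

Lemma soliton_congruence (R : realType) (m : nat) (J A B G : 'M[R]_m)
    (d : 'rV[R]_m) c :
  J *m A *m J^T + J *m B *m J^T - J *m d^T *m (d *m J^T) - c *: (J *m G *m J^T)
    =
  J *m (A + B - d^T *m d - c *: G) *m J^T.
Proof.
rewrite !mulmxBr mulmxDr !mulmxBl mulmxDl !mulmxA.
by rewrite -!scalemxAr -!scalemxAl.
Qed.

Section GlobalSolution.
Context {R : realType} {m n : nat}.
Variables (M : riemannian R m.+3) (N : riemannian R n) (phi : M -> N).
Hypothesis phi_smooth : smooth_map phi.
Variables (alpha : R) (U : N -> R) (f mu pr : M -> R).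
Hypotheses (U_smooth : smooth_fun U) (f_smooth : smooth_fun f)
  (mu_smooth : smooth_fun mu) (pr_smooth : smooth_fun pr).
Implicit Types (i j : midx M) (b c : midx N).

Let O := map_opens phi_smooth.
Let Z i b := traceless (metric i) (metric b) alpha (map_rep phi i b) (rep f i).
Let pot i b :=
  potential (metric i) (metric b) alpha (map_rep phi i b) (rep U b) (rep mu i).
Let Q i b := first_integral (metric i) (metric b) alpha (map_rep phi i b)
  (rep f i) (rep mu i) (rep pr i).

Let AC i b x (xb : O i b x) : chart_image b (map_rep phi i b x) :=
  map_rep_img xb.

Let gS i b : smooth_mx (O i b) (metric i).
Proof. by move=> p q; apply: smooth_sub (smooth_metric i p q) =>
  y /map_opens_img. Qed.

Let gT i b y (yb : O i b y) := metric_trmx (map_opens_img yb).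
Let gP i b y (yb : O i b y) := metric_posdef (map_opens_img yb).
Let gU i b y (yb : O i b y) := metric_unit (map_opens_img yb).

Let s_rep (u : M -> R) i b : smooth_fun u -> smooth (O i b) (rep u i).
Proof. by move=> su; apply: smooth_sub (smooth_rep i su) =>
  y /map_opens_img. Qed.

Lemma traceless_target i b c x : O i b x -> O i c x -> Z i b x = Z i c x.
Proof.
move=> xb xc; have E1 := ric_phi_target alpha xb xc.
have E2 := scal_phi_target alpha xb xc.
by rewrite /Z /traceless /soliton /soliton_trace E1 E2.
Qed.

Lemma traceless_source i j b x : overlap i j x -> O i b x ->
  let t := trans (mchart i) (mchart j) in
  Z i b x = dmap t x *m Z j b (t x) *m (dmap t x)^T.
Proof.
move=> xij xb t; have E1 := ric_phi_source alpha xij xb.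
have E2 := scal_phi_source alpha xij xb.
rewrite /Z /traceless /soliton /soliton_trace E1 E2.
rewrite (hess_source f_smooth xij) (lapf_source f_smooth xij).
rewrite (dfun_source f_smooth xij) -/t (metric_trans xij) -/t trmx_mul trmxK.
exact: soliton_congruence.
Qed.

(* Some chart of N around the image of the point; irrelevant by
   [traceless_target]. *)
Let target i (x : 'rV[R]_m.+3) : midx N :=
  projT1 (cid (mcover (phi (cinv (mchart i) x)))).

Let targetP i x : cimg (mchart i) x -> O i (target i x) x.
Proof.
by move=> xi; apply/map_opensP; split=> //; exact: projT2 (cid (mcover _)).
Qed.

Let P i x := Z i (target i x) x.

Let PE i b x : O i b x -> P i x = Z i b x.
Proof.
by move=> xb; exact: traceless_target (targetP (map_opens_img xb)) xb.
Qed.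

Lemma trans_map_opens i j b x : overlap i j x -> O i b x ->
  O j b (trans (mchart i) (mchart j) x).
Proof.
move=> xij /map_opensP[_ xb]; apply/map_opensP.
by rewrite cinv_trans//; split=> //; exact: trans_img.
Qed.

Lemma traceless_S20 : S20 P.
Proof.
have sZ i b : smooth_mx (O i b) (Z i b) := smooth_traceless alpha (@AC i b)
  (smooth_map_rep phi_smooth i b) (@gS i b) (@gT i b) (@gP i b)
  (smooth_metric b) (s_rep i b f_smooth).
split; last first.
  move=> i x xi; have xb := targetP xi; split.
    exact: (traceless_sym alpha (@AC i _) (@gS i _) (@gT i _) (@gP i _)
      (@metric_trmx _ _ N _) (s_rep i _ f_smooth) xb).
  rewrite /gtrace (PE xb).
  exact: (gtrace_traceless (metric (target i x)) alpha
    (map_rep phi i (target i x)) (rep f i) (@gT i _) (@gP i _) xb).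
split.
  move=> i a c s x xi; set b := target i x.
  have xb : O i b x := targetP xi.
  (* The chart of [N] selected by [target] may jump from point to point, but on the whole of [O i b]
     the field equals [Z i b] with [b] fixed. *)
  have [H] : smooth (O i b) (fun x => P i x a c).
    by apply: eq_smooth (sZ i b a c) => y /PE ->.
  exact: H.
move=> i j x xij t; have xij' : overlap i j x by [].
have xb := targetP (overlap_img xij').
have E1 := PE xb; have E2 := PE (trans_map_opens xij' xb).
apply: (etrans E1); rewrite E2.
exact: (traceless_source xij' xb).
Qed.

Lemma zero_S20 : S20 (fun (_ : midx M) _ => 0).
Proof.
split; last by move=> i x _; rewrite trmx0 /gtrace mulmx0 mxtrace0.
split; last by move=> i j x _ t; rewrite mulmx0 mul0mx.
move=> i a c; have [H] := smooth_cst (chart_image i) (0 : R).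
by under eq_fun do rewrite mxE; exact: H.
Qed.

Lemma WstarS0 v W (E : 'M[R]_m.+3) I (l : 'I_m.+3) : WstarS v W E 0 I l = 0.
Proof.
rewrite /WstarS big1// => p _; rewrite big1// => q _.
by rewrite /comp2 mulmx0 mul0mx mxE mulr0.
Qed.

Hypothesis CPF : CphiPF_system phi alpha U f mu pr.
Variables (s : midx M -> 'rV[R]_m.+3 -> R).
Hypothesis W_inj : Wstar_injective s.

Let localCPF i b x : O i b x -> CPF_at (metric i) (metric b) alpha
  (map_rep phi i b) (rep U b) (rep f i) (rep mu i) (rep pr i) x.
Proof. exact: CPF. Qed.

Lemma traceless_eq0 i b x : O i b x -> Z i b x = 0.
Proof.
move=> xb; rewrite -(PE xb); have xi := map_opens_img xb.
(* Injectivity compares two global fields; the second one is the zero field. *)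
apply: (W_inj traceless_S20 zero_S20) xi => {}i {b xb}{}x E I j xi EG.
rewrite WstarS0; set b := target i x; have xb : O i b x := targetP xi.
rewrite /P -/b /Z (traceless_codazzi _ _ _ _ (rep U b) _ (rep mu i)).
have sT := smooth_codazzi_tensor alpha (@AC i b)
  (smooth_map_rep phi_smooth i b) (@gS i b) (@gT i b) (@gP i b)
  (smooth_metric b) (smooth_rep b U_smooth) (s_rep i b f_smooth)
  (s_rep i b mu_smooth).
have cT y (yb : O i b y) := codazzi_tensor_codazzi (@AC i b)
  (smooth_map_rep phi_smooth i b) (@gS i b) (@gT i b) (@gP i b)
  (smooth_metric b) (@metric_trmx _ _ N b) (@metric_posdef _ _ N b)
  (smooth_rep b U_smooth) (s_rep i b f_smooth)
  (s_rep i b mu_smooth) (@localCPF i b) yb.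
have TT := codazzi_tensor_sym alpha (rep U b) (rep mu i) (@AC i b) (@gS i b)
  (@gT i b) (@gP i b) (@metric_trmx _ _ N b) (s_rep i b f_smooth) xb.
apply: (codazzi_WstarS (@gS i b) (@gT i b) (@gU i b)) sT cT xb TT EG _.
by rewrite size_tuple -addn3 addnK.
Qed.

Lemma dfun_potential_eq0 i b x : O i b x -> dfun (pot i b) x = 0.
Proof.
exact: (dfun_potential (@AC i b)
  (smooth_map_rep phi_smooth i b) (@gS i b) (@gT i b) (@gP i b)
  (smooth_metric b) (@metric_trmx _ _ N b) (@metric_posdef _ _ N b)
  (smooth_rep b U_smooth) (s_rep i b f_smooth)
  (s_rep i b mu_smooth) (@localCPF i b) (@traceless_eq0 i b)).
Qed.

Lemma dfun_first_integral_global i b x : O i b x ->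
  dfun (Q i b) x = Q i b x *: dfun (rep f i) x.
Proof.
exact: (dfun_first_integral (@AC i b)
  (smooth_map_rep phi_smooth i b) (@gS i b) (@gT i b) (@gP i b)
  (smooth_metric b) (@metric_trmx _ _ N b) (@metric_posdef _ _ N b)
  (smooth_rep b U_smooth) (s_rep i b f_smooth)
  (s_rep i b mu_smooth) (s_rep i b pr_smooth)
  (@localCPF i b) (@traceless_eq0 i b)).
Qed.

Hypothesis M_connected : connected [set: M].

(** The two compatibility conditions make [F] a function on [M], read off at each point through
    arbitrarily chosen charts. It is locally constant, and connectedness concludes. *)
Lemma constant_of_charts (F : midx M -> midx N -> 'rV[R]_m.+3 -> R) :
  (forall i b c x, O i b x -> O i c x -> F i b x = F i c x) ->
  (forall i j b x, overlap i j x -> O i b x ->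
    F i b x = F j b (trans (mchart i) (mchart j) x)) ->
  (forall i b x k, O i b x -> is_derive x (delta_mx 0 k) (F i b) 0) ->
  exists L, forall i b x, O i b x -> F i b x = L.
Proof.
move=> Ft Fs dF.
pose ix (p : M) := projT1 (cid (mcover p)).
have ixP p : cdom (mchart (ix p)) p := projT2 (cid (mcover p)).
pose G p := F (ix p) (target (ix p) (cmap (mchart (ix p)) p)) (cmap (mchart (ix
  p)) p).
have GE i b p : cdom (mchart i) p -> cdom (mchart b) (phi p) ->
    G p = F i b (cmap (mchart i) p).
  move=> pi pb; set j := ix p; set y := cmap (mchart j) p.
  have yj : cimg (mchart j) y by exists p => //; exact: ixP.
  have cy : cinv (mchart j) y = p.
    by have [_ _ ck _ _] := mchartP j; rewrite ck//; exact: ixP.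
  have yb : O j b y by apply/map_opensP; rewrite cy.
  have yji : overlap j i y by apply/overlapP; rewrite cy.
  rewrite /G -/j -/y (Ft _ _ b _ (targetP yj) yb) (Fs j i b y yji yb).
  by rewrite /trans cy.
have Gloc p : \forall q \near p, G q = G p.
  have pi := ixP p; set i := ix p in pi.
  have [b pb] := mcover (phi p).
  have [_ _ ck cc _] := mchartP i.
  have xb : O i b (cmap (mchart i) p).
    by apply/map_opensP; rewrite ck//; split=> //; exists p.
  have n0 := zero_pd_locally_constant (fun y k yb => dF i b y k yb) xb.
  have n1 : \forall q \near p, F i b (cmap (mchart i) q) = F i b (cmap (mchart
    i) p).
    exact: (cc p pi) _ n0.
  have n2 : \forall q \near p, cdom (mchart i) q.
    by have := open_cdom i; rewrite openE; exact.
  have n3 : \forall q \near p, cdom (mchart b) (phi q).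
    by have := open_phi phi_smooth b; rewrite openE; exact.
  apply: filterS3 n1 n2 n3 => q q1 q2 q3.
  by rewrite (GE i b q q2 q3) (GE i b p pi pb).
have Gc := connected_locally_constant M_connected Gloc.
(* The constant is the value at a base point; when [M] is empty, 0 serves. *)
have [[p0 _]|nM] := pselect (exists p : M, True); last first.
  by exists 0 => i b x _; case: nM; exists (cinv (mchart i) x).
exists (G p0) => i b x xb; rewrite -(Gc p0 (cinv (mchart i) x)).
have [xi pb] := (map_opensP _ _ _ _).1 xb.
by rewrite (GE i b) ?cinvK//; exact: cinv_dom.
Qed.

Lemma phiPF_of_CphiPF : exists L1 L2, phiPF_system phi alpha U f mu pr L1 L2.
Proof.
have Qt i b c x : O i b x -> O i c x -> Q i b x = Q i c x.
  move=> xb xc; rewrite /Q /first_integral.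
  by rewrite (scal_phi_target alpha xb xc).
have Qs i j b x : overlap i j x -> O i b x ->
    Q i b x = Q j b (trans (mchart i) (mchart j) x).
  move=> xij xb; rewrite /Q /first_integral (lapf_source f_smooth xij).
  rewrite (scal_phi_source alpha xij xb).
  by rewrite (rep_trans mu xij) (rep_trans pr xij).
have sQ i b : smooth (O i b) (Q i b).
  exact: (smooth_first_integral alpha (@AC i b)
    (smooth_map_rep phi_smooth i b) (@gS i b) (@gT i b) (@gP i b)
    (smooth_metric b) (s_rep i b f_smooth) (s_rep i b mu_smooth)
    (s_rep i b pr_smooth)).
have [L1 L1P] : exists L, forall i b x, O i b x -> Q i b x * expR (- rep f i x)
  = L.
  apply: constant_of_charts => [i b c x xb xc|i j b x xij xb|i b x k xb].
  - by rewrite (Qt i b c).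
  - by rewrite (Qs i j b) ?(rep_trans f xij).
  - exact: exp_first_integral (sQ i b) (s_rep i b f_smooth) xb
      (dfun_first_integral_global xb).
have [L2 L2P] : exists L, forall i b x, O i b x -> pot i b x = L.
  apply: constant_of_charts => [i b c x xb xc|i j b x xij xb|i b x k xb].
  - rewrite /pot /potential (scal_phi_target alpha xb xc) /rep /map_rep.
    have [xi xb'] := (map_opensP _ _ _ _).1 xb.
    have [_ xc'] := (map_opensP _ _ _ _).1 xc.
    have [_ _ ckb _ _] := mchartP b; have [_ _ ckc _ _] := mchartP c.
    by rewrite ckb// ckc.
  - rewrite /pot /potential (scal_phi_source alpha xij xb).
    by rewrite (rep_trans mu xij) /map_rep cinv_trans.
  - have sp : smooth (O i b) (pot i b) := smooth_potential alpha (@AC i b)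
      (smooth_map_rep phi_smooth i b) (@gS i b) (@gT i b) (@gP i b)
      (smooth_metric b) (smooth_rep b U_smooth) (s_rep i b mu_smooth).
    apply: DeriveDef; first exact: smooth_derivable sp xb.
    by have := congr1 (fun w : 'rV_m.+3 => w 0 k) (dfun_potential_eq0 xb);
      rewrite dfunE mxE.
exists L1, L2 => i b x xb0; have xb : O i b x by [].
have [_ [eq3 eq4]] := localCPF xb.
split.
- have /eqP := traceless_eq0 xb; rewrite /Z subr_eq0 => /eqP.
  by [].
- have := L1P i b x xb; rewrite /Q /first_integral => <-.
  by rewrite -mulrA -expRD addNr expR0 mulr1 addrC subrK.
- apply/eqP; rewrite -subr_eq0 opprD addrA; apply/eqP.
  by rewrite -eq3.
- by have := L2P i b x xb; rewrite /pot /potential => <-; ring.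
- by rewrite -[LHS]opprB -eq4 oppr0.
Qed.

End GlobalSolution.

Theorem theorem6p6 (R : realType) (m n : nat) (hm : (2 < m)%N)
    (M : riemannian R m) (N : riemannian R n)
    (M_connected : connected [set: M])
    (s : midx M -> 'rV[R]_m -> R) (M_oriented : is_orientation s)
    (phi : M -> N) (phi_smooth : smooth_map phi)
    (alpha : R) (alpha_neq0 : alpha != 0)
    (U : N -> R) (U_smooth : smooth_fun U)
    (f mu pr : M -> R)
    (f_smooth : smooth_fun f) (mu_smooth : smooth_fun mu)
    (pr_smooth : smooth_fun pr)
    (f_CphiPF : CphiPF_system phi alpha U f mu pr)
    (W_injective : Wstar_injective s) :
  exists L1 L2 : R, phiPF_system phi alpha U f mu pr L1 L2.
Proof.
(* The bound on the dimension gives it the form [m'.+3], in which the lists [I] in [Wstar_injective]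
   have length [m']. *)
case: m hm M M_connected s M_oriented phi phi_smooth f mu pr f_smooth mu_smooth
  pr_smooth f_CphiPF W_injective => [|[|[|m']]] // _ M M_connected s _ phi
  phi_smooth f mu pr f_smooth mu_smooth pr_smooth f_CphiPF W_injective.
exact: (phiPF_of_CphiPF phi_smooth U_smooth f_smooth mu_smooth pr_smooth
  f_CphiPF W_injective M_connected).
Qed.
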